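(* Let $m\ge2$ be even and $0\le i\le m-2$. Let $K^i_{+,m}(\underline{x},\underline{y})=\tilde f_m^i(s,t)+\hat f_m^i(s,t)+(\underline{x}\wedge\underline{y})g_m^i(s,t)$ and $\mathcal{F}^i_{+,m}[f](\underline{y})=(2\pi)^{-m/2}\int_{\mathbb{R}^m}K^i_{+,m}(\underline{x},\underline{y})f(\underline{x})\,dV(\underline{x})$. Then for all $p,k\in\mathbb{N}$ and admissible $\ell$: If $i$ is even: for $k$ even, $\mathcal{F}^i_{+,m}[\psi_{2p,k,\ell}]=(-1)^{m/2}\frac{(k+i-1)!!}{(k-i+m-3)!!}(-1)^p\psi_{2p,k,\ell}$ and $\mathcal{F}^i_{+,m}[\psi_{2p+1,k,\ell}]=\frac{(k+i-1)!!}{(k+m-i-3)!!}(-1)^p\psi_{2p+1,k,\ell}$; for $k$ odd, $\mathcal{F}^i_{+,m}[\psi_{2p,k,\ell}]=\frac{(k+i)!!}{(k+m-i-2)!!}(-1)^{p+1}\psi_{2p,k,\ell}$ and $\mathcal{F}^i_{+,m}[\psi_{2p+1,k,\ell}]=(-1)^{m/2}\frac{(k+i)!!}{(k-i+m-2)!!}(-1)^p\psi_{2p+1,k,\ell}$. If $i$ is odd: for $k$ even, $\mathcal{F}^i_{+,m}[\psi_{2p,k,\ell}]=\frac{(k+i)!!}{(k+m-i-2)!!}(-1)^{p+1}\psi_{2p,k,\ell}$ and $\mathcal{F}^i_{+,m}[\psi_{2p+1,k,\ell}]=(-1)^{m/2}\frac{(k+i)!!}{(k+m-i-2)!!}(-1)^{p+1}\psi_{2p+1,k,\ell}$;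 for $k$ odd, $\mathcal{F}^i_{+,m}[\psi_{2p,k,\ell}]=(-1)^{m/2}\frac{(k+i-1)!!}{(k+m-i-3)!!}(-1)^{p+1}\psi_{2p,k,\ell}$ and $\mathcal{F}^i_{+,m}[\psi_{2p+1,k,\ell}]=\frac{(k+i-1)!!}{(k+m-i-3)!!}(-1)^p\psi_{2p+1,k,\ell}$.
   Context: $\mathcal{C}l_{0,m}$ is the real Clifford algebra generated by $e_1,\dots,e_m$ with $e_ie_j+e_je_i=-2\delta_{ij}$; $\underline{x}=\sum_jx_je_j$, $\underline{x}\wedge\underline{y}=\sum_{j<k}e_je_k(x_jy_k-x_ky_j)$, $\partial_{\underline{x}}=\sum_je_j\partial_{x_j}$, $s=\langle\underline{x},\underline{y}\rangle$, $t=|\underline{x}\wedge\underline{y}|=\sqrt{|\underline{x}|^2|\underline{y}|^2-s^2}$, $\widetilde J_\alpha(t)=t^{-\alpha}J_\alpha(t)$ ($J_\alpha$ Bessel function). $\tilde f_m^i(s,t)=-\sqrt{\pi/2}\sum_{\ell=0}^{\lfloor (i-1)/2\rfloor}s^{i-1-2\ell}\frac{1}{2^\ell\ell!}\frac{\Gamma(i+1)}{\Gamma(i-2\ell)}\widetilde J_{(m-2\ell-3)/2}(t)$ for $i\ge1$, $\tilde f_m^0:=0$; $\hat f_m^i(s,t)=(-1)^{m/2+i}\sqrt{\pi/2}\sum_{\ell=0}^{\lfloor i/2\rfloor}s^{i-2\ell}\frac{1}{2^\ell\ell!}\frac{\Gamma(i+1)}{\Gamma(i+1-2\ell)}\widetilde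 J_{(m-2\ell-3)/2}(t)$; $g_m^i(s,t)=\sqrt{\pi/2}\sum_{\ell=0}^{\lfloor i/2\rfloor}s^{i-2\ell}\frac{1}{2^\ell\ell!}\frac{\Gamma(i+1)}{\Gamma(i+1-2\ell)}\widetilde J_{(m-2\ell-1)/2}(t)$. $\mathcal{M}_k$ is the space of spherical monogenics of degree $k$ (homogeneous $\mathcal{C}l_{0,m}$-valued polynomials $M$ of degree $k$ with $\partial_{\underline{x}}M=0$) with basis $M_k^{(\ell)}$; $\psi_{2p,k,\ell}(\underline{x})=L_p^{m/2+k-1}(|\underline{x}|^2)M_k^{(\ell)}(\underline{x})e^{-|\underline{x}|^2/2}$, $\psi_{2p+1,k,\ell}(\underline{x})=L_p^{m/2+k}(|\underline{x}|^2)\,\underline{x}\,M_k^{(\ell)}(\underline{x})e^{-|\underline{x}|^2/2}$, $L_p^\alpha$ generalized Laguerre polynomials. Double factorials: $u!!=u(u-2)\cdots$ down to $1$ or $2$, $0!!=(-1)!!=1$. *)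

(* Defs.v *)
From HB Require Import structures.
From mathcomp Require Import all_boot all_order all_algebra.
From mathcomp Require Import all_classical all_reals all_analysis.
Set Implicit Arguments. Unset Strict Implicit. Unset Printing Implicit Defensive.
Import Order.TTheory GRing.Theory Num.Theory.
Import numFieldNormedType.Exports.

Local Open Scope ring_scope.

Section Defs.
Variable R : realType.

Definition Gamma (x : R) : R :=
  fine (\int[lebesgue_measure]_(u in `]0%R, +oo[%classic) ((u `^ (x - 1)) * expR (- u))%:E)%E.

Definition tildeJ (a t : R) : R :=
  limn (fun N => \sum_(n < N)
     ((-1) ^+ n / ((n`!)%:R * Gamma (n%:R + a + 1) * (2 `^ (2 * n%:R + a))) * t ^+ (2 * n))).

Definition laguerre (p a : nat) (x : R) : R :=
  \sum_(j < p.+1) (-1) ^+ j * ('C(p + a, p - j))%:R * x ^+ j / (j`!)%:R.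

Fixpoint dfact (n : nat) : nat :=
  match n with 0 => 1 | 1 => 1 | (n'.+2) as n0 => n0 * dfact n' end.

Definition dfactz (z : int) : R :=
  match z with Posz n => (dfact n)%:R | Negz _ => 1 end.

Variable m : nat.

Definition Cl := {ffun {set 'I_m} -> R}.
Definition cl_blade (A : {set 'I_m}) : Cl := [ffun B => (B == A)%:R].
Definition cl_add (u v : Cl) : Cl := [ffun A => u A + v A].
Definition cl_scale (a : R) (u : Cl) : Cl := [ffun A => a * u A].
Definition cl_zero : Cl := [ffun _ => 0].
Definition cl_sgn (A B : {set 'I_m}) : R :=
  (-1) ^+ (#|[set q : 'I_m * 'I_m | [&& q.1 \in A, q.2 \in B & (q.2 < q.1)%N]]|
            + #|A :&: B|).
Definition cl_mul (u v : Cl) : Cl :=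
  [ffun C => \sum_(A : {set 'I_m}) \sum_(B : {set 'I_m})
     (if (A :\: B) :|: (B :\: A) == C then u A * v B * cl_sgn A B else 0)].
Definition cl_e (j : 'I_m) : Cl := cl_blade [set j].
Definition cl_scal (a : R) : Cl := cl_scale a (cl_blade finset.set0).
Definition cl_vec (x : 'rV[R]_m) : Cl :=
  [ffun A => \sum_(j < m) x 0 j * cl_e j A].
Definition cl_wedge (x y : 'rV[R]_m) : Cl :=
  [ffun A => \sum_(j < m) \sum_(k < m | (j < k)%N)
     (cl_mul (cl_e j) (cl_e k) A) * (x 0 j * y 0 k - x 0 k * y 0 j)].

Definition dotR (x y : 'rV[R]_m) : R := \sum_(j < m) x 0 j * y 0 j.
Definition sqnorm (x : 'rV[R]_m) : R := dotR x x.

Definition cl_partial (j : 'I_m) (M : 'rV[R]_m -> Cl) (x : 'rV[R]_m) : Cl :=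
  [ffun A => derive (fun y => M y A) x (delta_mx 0 j)].
Definition dirac (M : 'rV[R]_m -> Cl) (x : 'rV[R]_m) : Cl :=
  [ffun A => \sum_(j < m) cl_mul (cl_e j) (cl_partial j M x) A].

Definition hom_poly (k : nat) (M : 'rV[R]_m -> Cl) : Prop :=
  exists c : k.-tuple 'I_m -> Cl, forall x,
    M x = [ffun A => \sum_(s : k.-tuple 'I_m) (\prod_(r < k) x 0 (tnth s r)) * c s A].

Definition spherical_monogenic (k : nat) (M : 'rV[R]_m -> Cl) : Prop :=
  hom_poly k M /\ forall x, dirac M x = cl_zero.

End Defs.

Fixpoint intRn (R : realType) (n : nat) : ('rV[R]_n -> R) -> R :=
  match n return ('rV[R]_n -> R) -> R with
  | 0 => fun F => F 0
  | n'.+1 => fun F => Rintegral (@lebesgue_measure R) [set: R]%classic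
                (fun x : R => intRn (fun v : 'rV[R]_n' => F (row_mx (const_mx x : 'rV_1) v)))
  end.

Section Transform.
Variable R : realType.
Variable m : nat.

(* s = <x,y>, t = |x ^ y| = sqrt(|x|^2|y|^2 - s^2) *)
Definition s_of (x y : 'rV[R]_m) : R := dotR x y.
Definition t_of (x y : 'rV[R]_m) : R :=
  Num.sqrt (sqnorm x * sqnorm y - (dotR x y) ^+ 2).

Definition ftilde (i : nat) (s t : R) : R :=
  if i == 0%N then 0 else
  - Num.sqrt (pi / 2) * \sum_(l < ((i.-1)./2).+1)
      (s ^+ (i - 1 - 2 * l) / (2 ^+ l * (l`!)%:R)
       * (Gamma (i%:R + 1) / Gamma (i%:R - 2 * l%:R))
       * tildeJ ((m%:R - 2 * l%:R - 3) / 2) t).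

Definition fhat (i : nat) (s t : R) : R :=
  (-1) ^+ (m./2 + i) * Num.sqrt (pi / 2) * \sum_(l < (i./2).+1)
      (s ^+ (i - 2 * l) / (2 ^+ l * (l`!)%:R)
       * (Gamma (i%:R + 1) / Gamma (i%:R + 1 - 2 * l%:R))
       * tildeJ ((m%:R - 2 * l%:R - 3) / 2) t).

Definition gker (i : nat) (s t : R) : R :=
  Num.sqrt (pi / 2) * \sum_(l < (i./2).+1)
      (s ^+ (i - 2 * l) / (2 ^+ l * (l`!)%:R)
       * (Gamma (i%:R + 1) / Gamma (i%:R + 1 - 2 * l%:R))
       * tildeJ ((m%:R - 2 * l%:R - 1) / 2) t).

Definition Kplus (i : nat) (x y : 'rV[R]_m) : Cl R m :=
  cl_add (@cl_scal R m (ftilde i (s_of x y) (t_of x y) + fhat i (s_of x y) (t_of x y)))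
         (cl_scale (gker i (s_of x y) (t_of x y)) (cl_wedge x y)).

Definition Fplus (i : nat) (f : 'rV[R]_m -> Cl R m) (y : 'rV[R]_m) : Cl R m :=
  cl_scale ((2 * pi) `^ (- (m%:R / 2)))
    [ffun A => intRn (fun x => cl_mul (Kplus i x y) (f x) A)].

Definition psi_even (p k : nat) (M : 'rV[R]_m -> Cl R m) (x : 'rV[R]_m) : Cl R m :=
  cl_scale (laguerre p (m./2 + k - 1) (sqnorm x) * expR (- sqnorm x / 2)) (M x).

Definition psi_odd (p k : nat) (M : 'rV[R]_m -> Cl R m) (x : 'rV[R]_m) : Cl R m :=
  cl_scale (laguerre p (m./2 + k) (sqnorm x) * expR (- sqnorm x / 2))
           (cl_mul (cl_vec x) (M x)).
End Transform.

(* Main.v *)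
Require Import Defs.
From HB Require Import structures.
From mathcomp Require Import all_boot all_order all_algebra.
From mathcomp Require Import all_classical all_reals all_analysis.
From mathcomp Require Import measurable_realfun ring lra zify.
Set Implicit Arguments. Unset Strict Implicit. Unset Printing Implicit Defensive.
Import Order.TTheory GRing.Theory Num.Theory.
Import numFieldNormedType.Exports.
Local Open Scope classical_set_scope.
Local Open Scope ring_scope.

(* Put u = |y|^2 and let E be the mean for the standard Gaussian law, so that F[f](y) = E[K(x,y) g(x)]
   when f = g exp(-|x|^2/2).  The power series of the Bessel functions writes the kernel as a
   dominated series of polynomials in s and t^2, and E can be taken term by term.

   Let P_n be the part of Phi_i = sum_l i! / (2^l l! (i-2l)!) s^(i-2l) sqrt(pi/2) J~_((m-2l-3)/2)(t)
   that has degree n in x.  Gaussian integration by parts E[x_j P] = E[d_j P] gives, by induction on i,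
   that E[P_n H] = lambda_(i,k) H(y) times the coefficient of z^n in z^k exp(-u z^2/2), for every
   harmonic H homogeneous of degree k.  This covers fhat.  Multiplied by y on the left, the remaining
   part ftilde + (x ^ y) g of the kernel becomes -grad_x Phi_i, so another integration by parts reduces
   its mean against M and against xM to the scalar formula for xM and for M; the vector y is invertible
   unless y = 0, and that case is immediate.

   The factor L_p^a(|x|^2) multiplies the n-th term by a polynomial in n, and the identity
   sum_j (-2)^j C(p+a,p-j) C(N+a+j,j) = (-1)^p sum_j 2^j C(p+a,p-j) C(N,j)
   turns the resulting series into (-1)^p L_p^a(u) exp(-u/2). *)

(** Why left multiplication by y produces a gradient: y (x ^ y) = |y|^2 x - s y is half of grad_x
    t^2, and J~_a'(t) = - t J~_(a+1)(t) makes g, whose Bessel orders exceed those of Phi_i by one,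
    equal to -2 times the derivative of Phi_i in t^2; moreover ftilde is minus the derivative of
    Phi_i in s, and grad_x s = y. Evenness of m enters through m = 2h + 2: all orders are then
    half-integers h - l - 1/2, Gamma takes the values (2n-1)!! sqrt(pi) / 2^n there, and double
    factorials appear in the eigenvalues. The parity cases come from lambda_(i,k) = 0 for i + k odd:
    fhat and the rest of the kernel contribute lambda at the two consecutive degrees k and k+1, so
    one contribution always vanishes. The analytic obstacle is that the transform is an iterated
    one-dimensional integral. Limits are exchanged one coordinate at a time, so measurability of all
    partial integrals travels with a Gaussian domination. The bound C exp(e |x|^2) for every e > 0
    is available at fixed y because the Bessel coefficients carry two factorials in the
    denominator. *)

(** * Values of Gamma at integers and half-integers *)

Section GammaValues.
Variable R : realType.
Notation mu := (@lebesgue_measure R).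

Lemma FTC2_pointwise (f F : R -> R) (a b : R) : a < b ->
  (forall x, a <= x <= b -> is_derive x (1 : R) F (f x)) ->
  (forall x, a <= x <= b -> {for x, continuous f}) ->
  (\int[mu]_(x in `[a, b]) (f x)%:E = (F b - F a)%:E)%E.
Proof.
move=> ab dF cf; rewrite EFinB; apply: continuous_FTC2 => //.
- apply: continuous_in_subspaceT => x; rewrite inE/= in_itv/=; exact: cf.
- have dd x : a <= x <= b -> derivable F x 1 by move=> /dF [].
  have cF x : a <= x <= b -> {for x, continuous F}.
    by move=> /dd ?; apply/differentiable_continuous/derivable1_diffP.
  split.
  + by move=> x; rewrite in_itv/= => /andP[ax xb]; apply: dd; rewrite !ltW.
  + by apply: cvg_at_right_filter; apply: cF; rewrite lexx ltW.
  + by apply: cvg_at_left_filter; apply: cF; rewrite lexx ltW.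
- move=> x; rewrite in_itv/= => /andP[ax xb].
  have h := dF x; rewrite derive1E; apply: derive_val.
  by apply: h; rewrite !ltW.
Qed.

Definition gammaf (x u : R) : R := u `^ (x - 1) * expR (- u).

Lemma gammaf_ge0 x u : 0 <= gammaf x u.
Proof. by rewrite mulr_ge0 ?powR_ge0 ?expR_ge0. Qed.

Lemma is_derive_powR_gt0 (x u : R) : 0 < u ->
  is_derive u (1 : R) (fun u => u `^ x) (x * u `^ (x - 1)).
Proof.
move=> u0; apply: DeriveDef.
  by apply: derivable_powR; rewrite in_itv/= u0.
by rewrite -derive1E powR_derive1 // in_itv/= u0.
Qed.

Lemma gammaf_continuous (x u : R) : 0 < u -> {for u, continuous (gammaf x)}.
Proof.
move=> u0; apply/differentiable_continuous/derivable1_diffP.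
apply: derivableM.
  by apply: derivable_powR; rewrite in_itv/= u0.
have h : is_derive u (1 : R) (fun u => expR (- u)) (expR (- u) * -1).
  exact: (is_derive1_comp (f := expR) (g := -%R)).
by case: h.
Qed.

Lemma is_derive_gamma_primitive (x u : R) : 0 < u ->
  is_derive u (1 : R) (gammaf (x + 1)) (x * gammaf x u - gammaf (x + 1) u).
Proof.
move=> u0; have h := is_derive_powR_gt0 x u0.
have h2 : is_derive u (1 : R) (fun u => expR (- u)) (- expR (- u)).
  have := is_derive1_comp (f := expR) (g := -%R) (x := u).
  move=> /(_ (expR (-u)) (-1)); rewrite mulrN1; apply.
have -> : gammaf (x + 1) = (fun u => u `^ x) * (fun u => expR (- u)).
  by apply/funext => v; rewrite /gammaf addrK.
apply: is_derive_eq.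
have e (f g : R -> R) : (f * g) u = f u * g u by [].
rewrite e /gammaf /GRing.scale /=.
by ring.
Qed.

Lemma measurable_gammaf x D : measurable D -> measurable_fun D (gammaf x).
Proof.
move=> mD; apply: measurable_funTS; apply: measurable_funM.
  exact: measurable_powR.
apply: measurableT_comp => //.
Qed.

Lemma itv_exhaust (a b : nat -> R) :
  (forall n, 0 < a n) -> nonincreasing_seq a -> a @ \oo --> 0 ->
  nondecreasing_seq b -> b @ \oo --> +oo ->
  \bigcup_n [set` `[a n, b n]] = `]0, +oo[%classic.
Proof.
move=> a0 da a_0 ib boo; apply/seteqP; split => x /=.
  by move=> [n _] /=; rewrite !in_itv/= andbT => /andP[h _]; exact: lt_le_trans h.
rewrite in_itv/= andbT => x0.
have : \forall n \near \oo, a n <= x /\ x <= b n.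
  near=> n; split; near: n.
    have /cvgrPdist_le/(_ _ x0) := a_0; apply: filterS => n.
    by rewrite sub0r normrN gtr0_norm.
  by move/cvgryPge : boo; exact.
by move=> [N _ /(_ N (leqnn N)) [h1 h2]]; exists N => //=; rewrite in_itv/= h1 h2.
Unshelve. all: by end_near. Qed.

(** Monotone convergence. The half-line is reached through compact intervals because the fundamental
    theorem of calculus and the substitution rule are applied there. *)
Lemma integral_exhaust (f : R -> R) (a b : nat -> R) :
  measurable_fun setT f -> (forall u, 0 <= f u) ->
  (forall n, 0 < a n) -> nonincreasing_seq a -> a @ \oo --> 0 ->
  nondecreasing_seq b -> b @ \oo --> +oo ->
  (\int[mu]_(u in `[a n, b n]) (f u)%:E)%E @[n --> \oo] -->
  (\int[mu]_(u in `]0%R, +oo[) (f u)%:E)%E.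
Proof.
move=> mf f0 a0 da a_0 ib boo; rewrite -(itv_exhaust a0 da a_0 ib boo).
apply: ge0_nondecreasing_set_cvg_integral => //.
- move=> m n mn; rewrite subsetEset => u /=; rewrite !in_itv/= => /andP[h1 h2].
  by rewrite (le_trans (da _ _ mn) h1) (le_trans h2 (ib _ _ mn)).
- by move=> n; apply/measurable_EFinP; exact: measurable_funTS.
- by move=> n u _; rewrite lee_fin.
Qed.

Lemma gamma_exhaust x (a b : nat -> R) :
  (forall n, 0 < a n) -> nonincreasing_seq a -> a @ \oo --> 0 ->
  nondecreasing_seq b -> b @ \oo --> +oo ->
  (\int[mu]_(u in `[a n, b n]) (gammaf x u)%:E)%E @[n --> \oo] -->
  (\int[mu]_(u in `]0%R, +oo[) (gammaf x u)%:E)%E.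
Proof.
apply: integral_exhaust; first exact: measurable_gammaf.
exact: gammaf_ge0.
Qed.

Lemma gammaf_cvg0 (x : R) : 0 < x -> gammaf (x + 1) v @[v --> 0^'+] --> 0.
Proof.
move=> x0; rewrite -[X in _ --> X](mul0r (expR (- 0))).
rewrite /gammaf; under eq_fun do rewrite addrK.
apply: cvgM; first exact: powR_cvg0.
apply: cvg_at_right_filter.
apply: (cvg_comp (fun v : R => - v) expR); last exact: continuous_expR.
exact: cvgN.
Qed.

Lemma gammaf_cvgy (x : R) : gammaf x n.+1%:R @[n --> \oo] --> 0.
Proof.
(* With N >= x one has v^(x-1) <= v^N for v >= 1, and exp v >= v^(N+1) / (N+1)! leaves the bound
   (N+1)! / v. *)
pose N := `|Num.ceil x|%N.
have hb n : gammaf x n.+1%:R <= (N.+1)`!%:R * n.+1%:R^-1.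
  have p0 : 0 < n.+1%:R :> R by [].
  rewrite /gammaf expRN ler_pdivrMr ?expR_gt0//.
  have h1 : n.+1%:R `^ (x - 1) <= n.+1%:R ^+ N :> R.
    rewrite -powR_mulrn//; apply: ler_powR; first by rewrite ler1n.
    rewrite lerBlDr; apply: (le_trans (ceil_ge x)).
    rewrite ler_wpDr //.
    by rewrite (le_trans (ler_norm _)) // -intr_norm -[`|_|%R]abszE pmulrn lexx.
  apply: (le_trans h1).
  rewrite mulrAC ler_pdivlMr// -exprSr.
  have := @expR_ge1Dxn R n.+1%:R N (ltW p0).
  move=> h; rewrite mulrC -ler_pdivrMr ?ltr0n ?fact_gt0//.
  by apply: le_trans h; rewrite lerDr.
apply: (@squeeze_cvgr _ _ _ _ (fun=> 0) (fun n => (N.+1)`!%:R * n.+1%:R^-1)).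
- by near=> n; rewrite gammaf_ge0 hb.
- exact: cvg_cst.
- rewrite -[X in _ --> X](mulr0 (N.+1)`!%:R); apply: cvgMr.
  exact: cvg_harmonic.
Unshelve. all: by end_near. Qed.

Let a n : R := n.+2%:R^-1.
Let b n : R := n.+1%:R.

Lemma a_nonincreasing : nonincreasing_seq a.
Proof. by move=> m n mn; rewrite lef_pV2 ?posrE// ler_nat !ltnS. Qed.

Lemma a_cvg0 : a @ \oo --> 0.
Proof.
by have := @cvg_harmonic R; rewrite -(cvg_shiftS (@harmonic R)); apply.
Qed.

Lemma b_nondecreasing : nondecreasing_seq b.
Proof. by move=> m n mn; rewrite ler_nat ltnS. Qed.

Lemma b_cvgy : b @ \oo --> +oo.
Proof. by rewrite (cvg_shiftS (fun n => n%:R : R)); exact: cvgr_idn. Qed.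

(** Integration by parts on compact intervals; the limit is taken in the extended reals, before
    [fine] is applied. *)
Lemma GammaD1 (x : R) : 0 < x -> Gamma (x + 1) = x * Gamma x.
Proof.
move=> x0.
have a0 n : 0 < a n by rewrite invr_gt0.
have ab n : a n < b n.
  by apply: (@lt_le_trans _ _ 1); rewrite ?invf_lt1 ?ltr1n ?ler1n.
have E1 n : (x%:E * \int[mu]_(u in `[a n, b n]) (gammaf x u)%:E =
   (gammaf (x + 1) (b n) - gammaf (x + 1) (a n))%:E +
   \int[mu]_(u in `[a n, b n]) (gammaf (x + 1) u)%:E)%E.
  have pos u : a n <= u <= b n -> 0 < u.
    by case/andP => h _; exact: lt_le_trans h.
  have ig z : mu.-integrable `[a n, b n] (EFin \o gammaf z).
    apply: continuous_compact_integrable; first exact: segment_compact.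
    apply: continuous_in_subspaceT => u; rewrite inE/= in_itv/= => /pos.
    exact: gammaf_continuous.
  have dg u : a n <= u <= b n ->
      is_derive u (1 : R) (gammaf (x + 1)) (x * gammaf x u - gammaf (x + 1) u).
    by move=> /pos; exact: is_derive_gamma_primitive.
  rewrite -(FTC2_pointwise (ab n) dg).
  - have -> : (\int[mu]_(u in `[a n, b n]) (x * gammaf x u - gammaf (x + 1) u)%:E =
       \int[mu]_(u in `[a n, b n]) (x%:E * (gammaf x u)%:E - (gammaf (x + 1) u)%:E))%E.
      by apply: eq_integral => u _; rewrite EFinB EFinM.
    rewrite integralB//; [|by apply: integrableZl => //; exact: ig|exact: ig].
    rewrite integralZl//; last exact: ig.
    rewrite subeK//.
    by apply: integrable_fin_num => //; exact: ig.
  - move=> u /pos u0; apply: cvgB; last exact: gammaf_continuous.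
    by apply: cvgMr; exact: gammaf_continuous.
have L1 := @gamma_exhaust x _ _ a0 a_nonincreasing a_cvg0 b_nondecreasing b_cvgy.
have L2 := @gamma_exhaust (x + 1) _ _ a0 a_nonincreasing a_cvg0 b_nondecreasing b_cvgy.
have E : (x%:E * \int[mu]_(u in `]0%R, +oo[) (gammaf x u)%:E =
  \int[mu]_(u in `]0%R, +oo[) (gammaf (x + 1) u)%:E)%E.
  have L1' := cvgeZl (y := x%:E) isT L1.
  move: L1'; under eq_fun do rewrite E1.
  move=> L1'; apply: (cvg_unique _ L1') => //=.
  rewrite -[X in _ --> X]add0e; apply: cvgeD => //.
  apply: cvg_EFin; first by near=> n.
  rewrite -[0]subr0; apply: cvgB; first exact: gammaf_cvgy.
  have /cvg_at_rightP := gammaf_cvg0 x0; apply; split => //; exact: a_cvg0.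
rewrite /Gamma -[in LHS]/(\int[mu]_(u in `]0%R, +oo[) (gammaf (x + 1) u)%:E)%E.
rewrite -E.
rewrite -[in RHS]/(\int[mu]_(u in `]0%R, +oo[) (gammaf x u)%:E)%E.
(* By positivity the value is finite or +oo; in the case +oo both sides become 0 under [fine], since
   x > 0. *)
have : (0 <= \int[mu]_(u in `]0%R, +oo[) (gammaf x u)%:E)%E.
  by apply: integral_ge0 => u _; rewrite lee_fin gammaf_ge0.
case: (\int[mu]_(u in `]0%R, +oo[) (gammaf x u)%:E)%E => //= _.
by rewrite gt0_muley// ?lte_fin//= mulr0.
Unshelve. all: by end_near. Qed.

Lemma Gamma1 : Gamma 1 = 1 :> R.
Proof.
have a0 n : 0 < a n by rewrite invr_gt0.
have ab n : a n < b n.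
  by apply: (@lt_le_trans _ _ 1); rewrite ?invf_lt1 ?ltr1n ?ler1n.
have L := @gamma_exhaust 1 _ _ a0 a_nonincreasing a_cvg0 b_nondecreasing b_cvgy.
have g1 u : gammaf 1 u = expR (- u) by rewrite /gammaf subrr powRr0 mul1r.
rewrite /Gamma.
suff -> : (\int[mu]_(u in `]0%R, +oo[) (gammaf 1 u)%:E = 1%:E)%E by [].
have E n : (\int[mu]_(u in `[a n, b n]) (gammaf 1 u)%:E =
            (expR (- a n) - expR (- b n))%:E)%E.
  have dg u : a n <= u <= b n ->
      is_derive u (1 : R) (fun u => - expR (- u)) (gammaf 1 u).
    move=> _; rewrite g1.
    have h : is_derive u (1 : R) (fun u => expR (- u)) (expR (- u) * -1).
      exact: (is_derive1_comp (f := expR) (g := -%R)).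
    by apply: is_derive_eq; ring.
  rewrite (FTC2_pointwise (ab n) dg).
  - by congr EFin; ring.
  - by move=> u /andP[h _]; apply: gammaf_continuous; exact: lt_le_trans h.
move: L; under eq_fun do rewrite E.
move=> L; apply: (cvg_unique _ L) => //=.
apply: cvg_EFin; first by near=> n.
rewrite -[1]subr0; apply: cvgB; last first.
  apply: (cvg_comp b (fun x => expR (- x)) b_cvgy); exact: cvgr_expR.
rewrite -[X in _ --> X]expR0 -oppr0.
apply: (@cvg_comp _ _ _ (fun n => - a n) expR); last exact: continuous_expR.
by apply: cvgN; exact: a_cvg0.
Unshelve. all: by end_near. Qed.

Lemma Gamma_nat n : Gamma n.+1%:R = n`!%:R :> R.
Proof.
elim: n => [|n ih]; first by rewrite Gamma1.
by rewrite -natr1 GammaD1 // ih -natrM.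
Qed.

(** The substitution u = v^2 turns the integral over [a_n^2, b_n^2] into twice the Gaussian integral
    over [a_n, b_n]. *)
Lemma Gamma_half : Gamma (1 / 2) = Num.sqrt pi :> R.
Proof.
pose a2 n := a n ^+ 2; pose b2 n := b n ^+ 2.
have a0 n : 0 < a n by rewrite invr_gt0.
have ab n : a n < b n.
  by apply: (@lt_le_trans _ _ 1); rewrite ?invf_lt1 ?ltr1n ?ler1n.
have L : (\int[mu]_(u in `[a2 n, b2 n]) (gammaf (1 / 2) u)%:E)%E @[n --> \oo] -->
  (\int[mu]_(u in `]0%R, +oo[) (gammaf (1 / 2) u)%:E)%E.
  apply: gamma_exhaust.
  - by move=> n; rewrite exprn_gt0.
  - move=> m n mn; rewrite ler_pXn2r ?nnegrE ?(ltW (a0 _))//.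
    exact: a_nonincreasing.
  - rewrite -[X in _ --> X](mul0r 0); have -> : a2 = a * a by apply/funext => n; rewrite /a2 expr2.
    by apply: cvgM; exact: a_cvg0.
  - move=> m n mn; rewrite ler_pXn2r ?nnegrE//.
    exact: b_nondecreasing.
  - have h : forall n, b n <= b2 n.
      by move=> n; rewrite /b2 expr2 ler_peMr// ler1n.
    by apply: (ger_cvgy _ b_cvgy); near=> n; exact: h.
have mg : measurable_fun setT (fun x : R => 2 * gauss_fun x).
  by apply: measurable_funM => //; exact: measurable_gauss_fun.
have L2 := @integral_exhaust _ a b mg (fun x => mulr_ge0 (ler0n _ 2) (gauss_fun_ge0 x))
  a0 a_nonincreasing a_cvg0 b_nondecreasing b_cvgy.
have E n : (\int[mu]_(u in `[a2 n, b2 n]) (gammaf (1 / 2) u)%:E =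
  \int[mu]_(u in `[a n, b n]) (2 * gauss_fun u)%:E)%E.
  have dsq (x : R) : is_derive x (1 : R) (fun x => x ^+ 2) (2 * x).
    have := @is_deriveX _ _ (@id R) 1 x 1 1 (is_derive_id _ _).
    by move=> h; apply: is_derive_eq; rewrite /GRing.scale /=; ring.
  have dsqE : (fun x : R => x ^+ 2)^`()%classic = (fun x => 2 * x).
    by apply/funext => x; rewrite derive1E; apply: derive_val.
  have csq (x : R) : {for x, continuous (fun x : R => x ^+ 2)}.
    exact: sqr_continuous.
  have c2 (x : R) : {for x, continuous (fun x : R => 2 * x)}.
    by apply: cvgMr; exact: cvg_id.
  rewrite (@integration_by_substitution_increasing _ (fun x : R => x ^+ 2))//.
  - apply: eq_integral => x; rewrite inE/= in_itv/= => /andP[ax _].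
    have x0 : 0 < x by exact: lt_le_trans ax.
    congr EFin; rewrite dsqE.
    rewrite -[LHS]/(gammaf (1/2) (x^+2) * (2 * x)) /gammaf /gauss_fun.
    have -> : 1 / 2 - 1 = - 2^-1 :> R by lra.
    rewrite powRN powR12_sqrt ?sqr_ge0// sqrtr_sqr gtr0_norm//.
    by field; rewrite gt_eqF.
  - exact: ltW.
  - move=> x y; rewrite !in_itv/= => /andP[ax _] /andP[ay _] xy.
    by rewrite ltr_pXn2r// nnegrE ltW// (lt_le_trans (a0 n)).
  - by rewrite dsqE => x _; exact: c2.
  - by rewrite dsqE; apply: cvgP; apply: cvg_at_right_filter; exact: c2.
  - by rewrite dsqE; apply: cvgP; apply: cvg_at_left_filter; exact: c2.
  - split.
    + by move=> x _; have [] := dsq x.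
    + by apply: cvg_at_right_filter; exact: csq.
    + by apply: cvg_at_left_filter; exact: csq.
  - apply: continuous_in_subspaceT => u; rewrite inE/= in_itv/= => /andP[h _].
    apply: gammaf_continuous; apply: lt_le_trans h; exact: exprn_gt0.
rewrite /Gamma.
suff -> : (\int[mu]_(u in `]0%R, +oo[) (gammaf (1 / 2) u)%:E = (Num.sqrt pi)%:E)%E by [].
move: L; under eq_fun do rewrite E.
move=> L; rewrite -(cvg_unique _ L2 L)//.
rewrite integral_itv_obnd_cbnd; last by apply/measurable_EFinP/measurable_funTS.
under eq_integral do rewrite EFinM.
rewrite ge0_integralZl//.
- rewrite integral0y_gauss.
  by rewrite -EFinM; congr EFin; field.
- by apply/measurable_EFinP/measurable_funTS; exact: measurable_gauss_fun.
- by move=> x _; rewrite lee_fin gauss_fun_ge0.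
Unshelve. all: by end_near. Qed.

Lemma dfactS n : dfact n.+2 = (n.+2 * dfact n)%N.
Proof. by []. Qed.

Lemma dfact_gt0 n : (0 < dfact n)%N.
Proof.
suff : (0 < dfact n)%N /\ (0 < dfact n.+1)%N by case.
elim: n => [//|n [h1 h2]]; split => //.
by rewrite dfactS muln_gt0.
Qed.

Lemma Gamma_half_odd n :
  Gamma (n%:R + 1 / 2) = (dfact (n.*2.-1))%:R * Num.sqrt pi / 2 ^+ n :> R.
Proof.
elim: n => [|n ih]; first by rewrite add0r Gamma_half expr0 divr1 mul1r.
have -> : n.+1%:R + 1 / 2 = (n%:R + 1 / 2) + 1 :> R by rewrite -natr1; lra.
rewrite GammaD1 ?ih; last by rewrite ltr_wpDl.
have -> : dfact (n.+1).*2.-1 = ((n.*2.+1) * dfact n.*2.-1)%N.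
  by case: n {ih} => // n; rewrite doubleS.
have e : n.*2.+1%:R = 2 * n%:R + 1 :> R by rewrite -natr1 -mul2n (natrM R 2).
rewrite exprS (natrM R n.*2.+1) e; field.
by rewrite expf_neq0.
Qed.

End GammaValues.

(** * Gaussian moments in one variable *)

Section Gaussian1D.
Variable R : realType.
Notation mu := (@lebesgue_measure R).

Definition gexp (a x : R) : R := expR (- (a * x ^+ 2)).

Lemma gexp_ge0 a x : 0 <= gexp a x. Proof. exact: expR_ge0. Qed.

Lemma normal_pdf_gexp (a x : R) : 0 < a ->
  gexp a x = (normal_peak (Num.sqrt (a *+ 2)^-1))^-1 * normal_pdf 0 (Num.sqrt (a *+ 2)^-1) x.
Proof.
move=> a0.
have a2 : 0 < (a *+ 2)^-1 by rewrite invr_gt0 mulrn_wgt0.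
have s0 : Num.sqrt (a *+ 2)^-1 != 0 by rewrite gt_eqF// sqrtr_gt0.
rewrite normal_pdfE //= mulKf; last by rewrite gt_eqF// normal_peak_gt0.
rewrite /gexp /normal_fun subr0 sqr_sqrtr ?ltW//; congr expR.
have -> : (a *+ 2)^-1 *+ 2 = a^-1.
  by rewrite -[LHS]mulr_natr -[a *+ 2]mulr_natr invfM mulrVK// unitfE pnatr_eq0.
by rewrite invrK mulNr mulrC.
Qed.

Lemma integrable_gexp (a : R) : 0 < a -> mu.-integrable setT (EFin \o gexp a).
Proof.
move=> a0.
have -> : EFin \o gexp a = (fun x => (normal_peak (Num.sqrt (a *+ 2)^-1))^-1%:E *
   (normal_pdf 0 (Num.sqrt (a *+ 2)^-1) x)%:E)%E.
  by apply/funext => x; rewrite /= (normal_pdf_gexp _ a0) EFinM.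
by apply: integrableZl => //; exact: integrable_normal_pdf.
Qed.

Lemma Rintegral_gexp_half : \int[mu]_(x in setT) gexp (1 / 2) x = Num.sqrt (2 * pi).
Proof.
have a0 : 0 < 1 / 2 :> R by lra.
rewrite /Rintegral.
have -> : (\int[mu]_(x in setT) (gexp (1 / 2) x)%:E =
   \int[mu]_(x in setT) ((normal_peak (Num.sqrt ((1 / 2) *+ 2)^-1))^-1%:E *
   (normal_pdf 0 (Num.sqrt ((1 / 2) *+ 2)^-1) x)%:E))%E.
  by apply: eq_integral => x _; rewrite (normal_pdf_gexp _ a0) EFinM.
rewrite integralZl//; last exact: integrable_normal_pdf.
rewrite integral_normal_pdf mule1 /= /normal_peak invrK; congr Num.sqrt.
have -> : (1 / 2) *+ 2 = 1 :> R by lra.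
by rewrite invr1 sqrtr1 expr1n mul1r mulr_natl.
Qed.

(** The bound |x|^d <= 1 + x^(2d) makes the power even, and then (e x^2)^d / d! <= exp(e x^2). *)
Lemma normrX_le_gexp (e : R) (d : nat) : 0 < e ->
  exists2 C, 0 <= C & forall x : R, `|x ^+ d| <= C * expR (e * x ^+ 2).
Proof.
move=> e0; exists (1 + d`!%:R / e ^+ d).
  by rewrite addr_ge0// divr_ge0// exprn_ge0// ltW.
move=> x; rewrite normrX.
have xe : 0 <= e * x ^+ 2 by rewrite mulr_ge0 ?sqr_ge0// ltW.
have h1 : `|x| ^+ d <= 1 + (x ^+ 2) ^+ d.
  rewrite -[x ^+ 2]real_normK ?num_real// -exprM mul2n -addnn exprD.
  set t := `|x| ^+ d; have t0 : 0 <= t by rewrite exprn_ge0.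
  by nra.
apply: (le_trans h1); rewrite mulrDl mul1r; apply: lerD.
  by rewrite -expR0 ler_expR.
rewrite mulrAC ler_pdivlMr ?exprn_gt0// -exprMn (mulrC (x ^+ 2)).
case: d {h1} => [|d]; first by rewrite fact0 mul1r expr0 -expR0 ler_expR.
rewrite -ler_pdivrMl ?ltr0n ?fact_gt0// mulrC (mulrC (x ^+ 2)).
by apply: le_trans (expR_ge1Dxn d xe); rewrite [leLHS]mulrC lerDr.
Qed.

Definition gmom (d : nat) : R := \int[mu]_(x in setT) (x ^+ d * gexp (1 / 2) x).

Lemma continuous_Xgexp d : continuous (fun x : R => x ^+ d * gexp (1 / 2) x).
Proof.
move=> x; apply: cvgM; first exact: exprn_continuous.
apply: (@cvg_comp _ _ _ (fun x : R => - (1 / 2 * x ^+ 2)) expR); last exact: continuous_expR.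
by apply: cvgN; apply: cvgMr; exact: exprn_continuous.
Qed.

Lemma Xgexp_bound d : exists2 C, 0 <= C &
  forall x : R, `|x ^+ d * gexp (1 / 2) x| <= C * gexp (1 / 4) x.
Proof.
have [C C0 h] := @normrX_le_gexp (1 / 4) d ltac:(lra); exists C => // x.
rewrite normrM (ger0_norm (gexp_ge0 _ _)).
apply: (le_trans (ler_wpM2r (gexp_ge0 _ _) (h x))).
by rewrite -mulrA ler_wpM2l// /gexp -expRD ler_expR; nra.
Qed.

Lemma integrable_le_gexp (f : R -> R) (a C : R) : 0 < a -> measurable_fun setT f ->
  (forall x, `|f x| <= C * gexp a x) -> mu.-integrable setT (EFin \o f).
Proof.
move=> a0 mf h.
apply: (@le_integrable _ _ _ mu _ measurableT _ (fun x => C%:E * (gexp a x)%:E)%E).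
- apply/measurable_EFinP; exact: mf.
- move=> x _; rewrite -EFinM /= lee_fin; apply: (le_trans (h x)); exact: ler_norm.
- by apply: integrableZl => //; exact: integrable_gexp.
Qed.

Lemma integrable_Xgexp d :
  mu.-integrable setT (EFin \o (fun x : R => x ^+ d * gexp (1 / 2) x)).
Proof.
have [C C0 h] := Xgexp_bound d.
apply: integrable_le_gexp h; first by lra.
by apply: continuous_measurable_fun; exact: continuous_Xgexp.
Qed.

Lemma integrable_EFinZ (f : R -> R) (c : R) : mu.-integrable setT (EFin \o f) ->
  mu.-integrable setT (EFin \o (fun x => c * f x)).
Proof.
move=> h; have -> : EFin \o (fun x => c * f x) = (fun x => c%:E * (f x)%:E)%E by [].
by apply: integrableZl => //; exact: h.
Qed.

Lemma dominated_Rintegral (f_ : nat -> R -> R) (f g : R -> R) :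
  (forall n, measurable_fun setT (f_ n)) -> measurable_fun setT f ->
  (forall x, f_ ^~ x @ \oo --> f x) -> mu.-integrable setT (EFin \o g) ->
  (forall n x, `|f_ n x| <= g x) ->
  (fun n => \int[mu]_(x in setT) f_ n x) @ \oo --> \int[mu]_(x in setT) f x.
Proof.
move=> mf_ mf fc ig fg.
have [] := @dominated_convergence _ _ _ mu setT measurableT
  (fun n => EFin \o f_ n) (EFin \o f) (EFin \o g).
- by move=> n; apply/measurable_EFinP; exact: mf_.
- apply/measurable_EFinP; exact: mf.
- by apply: aeW => x _; apply: cvg_EFin; [near=> n|exact: fc].
- exact: ig.
- by apply: aeW => x n _; rewrite /= lee_fin.
move=> intf _ h.
have fin : (\int[mu]_x (EFin \o f) x)%E \is a fin_num by exact: integrable_fin_num.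
by apply: fine_cvg; rewrite fineK.
Unshelve. all: by end_near. Qed.

Lemma Rintegral_itv_cvg (f : R -> R) : mu.-integrable setT (EFin \o f) ->
  (fun n => \int[mu]_(x in `[- n.+1%:R, n.+1%:R]) f x) @ \oo --> \int[mu]_(x in setT) f x.
Proof.
move=> intf.
have mf : measurable_fun setT f by have /measurable_int/measurable_EFinP := intf.
under eq_fun do rewrite Rintegral_mkcond.
apply: (@dominated_Rintegral _ _ (fun x => `|f x|)).
- by move=> n; apply/(measurable_restrictT _ (measurable_itv _)); exact: measurable_funTS mf.
- exact: mf.
- move=> x; apply: (@cvg_near_cst _ _ _ _ \oo).
  near=> n; rewrite patchE mem_set//= in_itv/= -ler_norml.
  near: n; have /cvgryPge/(_ `|x|) : (fun n => n.+1%:R : R) @ \oo --> +oo.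
    by rewrite (cvg_shiftS (fun n => n%:R : R)); exact: cvgr_idn.
  by [].
- have := integrable_abse intf; by [].
- move=> n x; rewrite patchE; case: ifP => // _; by rewrite normr0.
Unshelve. all: by end_near. Qed.

(** The derivative of x^d exp(-x^2/2) has integral zero. At d = 0 the truncated [d.-1] is masked by
    the factor 0. *)
Lemma gmom_rec d : gmom d.+1 = d%:R * gmom d.-1.
Proof.
pose F (x : R) := x ^+ d * gexp (1 / 2) x.
pose f (x : R) := d%:R * (x ^+ d.-1 * gexp (1 / 2) x) - x ^+ d.+1 * gexp (1 / 2) x.
have dF (x : R) : is_derive x (1 : R) F (f x).
  have h : is_derive x (1 : R) (gexp (1 / 2)) (gexp (1 / 2) x * (- x)).
    have h : is_derive x (1 : R) (fun x => - (1 / 2 * x ^+ 2)) (- x).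
      have := @is_deriveX _ _ (@id R) 1 x 1 1 (is_derive_id _ _).
      by move=> h; apply: is_derive_eq; rewrite /GRing.scale /=; field.
    exact: (is_derive1_comp (f := expR)).
  have h2 : is_derive x (1 : R) (fun x => x ^+ d) (d%:R * x ^+ d.-1).
    have := is_deriveX d (is_derive_id x (1 : R)).
    by rewrite exprfctE /GRing.scale /= mulr1.
  rewrite /F; apply: is_derive_eq.
  by rewrite /f /GRing.scale /= exprSr; ring.
have intf : mu.-integrable setT (EFin \o f).
  have -> : EFin \o f = (fun x => (d%:R)%:E * (x ^+ d.-1 * gexp (1 / 2) x)%:E -
     (x ^+ d.+1 * gexp (1 / 2) x)%:E)%E by [].
  apply: integrableB => //; last exact: integrable_Xgexp.
  by apply: integrableZl => //; exact: integrable_Xgexp.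
have E : \int[mu]_(x in setT) f x = d%:R * gmom d.-1 - gmom d.+1.
  rewrite /f RintegralB//; last 2 first.
  - exact: integrable_EFinZ (integrable_Xgexp d.-1).
  - exact: integrable_Xgexp.
  by rewrite RintegralZl//; exact: integrable_Xgexp.
suff Z : \int[mu]_(x in setT) f x = 0.
  by apply/esym/eqP; rewrite -subr_eq0 -E Z.
have L := Rintegral_itv_cvg intf.
have B n : \int[mu]_(x in `[- n.+1%:R, n.+1%:R]) f x = F n.+1%:R - F (- n.+1%:R).
  rewrite /Rintegral (@FTC2_pointwise _ f F).
  - by [].
  - by rewrite gtrN.
  - move=> x _; apply: cvgB; last exact: continuous_Xgexp.
    by apply: cvgMr; exact: continuous_Xgexp.
move: L; under eq_fun do rewrite B.
move=> L; apply: (cvg_unique _ L) => //=.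
(* The sign s = 1 or -1 treats both endpoints at once; exp(-v^2/4) <= 4/v suffices for decay. *)
have FL (s : R) : s ^+ 2 = 1 -> F (s * n.+1%:R) @[n --> \oo] --> 0.
  move=> s1; have [C C0 h] := Xgexp_bound d.
  apply/cvgr0Pnorm_le => /= e e0; near=> n.
  apply: (le_trans (h _)).
  have n0 : 0 < n.+1%:R :> R by [].
  have : gexp (1 / 4) (s * n.+1%:R) <= 4 * n.+1%:R^-1.
    rewrite /gexp expRN exprMn s1 mul1r -[4]invrK -invfM lef_pV2 ?posrE ?expR_gt0//.
    by apply: le_trans (expR_ge1Dx _); nra.
  move=> h2; apply: (le_trans (ler_wpM2l C0 h2)).
  rewrite mulrA ler_pdivrMr// -ler_pdivrMl//.
  near: n; have /cvgryPge/(_ (e^-1 * (C * 4))) : (fun n => n.+1%:R : R) @ \oo --> +oo.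
    by rewrite (cvg_shiftS (fun n => n%:R : R)); exact: cvgr_idn.
  by [].
rewrite -[0]subr0; apply: cvgB.
  by have := FL 1 (expr1n _ _); under eq_fun do rewrite mul1r.
have := FL (-1) ltac:(by rewrite sqrrN expr1n); by under eq_fun do rewrite mulN1r.
Unshelve. all: by end_near. Qed.

Lemma gmom0 : gmom 0 = Num.sqrt (2 * pi).
Proof.
by rewrite -Rintegral_gexp_half /gmom; apply: eq_Rintegral => x _; rewrite expr0 mul1r.
Qed.

End Gaussian1D.

(** * Domination and limits for iterated integrals *)

Section IteratedIntegral.
Variable R : realType.
Notation mu := (@lebesgue_measure R).

Definition slice n (F : 'rV[R]_n.+1 -> R) (x : R) : 'rV[R]_n -> R :=
  fun v => F (row_mx (const_mx x : 'rV_1) v).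

Lemma intRnS n (F : 'rV[R]_n.+1 -> R) :
  intRn F = \int[mu]_(x in setT) intRn (slice F x).
Proof. by []. Qed.

(** Exactly the measurability that an induction along [intRn] consumes: one condition on the partial
    integral at each level, rather than joint measurability. *)
Fixpoint iter_measurable n : ('rV[R]_n -> R) -> Prop :=
  match n return ('rV[R]_n -> R) -> Prop with
  | 0 => fun F => True
  | n'.+1 => fun F => (forall x, @iter_measurable n' (slice F x)) /\
                      measurable_fun setT (fun x => intRn (slice F x))
  end.

Definition gauss_dom n (a C : R) (F : 'rV[R]_n -> R) :=
  forall v, `|F v| <= C * expR (- (a * sqnorm v)).

Lemma sqnorm_row_mx n (x : R) (v : 'rV[R]_n) :
  sqnorm (row_mx (const_mx x : 'rV_1) v) = x ^+ 2 + sqnorm v.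
Proof.
rewrite /sqnorm /dotR (@big_split_ord _ _ _ 1 n) big_ord1 !row_mxEl !mxE expr2.
by congr +%R; apply: eq_bigr => j _; rewrite !row_mxEr.
Qed.

Lemma gauss_dom_slice n a C (F : 'rV[R]_n.+1 -> R) x :
  gauss_dom a C F -> gauss_dom a (C * gexp a x) (slice F x).
Proof.
move=> h v; apply: (le_trans (h _)).
by rewrite sqnorm_row_mx /gexp mulrDr opprD expRD mulrA.
Qed.

Definition gexp_mass (a : R) : R := \int[mu]_(x in setT) gexp a x.

(** The induction varies C: fixing the first coordinate x multiplies it by [gexp a x], and
    integrating that factor yields one power of the mass. *)
Lemma intRn_le n a C (F : 'rV[R]_n -> R) : 0 < a -> 
  iter_measurable F -> gauss_dom a C F -> `|intRn F| <= C * gexp_mass a ^+ n.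
Proof.
move=> a0; elim: n => [|n ih] in C F * => mF dF.
  rewrite /= mulr1; apply: (le_trans (dF _)).
  by rewrite /sqnorm /dotR big_ord0 mulr0 oppr0 expR0 mulr1.
have mF2 := mF.2.
have b x : `|intRn (slice F x)| <= (C * gexp_mass a ^+ n) * gexp a x.
  by rewrite mulrAC; apply: ih; [exact: mF.1|exact: gauss_dom_slice].
have iF := integrable_le_gexp a0 mF2 b.
rewrite intRnS; apply: (le_trans (le_normr_Rintegral measurableT iF)).
rewrite exprSr mulrA -RintegralZl//; last exact: integrable_gexp.
apply: le_Rintegral => //.
- exact: (integrable_abse iF).
- by apply: integrable_EFinZ; exact: integrable_gexp.
Qed.

Lemma intRn_slice_integrable n a C (F : 'rV[R]_n.+1 -> R) : 0 < a ->
  iter_measurable F -> gauss_dom a C F ->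
  mu.-integrable setT (EFin \o (fun x => intRn (slice F x))).
Proof.
move=> a0 mF dF; have mF2 := mF.2.
apply: (@integrable_le_gexp _ _ a (C * gexp_mass a ^+ n)) => // x.
by rewrite mulrAC; apply: intRn_le => //; [exact: mF.1|exact: gauss_dom_slice].
Qed.

Lemma intRn_lincomb n a C D (c : R) (F G : 'rV[R]_n -> R) : 0 < a ->
  iter_measurable F -> gauss_dom a C F -> iter_measurable G -> gauss_dom a D G ->
  iter_measurable (fun v => F v + c * G v) /\
  intRn (fun v => F v + c * G v) = intRn F + c * intRn G.
Proof.
move=> a0; elim: n => [//|n ih] in C D F G * => mF dF mG dG.
have h x := ih _ _ _ _ (mF.1 x) (gauss_dom_slice x dF) (mG.1 x) (gauss_dom_slice x dG).
have iF := intRn_slice_integrable a0 mF dF.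
have iG := intRn_slice_integrable a0 mG dG.
have e : (fun x => intRn (slice (fun v => F v + c * G v) x)) =
  (fun x => intRn (slice F x) + c * intRn (slice G x)).
  by apply/funext => x; exact: (h x).2.
split; last first.
  rewrite !intRnS e RintegralD//; last exact: integrable_EFinZ.
  by rewrite RintegralZl.
split; first by move=> x; exact: (h x).1.
rewrite e; apply: measurable_funD; first exact: mF.2.
by apply: measurable_funM => //; exact: mG.2.
Qed.

(** Dominated convergence at each level: the induction hypothesis gives pointwise convergence of the
    partial integrals, [intRn_le] dominates them, and measurability passes to their limit. *)
Lemma intRn_dominated_cvg n a C (F_ : nat -> 'rV[R]_n -> R) (F : 'rV[R]_n -> R) : 0 < a ->
  (forall N, iter_measurable (F_ N)) -> (forall N, gauss_dom a C (F_ N)) ->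
  (forall v, F_ ^~ v @ \oo --> F v) ->
  iter_measurable F /\ (fun N => intRn (F_ N)) @ \oo --> intRn F.
Proof.
move=> a0; elim: n => [|n ih] in C F_ F * => mF dF cF.
  by split => //; exact: cF.
have h x := ih _ (fun N => slice (F_ N) x) (slice F x) (fun N => (mF N).1 x)
   (fun N => gauss_dom_slice x (dF N)) (fun v => cF _).
have mlim : measurable_fun setT (fun x => intRn (slice F x)).
  apply: (@measurable_fun_cvg _ _ _ _ (fun N x => intRn (slice (F_ N) x))).
    by move=> N; exact: (mF N).2.
  by move=> x _; exact: (h x).2.
split; first by split => // x; exact: (h x).1.
under eq_fun do rewrite intRnS.
rewrite intRnS.
apply: (@dominated_Rintegral _ _ _ (fun x => C * gexp_mass a ^+ n * gexp a x)) => //.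
- by move=> N; exact: (mF N).2.
- by move=> x; exact: (h x).2.
- by apply: integrable_EFinZ; exact: integrable_gexp.
- move=> N x; rewrite mulrAC; apply: intRn_le => //; last exact: gauss_dom_slice.
  exact: (mF N).1.
Qed.

Lemma row_mx_slice0 n (x : R) (v : 'rV[R]_n) :
  (row_mx (const_mx x : 'rV_1) v : 'rV[R]_n.+1) 0 ord0 = x.
Proof.
have -> : ord0 = lshift n (ord0 : 'I_1) :> 'I_(1 + n) by exact: val_inj.
by rewrite (row_mxEl (const_mx x : 'rV_1)) mxE.
Qed.

Lemma row_mx_sliceS n (x : R) (v : 'rV[R]_n) (j : 'I_n) :
  (row_mx (const_mx x : 'rV_1) v : 'rV[R]_n.+1) 0 (lift ord0 j) = v 0 j.
Proof.
have -> : lift ord0 j = rshift 1 j :> 'I_(1 + n) by exact: val_inj.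
by rewrite (row_mxEr (const_mx x : 'rV_1)).
Qed.

Lemma intRn0 n : iter_measurable (fun _ : 'rV[R]_n => 0) /\ intRn (fun _ : 'rV[R]_n => 0) = 0.
Proof.
elim: n => [|n [ih1 ih2]]; first by [].
have e : (fun x => intRn (slice (fun _ : 'rV[R]_n.+1 => 0) x)) = cst 0.
  by apply/funext => x; exact: ih2.
split; last by rewrite intRnS e Rintegral_cst// mul0r.
by split => //; rewrite e; exact: measurable_cst.
Qed.

(** Fubini for products. The factors are indexed by [nat], so that dropping the first coordinate is
    the shift [f j.+1]. *)
Lemma intRn_prod n (a : R) (f : nat -> R -> R) (C : nat -> R) : 0 < a ->
  (forall j, measurable_fun setT (f j)) ->
  (forall j x, `|f j x| <= C j * gexp a x) ->
  [/\ gauss_dom a (\prod_(j < n) C j) (fun v : 'rV[R]_n => \prod_(j < n) f j (v 0 j)),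
   iter_measurable (fun v : 'rV[R]_n => \prod_(j < n) f j (v 0 j)) &
   intRn (fun v : 'rV[R]_n => \prod_(j < n) f j (v 0 j)) =
    \prod_(j < n) \int[mu]_(x in setT) f j x].
Proof.
move=> a0; elim: n => [|n ih] in f C * => mf hf.
  split => //; last by rewrite /= !big_ord0.
  by move=> v; rewrite !big_ord0 /sqnorm /dotR big_ord0 normr1 mulr0 oppr0 expR0 mulr1.
have dom : gauss_dom a (\prod_(j < n.+1) C j)
    (fun v : 'rV[R]_n.+1 => \prod_(j < n.+1) f j (v 0 j)).
  move=> v; rewrite normr_prod /sqnorm /dotR big_distrr -sumrN expR_sum -big_split.
  by apply: ler_prod => j _; rewrite normr_ge0 /=; have := hf j (v 0 j); rewrite /gexp expr2.
(* The leading 0 gives the slice the shape F + c G, so that [intRn_lincomb] applies to a scalar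
   multiple. *)
have e x : slice (fun v : 'rV[R]_n.+1 => \prod_(j < n.+1) f j (v 0 j)) x =
  (fun v => 0 + f 0%N x * \prod_(j < n) f j.+1 (v 0 j)).
  apply/funext => v; rewrite /slice add0r big_ord_recl row_mx_slice0; congr (_ * _).
  by apply: eq_bigr => j _; rewrite row_mx_sliceS.
have [d1 m1 i1] := ih (fun j => f j.+1) (fun j => C j.+1)
  (fun j => mf j.+1) (fun j => hf j.+1).
have d0 : gauss_dom a 0 (fun _ : 'rV[R]_n => 0) by move=> v; rewrite normr0 mul0r.
have L x := intRn_lincomb (f 0%N x) a0 (intRn0 n).1 d0 m1 d1.
have e2 : (fun x => intRn (slice (fun v : 'rV[R]_n.+1 => \prod_(j < n.+1) f j (v 0 j)) x)) =
   (fun x => \prod_(j < n) \int[mu]_(x in setT) f j.+1 x * f 0%N x).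
  by apply/funext => x; rewrite e (L x).2 (intRn0 n).2 add0r i1 mulrC.
split => //.
  split; first by move=> x; rewrite e; exact: (L x).1.
  by rewrite e2; apply: measurable_funM.
rewrite intRnS e2 RintegralZl//; last exact: (integrable_le_gexp a0 (mf 0%N) (hf 0%N)).
by rewrite mulrC big_ord_recl.
Qed.

End IteratedIntegral.

(** * Polynomial functions and their derivatives *)

Section PolynomialFunctions.
Variables (R : realType) (m : nat).
Notation V := 'rV[R]_m.

(** Polynomials stay functions, so that [derive] and integrals apply to them directly; the predicate
    supplies induction over their construction. *)
Inductive polyfun : (V -> R) -> Prop :=
| polyfun_cst c : polyfun (fun _ => c)
| polyfun_coord j : polyfun (fun x => x 0 j)
| polyfun_add f g : polyfun f -> polyfun g -> polyfun (fun x => f x + g x)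
| polyfun_mul f g : polyfun f -> polyfun g -> polyfun (fun x => f x * g x).

Definition dd (v : V) (f : V -> R) : V -> R := fun x => 'D_v f x.

Lemma polyfun_derivable f : polyfun f -> forall x v, derivable f x v.
Proof.
elim=> [c|j|{}f g _ hf _ hg|{}f g _ hf _ hg] x v.
- exact: derivable_cst.
- by have /derivable_mxP := @derivable_id _ _ x v; apply.
- exact: (derivableD (hf x v) (hg x v)).
- exact: (derivableM (hf x v) (hg x v)).
Qed.

Lemma dd_cst v c : dd v (fun _ => c) = fun _ => 0.
Proof. by apply/funext => x; exact: derive_cst. Qed.

Lemma dd_coord v j : dd v (fun x => x 0 j) = fun _ => v 0 j.
Proof.
apply/funext => x.
have := derive_mx (@derivable_id _ _ x v).
by rewrite derive_id => /matrixP/(_ 0 j); rewrite mxE.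
Qed.

Lemma dd_add v f g : polyfun f -> polyfun g ->
  dd v (fun x => f x + g x) = fun x => dd v f x + dd v g x.
Proof.
move=> pf pg; apply/funext => x.
exact: (deriveD (@polyfun_derivable _ pf x v) (@polyfun_derivable _ pg x v)).
Qed.

Lemma dd_mul v f g : polyfun f -> polyfun g ->
  dd v (fun x => f x * g x) = fun x => dd v f x * g x + f x * dd v g x.
Proof.
move=> pf pg; apply/funext => x.
have := deriveM (@polyfun_derivable _ pf x v) (@polyfun_derivable _ pg x v).
rewrite /GRing.scale /= => h; apply: (eq_trans h).
by rewrite /dd addrC mulrC.
Qed.

Opaque dd.

Lemma polyfun_dd v f : polyfun f -> polyfun (dd v f).
Proof.
elim=> [c|j|{}f g pf hf pg hg|{}f g pf hf pg hg].
- by rewrite dd_cst; exact: polyfun_cst.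
- by rewrite dd_coord; exact: polyfun_cst.
- by rewrite dd_add//; exact: polyfun_add.
- by rewrite dd_mul//; apply: polyfun_add; exact: polyfun_mul.
Qed.

Lemma polyfun_scale c f : polyfun f -> polyfun (fun x => c * f x).
Proof. by apply: polyfun_mul; exact: polyfun_cst. Qed.

Lemma polyfun_opp f : polyfun f -> polyfun (fun x => - f x).
Proof.
by move=> /(polyfun_scale (-1)); congr polyfun; apply/funext => x; rewrite mulN1r.
Qed.

Lemma polyfun_sum (I : Type) (r : seq I) (P : pred I) (F : I -> V -> R) :
  (forall i, polyfun (F i)) -> polyfun (fun x => \sum_(i <- r | P i) F i x).
Proof.
move=> pF; elim: r => [|i r ih].
  by under eq_fun do rewrite big_nil; exact: polyfun_cst.
under eq_fun do rewrite big_cons.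
by case: (P i) => //; exact: polyfun_add.
Qed.

Lemma polyfun_exp n f : polyfun f -> polyfun (fun x => f x ^+ n).
Proof.
move=> pf; elim: n => [|n ih]; first exact: polyfun_cst.
by under eq_fun do rewrite exprS; exact: polyfun_mul.
Qed.

Lemma polyfun_prod (I : Type) (r : seq I) (P : pred I) (F : I -> V -> R) :
  (forall i, polyfun (F i)) -> polyfun (fun x => \prod_(i <- r | P i) F i x).
Proof.
move=> pF; elim: r => [|i r ih].
  by under eq_fun do rewrite big_nil; exact: polyfun_cst.
under eq_fun do rewrite big_cons.
by case: (P i) => //; exact: polyfun_mul.
Qed.

Lemma dd_scale v c f : polyfun f -> dd v (fun x => c * f x) = fun x => c * dd v f x.
Proof.
move=> pf; rewrite dd_mul ?dd_cst//; last exact: polyfun_cst.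
by apply/funext => x; rewrite mul0r add0r.
Qed.

Lemma dd_opp v f : polyfun f -> dd v (fun x => - f x) = fun x => - dd v f x.
Proof.
move=> pf; have -> : (fun x => - f x) = (fun x => -1 * f x).
  by apply/funext => x; rewrite mulN1r.
by rewrite dd_scale//; apply/funext => x; rewrite mulN1r.
Qed.

Lemma dd_sub v f g : polyfun f -> polyfun g ->
  dd v (fun x => f x - g x) = fun x => dd v f x - dd v g x.
Proof. by move=> pf pg; rewrite dd_add ?dd_opp//; exact: polyfun_opp. Qed.

Lemma dd_exp v f n : polyfun f ->
  dd v (fun x => f x ^+ n) = fun x => n%:R * f x ^+ n.-1 * dd v f x.
Proof.
move=> pf; elim: n => [|n ih].
  by under eq_fun do rewrite expr0; rewrite dd_cst; apply/funext => x; rewrite !mul0r.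
have -> : (fun x => f x ^+ n.+1) = (fun x => f x * f x ^+ n).
  by apply/funext => x; rewrite exprS.
rewrite dd_mul ?ih//; last exact: polyfun_exp.
apply/funext => x; case: n {ih} => [|n] /=; first by rewrite expr0; ring.
by rewrite -[in RHS]natr1 exprS; ring.
Qed.

Lemma dd_sum v (I : Type) (r : seq I) (P : pred I) (F : I -> V -> R) :
  (forall i, polyfun (F i)) ->
  dd v (fun x => \sum_(i <- r | P i) F i x) = fun x => \sum_(i <- r | P i) dd v (F i) x.
Proof.
move=> pF; elim: r => [|i r ih].
  by under eq_fun do rewrite big_nil; under [RHS]eq_fun do rewrite big_nil; exact: dd_cst.
under eq_fun do rewrite big_cons; under [RHS]eq_fun do rewrite big_cons.
case: (P i) => //; rewrite dd_add ?ih//; exact: polyfun_sum.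
Qed.

Lemma dd_comm v w f : polyfun f -> dd v (dd w f) = dd w (dd v f).
Proof.
elim=> [c|j|{}f g pf hf pg hg|{}f g pf hf pg hg].
- by rewrite !dd_cst.
- by rewrite !dd_coord !dd_cst.
- have [pvf pwf] := (polyfun_dd v pf, polyfun_dd w pf).
  have [pvg pwg] := (polyfun_dd v pg, polyfun_dd w pg).
  by rewrite (dd_add w pf pg) (dd_add v pf pg) (dd_add v pwf pwg) (dd_add w pvf pvg) hf hg.
- have [pvf pwf] := (polyfun_dd v pf, polyfun_dd w pf).
  have [pvg pwg] := (polyfun_dd v pg, polyfun_dd w pg).
  have pM := polyfun_mul.
  rewrite (dd_mul w pf pg) (dd_mul v pf pg).
  rewrite (dd_add v (pM _ _ pwf pg) (pM _ _ pf pwg)) (dd_add w (pM _ _ pvf pg) (pM _ _ pf pvg)).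
  rewrite (dd_mul v pwf pg) (dd_mul v pf pwg) (dd_mul w pvf pg) (dd_mul w pf pvg) hf hg.
  by apply/funext => x; rewrite addrACA.
Qed.

Definition part (j : 'I_m) := dd (delta_mx 0 j).

Lemma dd_part v f x : polyfun f -> dd v f x = \sum_j v 0 j * part j f x.
Proof.
move=> pf; elim: pf x => [c|j|{}f g pf hf pg hg|{}f g pf hf pg hg] x.
- by rewrite dd_cst big1// => j _; rewrite /part dd_cst mulr0.
- rewrite dd_coord (bigD1 j)//= /part dd_coord mxE !eqxx mulr1 big1 ?addr0//.
  by move=> k kj; rewrite dd_coord mxE eq_sym (negPf kj) andbF mulr0.
- rewrite dd_add// hf hg -big_split; apply: eq_bigr => j _.
  by rewrite /part dd_add// mulrDr.
- rewrite dd_mul// hf hg mulr_suml mulr_sumr -big_split; apply: eq_bigr => j _.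
  by rewrite /part dd_mul//=; ring.
Qed.

Definition mon (d : nat -> nat) (x : V) : R := \prod_(j < m) x 0 j ^+ d j.

Lemma polyfun_mon d : polyfun (mon d).
Proof. by apply: polyfun_prod => j; apply: polyfun_exp; exact: polyfun_coord. Qed.

(** A second induction principle: linear identities reduce to monomials, whose Gaussian integrals
    factor over the coordinates. *)
Inductive monspan : (V -> R) -> Prop :=
| monspan_mon d : monspan (mon d)
| monspan_lin c f g : monspan f -> monspan g -> monspan (fun x => f x + c * g x).

Lemma monspan0 : monspan (fun _ => 0).
Proof.
have := monspan_lin (-1) (monspan_mon (fun _ => 0%N)) (monspan_mon (fun _ => 0%N)).
by congr monspan; apply/funext => x; rewrite mulN1r subrr.
Qed.

Lemma monspan_scale c f : monspan f -> monspan (fun x => c * f x).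
Proof.
move=> h; have := monspan_lin c monspan0 h.
by congr monspan; apply/funext => x; rewrite add0r.
Qed.

Lemma monspan_add f g : monspan f -> monspan g -> monspan (fun x => f x + g x).
Proof.
move=> hf hg; have := monspan_lin 1 hf hg.
by congr monspan; apply/funext => x; rewrite mul1r.
Qed.

Lemma monspan_mul f g : monspan f -> monspan g -> monspan (fun x => f x * g x).
Proof.
move=> hf; elim: hf g => [d|c {}f h _ hf _ hh] g hg.
  elim: hg => [e|c {}f {}g _ hf _ hg].
    have := monspan_mon (fun j => d j + e j)%N.
    congr monspan; apply/funext => x; rewrite /mon -big_split.
    by apply: eq_bigr => j _; rewrite exprD.
  have := monspan_lin c hf hg; congr monspan; apply/funext => x; ring.
have := monspan_lin c (hf _ hg) (hh _ hg); congr monspan; apply/funext => x; ring.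
Qed.

Lemma polyfun_monspan f : polyfun f -> monspan f.
Proof.
elim=> [c|j|{}f g pf hf pg hg|{}f g pf hf pg hg].
- have := monspan_scale c (monspan_mon (fun _ => 0%N)).
  by congr monspan; apply/funext => x; rewrite /mon big1 ?mulr1.
- have := monspan_mon (fun i => (i == j :> nat)).
  congr monspan; apply/funext => x; rewrite /mon (bigD1 j)//= eqxx expr1.
  rewrite big1 ?mulr1// => i ij; by rewrite (_ : (i == j :> nat) = false) ?expr0//; exact/negbTE.
- exact: monspan_add.
- exact: monspan_mul.
Qed.

Definition updn (d : nat -> nat) j n := fun i => if i == j then n else d i.

Lemma mon_updn d (j : 'I_m) n x :
  mon (updn d j n) x = x 0 j ^+ n * \prod_(i < m | i != j) x 0 i ^+ d i.
Proof.
rewrite /mon (bigD1 j)//= /updn eqxx; congr (_ * _).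
apply: eq_bigr => i ij; rewrite (_ : (i == j :> nat) = false)//; exact/negbTE.
Qed.

Lemma part_mon j d : part j (mon d) = fun x => (d j)%:R * mon (updn d j (d j).-1) x.
Proof.
pose r (x : V) : R := \prod_(i < m | i != j) x 0 i ^+ d i.
have e : mon d = (fun x => x 0 j ^+ d j * r x).
  by apply/funext => x; rewrite /mon (bigD1 j).
have pr : polyfun r.
  by apply: polyfun_prod => i; apply: polyfun_exp; exact: polyfun_coord.
have pX i n : polyfun (fun x => x 0 i ^+ n) by apply: polyfun_exp; exact: polyfun_coord.
have dr : part j r = fun _ => 0.
  suff [] : polyfun r /\ part j r = fun _ => 0 by [].
  rewrite /r; elim: (index_enum _) => [|i s [ih1 ih2]].
    under eq_fun do rewrite big_nil; split; [exact: polyfun_cst|exact: dd_cst].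
  under eq_fun do rewrite big_cons; have [->//|ij] := eqVneq i j.
  split; first exact: polyfun_mul.
  rewrite /part dd_mul// -/(part j _) -/(part j _) ih2 /part dd_exp ?dd_coord; last exact: polyfun_coord.
  by apply/funext => x; rewrite mxE eqxx/= (negPf ij) mulr0 mul0r mulr0 addr0.
rewrite e /part dd_mul// -/(part j _) -/(part j _) dr /part dd_exp ?dd_coord; last exact: polyfun_coord.
apply/funext => x; rewrite mon_updn mxE !eqxx mulr0 addr0 mulr1 mulrA; congr (_ * _).
Qed.

End PolynomialFunctions.

(** * The Gaussian mean: integration by parts and termwise evaluation *)

Section GaussianExpectation.
Variables (R : realType) (m : nat).
Notation V := 'rV[R]_m.
Notation mu := (@lebesgue_measure R).

Definition gdens (x : V) : R := expR (- sqnorm x / 2).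

Definition gE (f : V -> R) : R :=
  (2 * pi) `^ (- (m%:R / 2)) * intRn (fun x => f x * gdens x).

(** Asking for every rate e makes the class closed under products (split e in halves), which a
    single fixed rate would not give. *)
Definition subgauss (f : V -> R) := forall e, 0 < e ->
  exists2 C, 0 <= C & forall x, `|f x| <= C * expR (e * sqnorm x).

Definition admissible f := iter_measurable (fun x => f x * gdens x) /\ subgauss f.

Lemma sqnorm_ge0 (x : V) : 0 <= sqnorm x.
Proof. by apply: sumr_ge0 => j _; rewrite -expr2 sqr_ge0. Qed.

Lemma subgauss_dom f : subgauss f ->
  exists2 C, 0 <= C & gauss_dom (1 / 4) C (fun x => f x * gdens x).
Proof.
move=> /(_ (1 / 4) ltac:(lra)) [C C0 h]; exists C => // x.
rewrite normrM (ger0_norm (expR_ge0 _)).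
apply: (le_trans (ler_wpM2r (expR_ge0 _) (h x))).
by rewrite -mulrA ler_wpM2l// -expRD ler_expR; lra.
Qed.

Lemma subgauss_add f g : subgauss f -> subgauss g -> subgauss (fun x => f x + g x).
Proof.
move=> hf hg e e0; have [C C0 h1] := hf _ e0; have [D D0 h2] := hg _ e0.
exists (C + D); first exact: addr_ge0.
by move=> x; rewrite mulrDl; apply: (le_trans (ler_normD _ _)); exact: lerD.
Qed.

Lemma subgauss_mul f g : subgauss f -> subgauss g -> subgauss (fun x => f x * g x).
Proof.
move=> hf hg e e0; have e2 : 0 < e / 2 by lra.
have [C C0 h1] := hf _ e2; have [D D0 h2] := hg _ e2.
exists (C * D); first exact: mulr_ge0.
move=> x; rewrite normrM; apply: (le_trans (ler_pM _ _ (h1 x) (h2 x))) => //.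
rewrite mulrACA -expRD ler_wpM2l ?mulr_ge0// ler_expR; lra.
Qed.

Lemma subgauss_cst c : subgauss (fun _ => c).
Proof.
move=> e e0; exists `|c| => // x; rewrite ler_peMr// -expR0 ler_expR.
by rewrite mulr_ge0 ?sqnorm_ge0// ltW.
Qed.

Lemma polyfun_subgauss f : polyfun f -> subgauss f.
Proof.
elim=> [c|j|{}f g _ hf _ hg|{}f g _ hf _ hg].
- exact: subgauss_cst.
- move=> e e0; have [C C0 h] := @normrX_le_gexp R e 1 e0; exists C => // x.
  apply: (le_trans (h _)); rewrite ler_wpM2l// ler_expR ler_pM2l//.
  rewrite /sqnorm /dotR (bigD1 j)//= -expr2 lerDl.
  by apply: sumr_ge0 => k _; rewrite -expr2 sqr_ge0.
- exact: subgauss_add.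
- exact: subgauss_mul.
Qed.

Lemma admissible_lin c f g : admissible f -> admissible g ->
  admissible (fun x => f x + c * g x) /\
  gE (fun x => f x + c * g x) = gE f + c * gE g.
Proof.
move=> [mf sf] [mg sg].
have [C C0 dC] := subgauss_dom sf; have [D D0 dD] := subgauss_dom sg.
have e : (fun x => (f x + c * g x) * gdens x) =
  (fun x => f x * gdens x + c * (g x * gdens x)).
  by apply/funext => x; rewrite mulrDl mulrA.
have q : 0 < 1 / 4 :> R by lra.
have [h1 h2] := intRn_lincomb c q mf dC mg dD.
split; first split.
- by rewrite e.
- by apply: subgauss_add => //; apply: subgauss_mul => //; exact: subgauss_cst.
by rewrite /gE e h2; ring.
Qed.

Definition gmoment d : R := gmom R d / Num.sqrt (2 * pi).

Lemma sqrt2pi_gt0 : 0 < Num.sqrt (2 * pi) :> R.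
Proof. by rewrite sqrtr_gt0 mulr_gt0// pi_gt0. Qed.

Lemma gmoment0 : gmoment 0 = 1.
Proof. by rewrite /gmoment gmom0 divff// gt_eqF// sqrt2pi_gt0. Qed.

Lemma gmomentS d : gmoment d.+1 = d%:R * gmoment d.-1.
Proof. by rewrite /gmoment gmom_rec mulrA. Qed.

Lemma mon_gdens d : (fun x : V => mon d x * gdens x) =
  (fun x => \prod_(j < m) (x 0 j ^+ d j * gexp (1 / 2) (x 0 j))).
Proof.
apply/funext => x; rewrite big_split /=; congr (_ * _).
rewrite /gdens /gexp -expR_sum sumrN -big_distrr /=; congr expR.
rewrite mulNr mulrC mul1r; congr (- (_ * _)).
Qed.

Lemma admissible_mon d : admissible (mon d) /\ gE (mon d) = \prod_(j < m) gmoment (d j).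
Proof.
have hC j : exists C, forall x : R, `|x ^+ d j * gexp (1 / 2) x| <= C * gexp (1 / 4) x.
  by have [C _ h] := @Xgexp_bound R (d j); exists C.
have [C hb] := choice hC.
have q : 0 < 1 / 4 :> R by lra.
have [_ h1 h2] := @intRn_prod R m (1 / 4) (fun j x => x ^+ d j * gexp (1 / 2) x) C q
  (fun j => continuous_measurable_fun (@continuous_Xgexp R (d j))) hb.
split; first by split; [rewrite mon_gdens|exact: polyfun_subgauss (polyfun_mon R m d)].
rewrite /gE mon_gdens h2 /gmoment -/(gmom R _) big_split /= prodfV prodr_const card_ord.
rewrite mulrC; congr (_ * _).
rewrite powRN; congr (_^-1).
rewrite -powR12_sqrt ?mulr_ge0 ?pi_ge0//.
by rewrite -[RHS]powR_mulrn ?powR_ge0// -powRrM; congr powR; rewrite mulrC.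
Qed.

Lemma admissible_monspan f : monspan f -> admissible f.
Proof.
elim=> [d|c {}f g _ hf _ hg]; first exact: (admissible_mon d).1.
exact: (admissible_lin c hf hg).1.
Qed.

Lemma polyfun_admissible f : polyfun f -> admissible f.
Proof. by move=> /polyfun_monspan /admissible_monspan. Qed.

Lemma gE_lin c f g : polyfun f -> polyfun g ->
  gE (fun x => f x + c * g x) = gE f + c * gE g.
Proof.
by move=> /polyfun_admissible hf /polyfun_admissible hg; exact: (admissible_lin c hf hg).2.
Qed.

Lemma gE_add f g : polyfun f -> polyfun g -> gE (fun x => f x + g x) = gE f + gE g.
Proof.
move=> pf pg; rewrite -[gE g]mul1r -gE_lin//; congr gE.
by apply/funext => x; rewrite mul1r.
Qed.

Lemma gE0 : gE (fun _ => 0) = 0.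
Proof.
have p0 := polyfun_cst m (0 : R).
have e : (fun _ : V => 0 + -1 * 0) = (fun _ => 0 : R).
  by apply/funext => x; rewrite mulr0 addr0.
have := gE_lin (-1) p0 p0; rewrite e => h; lra.
Qed.

Lemma gE_scale c f : polyfun f -> gE (fun x => c * f x) = c * gE f.
Proof.
move=> pf; have := gE_lin c (polyfun_cst m (0 : R)) pf; rewrite gE0 add0r => <-.
by congr gE; apply/funext => x; rewrite add0r.
Qed.

Lemma gE_opp f : polyfun f -> gE (fun x => - f x) = - gE f.
Proof.
move=> pf; rewrite -mulN1r -gE_scale//; congr gE.
by apply/funext => x; rewrite mulN1r.
Qed.

Lemma gE_sub f g : polyfun f -> polyfun g -> gE (fun x => f x - g x) = gE f - gE g.
Proof. by move=> pf pg; rewrite gE_add ?gE_opp//; exact: polyfun_opp. Qed.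

Lemma gE_sum (I : Type) (r : seq I) (P : pred I) (F : I -> V -> R) :
  (forall i, polyfun (F i)) ->
  gE (fun x => \sum_(i <- r | P i) F i x) = \sum_(i <- r | P i) gE (F i).
Proof.
move=> pF; elim: r => [|i r ih].
  by under eq_fun do rewrite big_nil; rewrite gE0 big_nil.
under eq_fun do rewrite big_cons; rewrite big_cons.
case: (P i) => //; rewrite gE_add ?ih//; exact: polyfun_sum.
Qed.

Lemma gE_cst c : gE (fun _ => c) = c.
Proof.
have -> : (fun _ : V => c) = (fun x => c * mon (fun _ => 0%N) x).
  by apply/funext => x; rewrite /mon big1 ?mulr1.
rewrite gE_scale; last exact: polyfun_mon.
by rewrite (admissible_mon _).2 big1 ?mulr1// => j _; rewrite gmoment0.
Qed.

Lemma gE_mon_updn d (j : 'I_m) n :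
  gE (mon (updn d j n)) = gmoment n * \prod_(i < m | i != j) gmoment (d i).
Proof.
rewrite (admissible_mon _).2 (bigD1 j)//= /updn eqxx; congr (_ * _).
by apply: eq_bigr => i ij; rewrite (_ : (i == j :> nat) = false)//; exact/negbTE.
Qed.

Lemma monspan_polyfun (f : V -> R) : monspan f -> polyfun f.
Proof.
elim=> [d|c {}f g _ hf _ hg]; first exact: polyfun_mon.
by apply: polyfun_add => //; exact: polyfun_scale.
Qed.

(** By linearity f may be a monomial; then the claim is the moment recursion in the j-th factor. *)
Lemma gE_coord j f : polyfun f -> gE (fun x => x 0 j * f x) = gE (part j f).
Proof.
move=> pf; have := polyfun_monspan pf; elim=> [d|c {pf}f' g hf ihf hg ihg].
  have -> : (fun x : V => x 0 j * mon d x) = mon (updn d j (d j).+1).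
    by apply/funext => x; rewrite mon_updn exprS /mon (bigD1 j)//= mulrA.
  rewrite part_mon gE_scale; last exact: polyfun_mon.
  by rewrite !gE_mon_updn gmomentS mulrA.
have [pf pg] := (monspan_polyfun hf, monspan_polyfun hg).
have pc := polyfun_coord R j.
have -> : (fun x : V => x 0 j * (f' x + c * g x)) =
  (fun x => x 0 j * f' x + c * (x 0 j * g x)).
  by apply/funext => x; ring.
rewrite gE_lin ?ihf ?ihg; [|exact: polyfun_mul..].
rewrite /part (dd_add _ pf (polyfun_scale c pg)) (dd_scale _ c pg) gE_lin//; exact: polyfun_dd.
Qed.

Lemma gE_dot y f : polyfun f -> gE (fun x => dotR x y * f x) = gE (dd y f).
Proof.
move=> pf.
have -> : (fun x => dotR x y * f x) = (fun x => \sum_j y 0 j * (x 0 j * f x)).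
  by apply/funext => x; rewrite /dotR mulr_suml; apply: eq_bigr => j _; ring.
have -> : dd y f = (fun x => \sum_j y 0 j * part j f x).
  by apply/funext => x; exact: dd_part.
have pc j := polyfun_mul (polyfun_coord R j) pf.
have pp j := polyfun_dd (delta_mx 0 j) pf.
rewrite !gE_sum.
- by apply: eq_bigr => j _; rewrite (gE_scale _ (pc j)) (gE_scale _ (pp j)) gE_coord.
- by move=> j; exact: polyfun_scale _ (pp j).
- by move=> j; exact: polyfun_scale _ (pc j).
Qed.

(* The bound is what allows termwise integration against a Gaussian times a polynomial. *)
Record series_of (F : V -> R) (P : nat -> V -> R) : Prop := SeriesOf {
  series_of_poly : forall d, polyfun (P d);
  series_of_bound : forall e, 0 < e -> exists2 C, 0 <= C &
    forall N x, \sum_(d < N) `|P d x| <= C * expR (e * sqnorm x);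
  series_of_cvg : forall x, (fun N => \sum_(d < N) P d x) @ \oo --> F x }.

Lemma gE_dominated_cvg (f_ : nat -> V -> R) f :
  (forall N, admissible (f_ N)) ->
  (forall e, 0 < e -> exists2 C, 0 <= C & forall N x, `|f_ N x| <= C * expR (e * sqnorm x)) ->
  (forall x, f_ ^~ x @ \oo --> f x) ->
  admissible f /\ (fun N => gE (f_ N)) @ \oo --> gE f.
Proof.
move=> af bf cf.
have sf : subgauss f.
  move=> e e0; have [C C0 h] := bf e e0; exists C => // x.
  by apply: (cvgr_to_le (cvg_norm (cf x))); near=> N; exact: h.
have [C C0 h] := bf (1 / 4) ltac:(lra).
have dF N : gauss_dom (1 / 4) C (fun x => f_ N x * gdens x).
  move=> x; rewrite normrM (ger0_norm (expR_ge0 _)).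
  apply: (le_trans (ler_wpM2r (expR_ge0 _) (h N x))).
  by rewrite -mulrA ler_wpM2l// -expRD ler_expR; lra.
have q : 0 < 1 / 4 :> R by lra.
have cF x : (fun N => f_ N x * gdens x) @ \oo --> f x * gdens x.
  by apply: cvgMl; exact: cf.
have [h1 h2] := intRn_dominated_cvg q (fun N => (af N).1) dF cF.
by split => //; apply: cvgMr.
Unshelve. all: by end_near. Qed.

Lemma series_of_partial_poly F P N : series_of F P ->
  polyfun (fun x => \sum_(d < N) P d x).
Proof. by move=> [pP _ _]; apply: polyfun_sum => d; exact: pP. Qed.

Lemma series_of_gE F P Q : series_of F P -> polyfun Q ->
  admissible (fun x => F x * Q x) /\
  (fun N => \sum_(d < N) gE (fun x => P d x * Q x)) @ \oo --> gE (fun x => F x * Q x).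
Proof.
move=> sF pQ; have [pP bP cP] := sF.
have [] := @gE_dominated_cvg (fun N x => (\sum_(d < N) P d x) * Q x) (fun x => F x * Q x).
- move=> N; apply: polyfun_admissible; apply: polyfun_mul => //.
  exact: series_of_partial_poly sF.
- move=> e e0; have e2 : 0 < e / 2 by lra.
  have [C C0 h1] := bP _ e2; have [D D0 h2] := polyfun_subgauss pQ e2.
  exists (C * D); first exact: mulr_ge0.
  move=> N x; rewrite normrM.
  have h3 : `|\sum_(d < N) P d x| <= C * expR (e / 2 * sqnorm x).
    by apply: le_trans (ler_norm_sum _ _ _) (h1 N x).
  apply: (le_trans (ler_pM _ _ h3 (h2 x))) => //.
  rewrite mulrACA -expRD ler_wpM2l ?mulr_ge0// ler_expR; lra.
- by move=> x; apply: cvgMl; exact: cP.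
move=> h1 h2; split => //.
have -> : (fun N => \sum_(d < N) gE (fun x => P d x * Q x)) =
   (fun N => gE (fun x => (\sum_(d < N) P d x) * Q x)); last exact: h2.
apply/funext => N; rewrite -gE_sum.
  by congr gE; apply/funext => x; rewrite mulr_suml.
by move=> d; exact: polyfun_mul.
Qed.

Lemma series_of_add F G P Q : series_of F P -> series_of G Q ->
  series_of (fun x => F x + G x) (fun d x => P d x + Q d x).
Proof.
move=> [pP bP cP] [pQ bQ cQ]; split.
- by move=> d; exact: polyfun_add.
- move=> e e0; have [C C0 h1] := bP e e0; have [D D0 h2] := bQ e e0.
  exists (C + D); first exact: addr_ge0.
  move=> N x; rewrite mulrDl; apply: le_trans (lerD (h1 N x) (h2 N x)).
  by rewrite -big_split; apply: ler_sum => d _; exact: ler_normD.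
- by move=> x; under eq_fun do rewrite big_split; exact: cvgD.
Qed.

Lemma series_of_scale c F P : series_of F P ->
  series_of (fun x => c * F x) (fun d x => c * P d x).
Proof.
move=> [pP bP cP]; split.
- by move=> d; exact: polyfun_scale.
- move=> e e0; have [C C0 h1] := bP e e0.
  exists (`|c| * C); first exact: mulr_ge0.
  move=> N x; rewrite -mulrA; apply: le_trans (ler_wpM2l _ (h1 N x)) => //.
  by rewrite mulr_sumr; apply: ler_sum => d _; rewrite normrM.
- by move=> x; under eq_fun do rewrite -mulr_sumr; exact: cvgMr.
Qed.

Lemma series_of_mul F P Q : series_of F P -> polyfun Q ->
  series_of (fun x => Q x * F x) (fun d x => Q x * P d x).
Proof.
move=> [pP bP cP] pQ; split.
- by move=> d; exact: polyfun_mul.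
- move=> e e0; have e2 : 0 < e / 2 by lra.
  have [C C0 h1] := bP _ e2; have [D D0 h2] := polyfun_subgauss pQ e2.
  exists (D * C); first exact: mulr_ge0.
  move=> N x.
  have -> : \sum_(i < N) `|Q x * P i x| = `|Q x| * \sum_(i < N) `|P i x|.
    by rewrite mulr_sumr; apply: eq_bigr => i _; rewrite normrM.
  apply: (le_trans (ler_pM _ _ (h2 x) (h1 N x))) => //; first exact: sumr_ge0.
  rewrite mulrACA -expRD ler_wpM2l ?mulr_ge0// ler_expR; lra.
- move=> x; under eq_fun do rewrite -mulr_sumr.
  exact: cvgMr.
Qed.

(** After multiplication by a linear form the shift restores the agreement between index and
    degree. *)
Definition shift_series (P : nat -> V -> R) (d : nat) : V -> R :=
  if d is d'.+1 then P d' else fun _ => 0.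

Lemma series_of_shift F P : series_of F P -> series_of F (shift_series P).
Proof.
move=> [pP bP cP]; split.
- by case=> [|d]; [exact: polyfun_cst|exact: pP].
- move=> e e0; have [C C0 h1] := bP _ e0; exists C => //.
  case=> [|N] x; first by rewrite big_ord0 mulr_ge0 ?expR_ge0.
  by rewrite big_ord_recl /= normr0 add0r; exact: h1.
- move=> x; rewrite -cvg_shiftS.
  by under eq_fun do rewrite big_ord_recl /= add0r; exact: cP.
Qed.

End GaussianExpectation.

(** * Gaussian means of homogeneous harmonic polynomials *)

Section Harmonic.
Variables (R : realType) (m : nat).
Notation V := 'rV[R]_m.
Implicit Types (f g H : V -> R).

Inductive homf : nat -> (V -> R) -> Prop :=
| homf_cst c : homf 0 (fun _ => c)
| homf_zero k : homf k (fun _ => 0)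
| homf_add k f g : homf k f -> homf k g -> homf k (fun x => f x + g x)
| homf_coord j k f : homf k f -> homf k.+1 (fun x => x 0 j * f x).

Lemma homf_polyfun k f : homf k f -> polyfun f.
Proof.
elim=> [c|{}k|{}k {}f g _ hf _ hg|j {}k {}f _ hf].
- exact: polyfun_cst.
- exact: polyfun_cst.
- exact: polyfun_add.
- by apply: polyfun_mul => //; exact: polyfun_coord.
Qed.

Lemma homf_scale k f c : homf k f -> homf k (fun x => c * f x).
Proof.
elim=> [d|{}k|{}k {}f g _ hf _ hg|j {}k {}f _ hf].
- exact: homf_cst.
- have := homf_zero k; congr homf; apply/funext => x; by rewrite mulr0.
- have := homf_add hf hg; congr homf; apply/funext => x; by rewrite mulrDr.
- have := homf_coord j hf; congr homf; apply/funext => x; by rewrite mulrCA.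
Qed.

Lemma homf_sum k (I : Type) (r : seq I) (P : pred I) (F : I -> V -> R) :
  (forall i, homf k (F i)) -> homf k (fun x => \sum_(i <- r | P i) F i x).
Proof.
move=> pF; elim: r => [|i r ih].
  by under eq_fun do rewrite big_nil; exact: homf_zero.
under eq_fun do rewrite big_cons.
by case: (P i) => //; exact: homf_add.
Qed.

Lemma homf_mul k l f g : homf k f -> homf l g -> homf (k + l) (fun x => f x * g x).
Proof.
move=> hf hg; elim: hf => [c|{}k|{}k {}f f' _ h1 _ h2|j {}k {}f _ h].
- exact: homf_scale.
- have := homf_zero (k + l); congr homf; apply/funext => x; by rewrite mul0r.
- have := homf_add h1 h2; congr homf; apply/funext => x; by rewrite mulrDl.
- have := homf_coord j h; congr homf; apply/funext => x; by rewrite mulrA.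
Qed.

Lemma homf_dot y : homf 1 (fun x => dotR x y).
Proof.
apply: homf_sum => j.
have := homf_coord j (homf_cst (y 0 j)); congr homf.
Qed.

Lemma homf_sqnorm : homf 2 (@sqnorm R m).
Proof.
apply: homf_sum => j.
have := homf_coord j (homf_coord j (homf_cst 1)); congr homf.
by apply/funext => x; rewrite mulr1.
Qed.

Lemma homf_exp k n f : homf k f -> homf (n * k) (fun x => f x ^+ n).
Proof.
move=> hf; elim: n => [|n ih].
  by under eq_fun do rewrite expr0; exact: homf_cst.
by under eq_fun do rewrite exprS; rewrite mulSn; exact: homf_mul.
Qed.

Lemma homf0_cst f : homf 0 f -> forall x y, f x = f y.
Proof.
suff gen k : homf k f -> k = 0%N -> forall x y, f x = f y by move=> h; exact: gen h _.
elim=> // {}k {}f g _ h1 _ h2 k0 x y.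
by rewrite (h1 k0 x y) (h2 k0 x y).
Qed.

Lemma homf_at0 k f : homf k.+1 f -> f 0 = 0.
Proof.
move: {-2}k.+1 (erefl k.+1) => l kl hf; elim: hf kl => //.
- by move=> l' {}f g _ h1 _ h2 kl; rewrite h1// h2// addr0.
- by move=> j l' {}f _ _ _; rewrite mxE mul0r.
Qed.

Lemma homf0_dd v f : homf 0 f -> dd v f = fun _ => 0.
Proof.
move=> /homf0_cst h; have -> : f = fun _ => f 0 by apply/funext => x; exact: h.
exact: dd_cst.
Qed.

Lemma homfS_dd v k f : homf k.+1 f -> homf k (dd v f).
Proof.
move: {-2}k.+1 (erefl k.+1) => l kl hf; elim: hf k kl => //.
- by move=> l' k _; rewrite dd_cst; exact: homf_zero.
- move=> l' {}f g hf h1 hg h2 k kl.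
  rewrite (dd_add v (homf_polyfun hf) (homf_polyfun hg)); apply: homf_add; [exact: h1|exact: h2].
- move=> j l' {}f hf ih k [e]; subst l'.
  rewrite (dd_mul v (polyfun_coord R j) (homf_polyfun hf)) dd_coord.
  apply: homf_add; first exact: homf_scale.
  case: k hf ih => [|k] hf ih.
    rewrite (homf0_dd v hf); have := homf_zero 0; congr homf.
    by apply/funext => x; rewrite mulr0.
  by apply: homf_coord; exact: ih.
Qed.

Lemma euler k f x : homf k f -> dd x f x = k%:R * f x.
Proof.
elim=> [c|{}k|{}k {}f g hf h1 hg h2|j {}k {}f hf h].
- by rewrite dd_cst mul0r.
- by rewrite dd_cst mulr0.
- by rewrite (dd_add x (homf_polyfun hf) (homf_polyfun hg)) h1 h2 mulrDr.
- rewrite (dd_mul x (polyfun_coord R j) (homf_polyfun hf)) dd_coord h -natr1; ring.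
Qed.

Definition harmonicf f := forall x, \sum_j part j (part j f) x = 0.

Lemma harmonicf_dd v f : polyfun f -> harmonicf f -> harmonicf (dd v f).
Proof.
move=> pf hf x.
have pp j := polyfun_dd (delta_mx 0 j) pf.
have -> : \sum_j part j (part j (dd v f)) x = dd v (fun x => \sum_j part j (part j f) x) x.
  rewrite dd_sum; last by move=> j; apply: polyfun_dd; exact: pp.
  by apply: eq_bigr => j _; rewrite /part (dd_comm _ v pf) (dd_comm _ v (pp j)).
have -> : (fun x => \sum_j part j (part j f) x) = (fun _ => 0) by apply/funext.
by rewrite dd_cst.
Qed.

Lemma gE_euler f : polyfun f -> gE (fun x => dd x f x) = gE (fun x => \sum_j part j (part j f) x).
Proof.
move=> pf; have pp j := polyfun_dd (delta_mx 0 j) pf.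
have -> : (fun x => dd x f x) = (fun x => \sum_j x 0 j * part j f x).
  by apply/funext => x; exact: dd_part.
rewrite !gE_sum.
- by apply: eq_bigr => j _; rewrite (gE_coord j (pp j)).
- by move=> j; exact: polyfun_mul (polyfun_coord R j) (pp j).
- by move=> j; exact: (polyfun_dd (delta_mx 0 j) (pp j)).
Qed.

(** By [gE_euler], k E[H] is the mean of the Laplacian of H, which is zero. *)
Lemma gE_harmonicf k H : homf k H -> harmonicf H -> gE H = (k == 0%N)%:R * H 0.
Proof.
case: k => [|k] hH harmH.
  rewrite mul1r -[RHS](gE_cst m (H 0)); congr gE; apply/funext => x.
  exact: homf0_cst.
have pH := homf_polyfun hH; have := gE_euler pH.
have -> : (fun x => dd x H x) = (fun x => k.+1%:R * H x).
  by apply/funext => x; exact: euler.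
have -> : (fun x => \sum_j part j (part j H) x) = (fun _ => 0) by apply/funext.
rewrite gE0 gE_scale// mul0r => /eqP; rewrite mulf_eq0 pnatr_eq0 /= => /eqP->.
by rewrite ?mul0r.
Qed.

(** Since E[x_j (x_j f)] = E[f] + E[x_j d_j f], the sum over j is m E[f] plus the mean of the Euler
    derivative k f. *)
Lemma gE_sqnorm k f : homf k f -> gE (fun x => sqnorm x * f x) = (m%:R + k%:R) * gE f.
Proof.
move=> hf; have pf := homf_polyfun hf.
have pc j := @polyfun_coord R m j.
have -> : (fun x => sqnorm x * f x) = (fun x => \sum_j x 0 j * (x 0 j * f x)).
  by apply/funext => x; rewrite /sqnorm /dotR mulr_suml; apply: eq_bigr => j _; rewrite mulrA.
rewrite gE_sum; last by move=> j; do 2 apply: polyfun_mul => //.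
have pxp j : polyfun (fun x => x 0 j * part j f x) by apply: polyfun_mul => //; exact: polyfun_dd.
transitivity (\sum_j (gE f + gE (fun x => x 0 j * part j f x))).
  apply: eq_bigr => j _; rewrite (gE_coord j (polyfun_mul (pc j) pf)).
  rewrite -gE_add//; congr gE; rewrite /part (dd_mul _ (pc j) pf) dd_coord.
  by apply/funext => x; rewrite mxE !eqxx mul1r.
rewrite big_split /= sumr_const card_ord mulrDl mulr_natl; congr (_ + _).
rewrite -gE_sum// -gE_scale//; congr gE; apply/funext => x.
by rewrite -(euler x hf) dd_part.
Qed.

Lemma gE_sqnorm_exp j k f : homf k f ->
  gE (fun x => sqnorm x ^+ j * f x) = (\prod_(r < j) (m%:R + k%:R + 2 * r%:R)) * gE f.
Proof.
move=> hf; elim: j => [|j ih].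
  by rewrite big_ord0 mul1r; congr gE; apply/funext => x; rewrite expr0 mul1r.
have -> : (fun x => sqnorm x ^+ j.+1 * f x) = (fun x => sqnorm x * (sqnorm x ^+ j * f x)).
  by apply/funext => x; rewrite exprS mulrA.
rewrite (gE_sqnorm (homf_mul (homf_exp j homf_sqnorm) hf)) ih big_ord_recr /= natrD natrM; ring.
Qed.

Variable y : V.

(* The square of [t_of x y]. *)
Definition qform (x : V) : R := sqnorm y * sqnorm x - dotR x y ^+ 2.

Lemma homf_qf : homf 2 qform.
Proof.
have := homf_add (homf_scale (sqnorm y) homf_sqnorm) (homf_scale (-1) (homf_exp 2 (homf_dot y))).
by congr homf; apply/funext => x; rewrite /qform; ring.
Qed.

Lemma polyfun_qf : polyfun qform. Proof. exact: homf_polyfun homf_qf. Qed.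

Lemma polyfun_dot : polyfun (fun x => dotR x y).
Proof. exact: homf_polyfun (homf_dot y). Qed.

Lemma dotRC (x z : V) : dotR x z = dotR z x.
Proof. by apply: eq_bigr => j _; rewrite mulrC. Qed.

Lemma dd_dot v : dd v (fun x => dotR x y) = fun _ => dotR v y.
Proof.
have pc j : polyfun (fun x : V => x 0 j * y 0 j).
  by apply: polyfun_mul; [exact: polyfun_coord|exact: polyfun_cst].
rewrite /dotR dd_sum//; apply/funext => x; apply: eq_bigr => j _.
rewrite (dd_mul v (polyfun_coord R j) (polyfun_cst m (y 0 j))) dd_coord dd_cst.
by rewrite mulr0 addr0.
Qed.

Lemma dd_sqnorm v : dd v (@sqnorm R m) = fun x => 2 * dotR v x.
Proof.
have pc j := polyfun_coord (m := m) R j.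
rewrite /sqnorm /dotR dd_sum; last by move=> j; exact: polyfun_mul.
apply/funext => x; rewrite mulr_sumr; apply: eq_bigr => j _.
by rewrite (dd_mul v (pc j) (pc j)) dd_coord; ring.
Qed.

Lemma dd_qf v : dd v qform = fun x => 2 * (sqnorm y * dotR v x - dotR x y * dotR v y).
Proof.
have pS := homf_polyfun homf_sqnorm.
rewrite /qform (dd_sub v (polyfun_scale _ pS) (polyfun_exp 2 polyfun_dot)).
rewrite (dd_scale v _ pS) dd_sqnorm (dd_exp v 2 polyfun_dot) dd_dot.
by apply/funext => x; rewrite /= expr1; ring.
Qed.

(** Adding a multiple of y to x does not change x ^ y, hence not its squared norm. Derivatives along
    y therefore pass through powers of [qform]. *)
Lemma dd_y_qf : dd y qform = fun _ => 0.
Proof. by rewrite dd_qf; apply/funext => x; rewrite (dotRC x y) /sqnorm; ring. Qed.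

Lemma dd_y_qfX n f : polyfun f -> dd y (fun x => qform x ^+ n * f x) = fun x => qform x ^+ n * dd y f x.
Proof.
move=> pf; rewrite (dd_mul y (polyfun_exp n polyfun_qf) pf) (dd_exp y n polyfun_qf) dd_y_qf.
by apply/funext => x; rewrite mulr0 mul0r add0r.
Qed.

(** Expand one factor as |y|^2 |x|^2 - s^2. The first term is governed by the degree 2n + k; the
    second is integrated by parts twice along y, which costs one |y|^2 (whence m - 1) and puts both
    derivatives on f. *)
Lemma gE_qfS n k f : homf k f ->
  gE (fun x => qform x ^+ n.+1 * f x) =
  sqnorm y * (m%:R - 1 + 2 * n%:R + k%:R) * gE (fun x => qform x ^+ n * f x)
  - gE (fun x => qform x ^+ n * dd y (dd y f) x).
Proof.
move=> hf; have pf := homf_polyfun hf.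
have pq := polyfun_exp n polyfun_qf; have ps := polyfun_dot.
pose g x := qform x ^+ n * f x.
have hg : homf (n * 2 + k) g by exact: homf_mul (homf_exp n homf_qf) hf.
have pg := homf_polyfun hg.
have -> : (fun x => qform x ^+ n.+1 * f x) =
  (fun x => sqnorm y * (sqnorm x * g x) - dotR x y * (dotR x y * g x)).
  by apply/funext => x; rewrite exprS /g {1}/qform; ring.
have psg := polyfun_mul ps pg.
have pSg := polyfun_mul (homf_polyfun homf_sqnorm) pg.
rewrite (gE_sub (polyfun_scale _ pSg) (polyfun_mul ps psg)) (gE_scale _ pSg).
rewrite (gE_sqnorm hg) (gE_dot y psg) (dd_mul y ps pg) dd_dot.
have pdf := polyfun_dd y pf.
have e : dd y g = fun x => qform x ^+ n * dd y f x by exact: dd_y_qfX.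
have pdg : polyfun (dd y g) by exact: polyfun_dd.
rewrite (gE_add (polyfun_scale _ pg) (polyfun_mul ps pdg)) (gE_scale _ pg).
rewrite (gE_dot y pdg) e (dd_y_qfX n pdf) natrD natrM -/g /sqnorm; ring.
Qed.

(** The ratio of E[q^n H] to |y|^(2(n-k)) H(y) for harmonic H of degree 2k. For k = 0 it is the n-th
    moment of a chi-square law with m - 1 degrees of freedom. The binomial kills k > n, where n - k
    would truncate. *)
Definition qcoef (n k : nat) : R := (-1) ^+ k * ((k.*2)`!)%:R * ('C(n, k))%:R *
  \prod_(k <= j < n) (m%:R - 1 + 2 * j%:R).

(** The recursion of [gE_qfS] in degree 2k + 2; two derivatives of H along y, evaluated at y, give
    (2k+2)(2k+1) H(y). *)
Lemma qcoefSS n k : qcoef n.+1 k.+1 =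
  (m%:R - 1 + 2 * n%:R + 2 * k.+1%:R) * qcoef n k.+1 - (k.*2.+2 * k.*2.+1)%:R * qcoef n k.
Proof.
rewrite /qcoef doubleS !factS; have [nk|kn] := ltnP n k.
  by rewrite !bin_small ?ltnS// 1?ltnW//; ring.
rewrite binS !natrM !natrD.
move: kn; rewrite leq_eqVlt => /predU1P[<-|kn].
  by rewrite (bin_small (ltnSn k)) binn !big_geq//= exprS; ring.
have e : (k.+1)%:R * ('C(n, k.+1))%:R = (n%:R - k%:R) * ('C(n, k))%:R :> R.
  by rewrite -natrM mul_bin_left natrM natrB// ltnW.
rewrite (big_nat_recr n)//= (big_ltn kn) exprS.
set P := \prod_(_ <= _ < _) _.
set B := ('C(n, k.+1))%:R in e *; set C := ('C(n, k))%:R in e *.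
set F := (_`!)%:R; set b := m%:R - 1.
set a := k.*2.+2%:R; set c := k.*2.+1%:R.
suff : (B + C) * (b + 2 * n%:R) = (b + 2 * n%:R + 2 * k.+1%:R) * B + C * (b + 2 * k%:R).
  move=> h.
  have -> : -1 * (-1) ^+ k * (a * (c * F)) * (B + C) * (P * (b + 2 * n%:R)) =
    -1 * (-1) ^+ k * (a * (c * F)) * P * ((B + C) * (b + 2 * n%:R)) by ring.
  by rewrite h; ring.
have -> : (b + 2 * n%:R + 2 * k.+1%:R) * B = (b + 2 * n%:R) * B + 2 * (k.+1%:R * B) by ring.
by rewrite e; ring.
Qed.

Lemma gE_qfX_harmonicf n k H : homf k H -> harmonicf H ->
  gE (fun x => qform x ^+ n * H x) =
  (if odd k then 0 else qcoef n k./2 * sqnorm y ^+ (n - k./2)) * H y.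
Proof.
elim: n k H => [|n ih] k H hH harmH.
  have -> : (fun x => qform x ^+ 0 * H x) = H by apply/funext => x; rewrite expr0 mul1r.
  rewrite (gE_harmonicf hH harmH); case: k hH => [|k] hH.
    by rewrite /qcoef big_geq// bin0 !mulr1 expr0 !mul1r (homf0_cst hH 0 y).
  rewrite mul0r; case: k hH => [|k] hH /=; first by rewrite mul0r.
  by rewrite negbK /qcoef bin0n /= mulr0 mul0r; case: ifP => _; rewrite !mul0r.
rewrite (gE_qfS n hH) (ih _ _ hH harmH).
have pH := homf_polyfun hH.
case: k hH => [|[|k]] hH.
- have -> : (fun x => qform x ^+ n * dd y (dd y H) x) = fun _ => 0.
    by apply/funext => x; rewrite (homf0_dd y hH) dd_cst mulr0.
  rewrite gE0 /= subr0 !subn0 /qcoef !bin0 (big_nat_recr n)//= exprS; ring.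
- have -> : (fun x => qform x ^+ n * dd y (dd y H) x) = fun _ => 0.
    by apply/funext => x; rewrite (homf0_dd y (homfS_dd y hH)) mulr0.
  by rewrite gE0 /= !mul0r mulr0 subr0.
- have h1 := homfS_dd y hH; have h2 := homfS_dd y h1.
  have harm2 : harmonicf (dd y (dd y H)).
    apply: harmonicf_dd; first exact: polyfun_dd.
    exact: harmonicf_dd.
  rewrite (ih _ _ h2 harm2) (euler y h1) (euler y hH) /= negbK.
  have [kodd|keven] := boolP (odd k); first by rewrite !mul0r mulr0 subr0.
  rewrite subSS qcoefSS.
  have ek : k = (k./2).*2 by rewrite even_halfK.
  have ek2 : k.+2%:R = 2 * (k./2).+1%:R :> R by rewrite {1}ek -doubleS -mul2n natrM.
  have ek1 : (k./2.*2.+2 * k./2.*2.+1)%:R = k.+2%:R * k.+1%:R :> R by rewrite -ek natrM.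
  have [nk|kn] := ltnP n k./2.+1.
    have -> : qcoef n k./2.+1 = 0 by rewrite /qcoef bin_small// mulr0 mul0r.
    rewrite ek1; ring.
  have -> : (n - k./2 = (n - k./2.+1).+1)%N by lia.
  rewrite exprS ek1 ek2; ring.
Qed.

End Harmonic.

(** * Homogeneous parts of the kernel and their gradients *)

Section KernelPolynomials.
Variables (R : realType) (m : nat) (y : 'rV[R]_m).
Notation V := 'rV[R]_m.
Notation qf := (qform y).

(** The coefficient of t^(2n) in sqrt(pi/2) J~_(h-1/2)(t). Truncation of the predecessor at n = h =
    0 encodes (-1)!! = 1. *)
Definition bessel_coef (h n : nat) : R :=
  (-1) ^+ n / (2 ^+ n * (n`!)%:R * (dfact (n + h).*2.-1)%:R).

(* The part of Phi^h_i = [bessel_sum y h i], defined below, that is homogeneous of degree [n] in [x].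
   It comes from Phi^h_(i+1) = s Phi^h_i + i Phi^(h-1)_(i-1), where [kpoly_lower] expresses the
   degree-n part of Phi^(h-1)_(i-1) as a multiple of that of Phi^h_(i-1). *)
Fixpoint kpoly (h i : nat) : nat -> V -> R :=
  match i with
  | 0 => fun n x => if odd n then 0 else bessel_coef h n./2 * qf x ^+ n./2
  | i1.+1 => fun n x =>
      shift_series (fun d x => dotR x y * kpoly h i1 d x) n x +
      i1%:R * (2 * h%:R - i1%:R + n%:R) *
      match i1 with 0 => 0 | i2.+1 => kpoly h i2 n x end
  end.

Lemma kpoly0 h i x : kpoly h i.+1 0 x =
  i%:R * (2 * h%:R - i%:R) * kpoly h i.-1 0 x.
Proof. by case: i => [|i] /=; rewrite add0r ?mul0r ?addr0. Qed.

Lemma kpolyS h i n x : kpoly h i.+1 n.+1 x =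
  dotR x y * kpoly h i n x + i%:R * (2 * h%:R - i%:R + n.+1%:R) * kpoly h i.-1 n.+1 x.
Proof. by case: i => [|i] //=; rewrite ?mul0r. Qed.

(** Two-step induction with [i.-1] truncated at 0; in [kpolyS] the corresponding term carries the
    factor i. *)
Lemma kpoly_ind (P : nat -> Prop) : P 0%N ->
  (forall i, P i -> P i.-1 -> P i.+1) -> forall i, P i.
Proof.
move=> P0 PS i; suff [] : P i /\ P i.-1 by [].
by elim: i => [|i [h1 h2]]; split => //; exact: PS.
Qed.

Lemma homf_kpoly h i n : homf n (kpoly h i n).
Proof.
elim/kpoly_ind: i n => [|i h1 h2] n.
  have [on|on] := boolP (odd n).
    have -> : kpoly h 0 n = fun _ => 0 by apply/funext => x; rewrite /= on.
    exact: homf_zero.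
  have -> : kpoly h 0 n = fun x => bessel_coef h n./2 * qf x ^+ n./2.
    by apply/funext => x; rewrite /= (negPf on).
  have := homf_scale (bessel_coef h n./2) (homf_exp n./2 (homf_qf y)).
  by rewrite muln2 even_halfK.
case: n => [|n].
  have := homf_scale (i%:R * (2 * h%:R - i%:R)) (h2 0%N); congr homf.
  by apply/funext => x; rewrite kpoly0.
have := homf_add (homf_mul (homf_dot y) (h1 n))
  (homf_scale (i%:R * (2 * h%:R - i%:R + n.+1%:R)) (h2 n.+1)); congr homf.
by apply/funext => x; rewrite kpolyS.
Qed.

Lemma polyfun_kpoly h i n : polyfun (kpoly h i n).
Proof. exact: homf_polyfun (homf_kpoly h i n). Qed.

(** This is J~_(a-1) = (2a + t d/dt) J~_a with a = h - l + 1/2 in the l-th term. In degree n the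
    Bessel factor has degree n - i + 2l, so the multiplier 2h + 1 - i + n is the same for all l. *)
Lemma kpoly_lower h i n x :
  kpoly h i n x = (2 * h%:R + 1 - i%:R + n%:R) * kpoly h.+1 i n x.
Proof.
elim/kpoly_ind: i n => [|i h1 h2] n.
  rewrite /=; case: ifP => [_|/negbT on]; first by rewrite mulr0.
  rewrite mulrA; congr (_ * _).
  have en : n%:R = 2 * (n./2)%:R :> R by rewrite -{1}(even_halfK on) -mul2n natrM.
  rewrite /bessel_coef addnS doubleS -pred_Sn.
  have -> : dfact (n./2 + h).*2.+1 = ((n./2 + h).*2.+1 * dfact (n./2 + h).*2.-1)%N.
    by case: (n./2 + h)%N.
  have d0 : (dfact (n./2 + h).*2.-1)%:R != 0 :> R.
    by rewrite pnatr_eq0 -lt0n dfact_gt0.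
  have e : (n./2 + h).*2.+1%:R = 2 * h%:R + 1 - 0%:R + n%:R :> R.
    by rewrite -natr1 -mul2n natrM natrD en; ring.
  rewrite (natrM R (n./2 + h).*2.+1) e.
  have e0 : 2 * h%:R + 1 - 0%:R + n%:R != 0 :> R by rewrite -e pnatr_eq0.
  have f0 : (n./2)`!%:R != 0 :> R by rewrite pnatr_eq0 -lt0n fact_gt0.
  have t0 : 2 ^+ n./2 != 0 :> R by rewrite expf_neq0// pnatr_eq0.
  move: e0 d0 f0 t0; move: (2 * h%:R + 1 - 0%:R + n%:R) => a.
  move: (dfact _)%:R (_`!)%:R (2 ^+ _) ((-1) ^+ _) => b c d e'.
  by move=> *; field; do ?[apply/andP; split].
case: n => [|n].
  rewrite !kpoly0 h2; case: i {h1 h2} => [|i]; first by rewrite !mul0r mulr0.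
  rewrite -!natr1 /=; ring.
rewrite !kpolyS h1 h2; case: i {h1 h2} => [|i]; rewrite -!natr1 /=; ring.
Qed.

Lemma part_dotx j : part j (fun x => dotR x y) = fun _ => y 0 j.
Proof.
rewrite /part dd_dot; apply/funext => x; rewrite /dotR (bigD1 j)//= mxE !eqxx mul1r.
by rewrite big1 ?addr0// => k kj; rewrite mxE (negPf kj) andbF mul0r.
Qed.

Lemma part_qf j : part j qf = fun x => 2 * (sqnorm y * x 0 j - dotR x y * y 0 j).
Proof.
have dj (z : V) : dotR (delta_mx 0 j) z = z 0 j.
  rewrite /dotR (bigD1 j)//= mxE !eqxx mul1r.
  by rewrite big1 ?addr0// => k kj; rewrite mxE (negPf kj) andbF mul0r.
by rewrite /part dd_qf; apply/funext => x; rewrite !dj.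
Qed.

(** Coefficient form of J~_a'(t) = - t J~_(a+1)(t). *)
Lemma bessel_coefS h n : 2 * n.+1%:R * bessel_coef h n.+1 = - bessel_coef h.+1 n.
Proof.
rewrite /bessel_coef addSnnS exprS [2 ^+ n.+1]exprS factS natrM.
have n0 : n.+1%:R != 0 :> R by rewrite pnatr_eq0.
have d0 : (dfact (n + h.+1).*2.-1)%:R != 0 :> R by rewrite pnatr_eq0 -lt0n dfact_gt0.
have f0 : (n`!)%:R != 0 :> R by rewrite pnatr_eq0 -lt0n fact_gt0.
have t0 : 2 ^+ n != 0 :> R by rewrite expf_neq0// pnatr_eq0.
move: n0 d0 f0 t0.
move: (dfact _)%:R (_`!)%:R (2 ^+ _) ((-1) ^+ _) (n.+1%:R) => b c d e' a.
by move=> *; field; do ?[apply/andP; split].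
Qed.

(** The chain rule in s and q = t^2: the derivative of Phi^h_i in s is i Phi^h_(i-1), that in q is
    -1/2 Phi^(h+1)_i, and d_j q = 2 (|y|^2 x_j - s y_j). This last factor is linear in x, hence the
    shift. *)
Lemma part_kpoly h i n j x : part j (kpoly h i n.+1) x =
  y 0 j * i%:R * kpoly h i.-1 n x
  - (sqnorm y * x 0 j - dotR x y * y 0 j) * shift_series (kpoly h.+1 i) n x.
Proof.
elim/kpoly_ind: i n => [|i h1 h2] n.
  rewrite mulr0 mul0r sub0r.
  case: n => [|n].
    have -> : kpoly h 0 1 = fun _ => 0 by [].
    by rewrite /part dd_cst mulr0 oppr0.
  have [on|on] := boolP (odd n).
    have -> : kpoly h 0 n.+2 = fun _ => 0 by apply/funext => z; rewrite /= negbK on.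
    by rewrite /part dd_cst /= on mulr0 oppr0.
  have -> : kpoly h 0 n.+2 = fun x => bessel_coef h (n./2).+1 * qf x ^+ (n./2).+1.
    by apply/funext => z; rewrite /= negbK (negPf on).
  have pq := polyfun_qf y.
  rewrite /part (dd_scale _ _ (polyfun_exp _ pq)) (dd_exp _ _ pq) -/(part j qf) part_qf.
  rewrite /= (negPf on).
  have -> : bessel_coef h.+1 n./2 = - (2 * (n./2).+1%:R * bessel_coef h (n./2).+1).
    by rewrite bessel_coefS opprK.
  ring.
have pk a b := polyfun_kpoly h a b.
have ps := polyfun_dot y.
have -> : kpoly h i.+1 n.+1 = fun x => dotR x y * kpoly h i n x +
    i%:R * (2 * h%:R - i%:R + n.+1%:R) * kpoly h i.-1 n.+1 x.
  by apply/funext => z; rewrite kpolyS.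
rewrite /part (dd_add _ (polyfun_mul ps (pk i n)) (polyfun_scale _ (pk i.-1 n.+1))).
rewrite (dd_mul _ ps (pk i n)) (dd_scale _ _ (pk i.-1 n.+1)).
rewrite -!/(part j _) part_dotx h2.
case: n => [|n].
  have -> : part j (kpoly h i 0) x = 0.
    by rewrite /part (homf0_dd _ (homf_kpoly h i 0)).
  rewrite /= mulr0 addr0 !mulr0 !subr0.
  case: i {h1 h2} => [|i]; first by rewrite /=; ring.
  rewrite kpoly0 -!natr1 /=; ring.
rewrite h1.
have -> : shift_series (kpoly h.+1 i.+1) n.+1 x = kpoly h.+1 i.+1 n x by [].
have -> : shift_series (kpoly h.+1 i.-1) n.+1 x = kpoly h.+1 i.-1 n x by [].
case: n => [|n].
  case: i {h1 h2} => [|i]; first by rewrite kpoly0 /=; ring.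
  rewrite kpoly0 kpolyS -!natr1 /=; ring.
have -> : shift_series (kpoly h.+1 i) n.+1 x = kpoly h.+1 i n x by [].
rewrite (kpolyS h.+1 i n).
case: i {h1 h2} => [|i]; first by rewrite /= mul0r; ring.
rewrite (kpolyS h i n.+1) -!natr1 /=; ring.
Qed.

End KernelPolynomials.

(** * A Funk-Hecke formula for the scalar kernel *)

Section FunkHecke.
Variables (R : realType) (m : nat) (y : 'rV[R]_m).
Notation V := 'rV[R]_m.
Notation qf := (qform y).

(* The coefficient of z^n in z^k exp(-u z^2 / 2). *)
Definition gcoef (u : R) (k n : nat) : R :=
  if (k <= n)%N && ~~ odd (n - k)
  then (- u) ^+ (n - k)./2 / (2 ^+ (n - k)./2 * ((n - k)./2`!)%:R) else 0.

(* The convention (-1)!! = 1 is encoded by [0.-1 = 0]. *)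
Definition kernel_eig (i k : nat) : R :=
  if odd (i + k) then 0
  else (dfact (k + i).-1)%:R / (dfact (k + (m - 2 - i)).-1)%:R.

Lemma gcoefSS u k n : gcoef u k.+1 n.+1 = gcoef u k n.
Proof. by rewrite /gcoef ltnS subSS. Qed.

Lemma gcoef_lt u k n : (n < k)%N -> gcoef u k n = 0.
Proof. by move=> h; rewrite /gcoef leqNgt h. Qed.

Lemma gcoef_double u k N : gcoef u k (k + N.*2) = (- u) ^+ N / (2 ^+ N * (N`!)%:R).
Proof. by rewrite /gcoef leq_addr addKn odd_double /= doubleK. Qed.

Lemma gcoef_odd u k N : gcoef u k (k + N.*2.+1) = 0.
Proof. by rewrite /gcoef leq_addr addKn /= odd_double /=. Qed.

Lemma gcoef_double_rec u N : 2 * N.+1%:R * ((- u) ^+ N.+1 / (2 ^+ N.+1 * (N.+1`!)%:R)) =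
  - u * ((- u) ^+ N / (2 ^+ N * (N`!)%:R)) :> R.
Proof.
rewrite !exprS factS (natrM R N.+1).
have n0 : N.+1%:R != 0 :> R by rewrite pnatr_eq0.
have f0 : (N`!)%:R != 0 :> R by rewrite pnatr_eq0 -lt0n fact_gt0.
have t0 : 2 ^+ N != 0 :> R by rewrite expf_neq0// pnatr_eq0.
move: n0 f0 t0; move: (N.+1%:R) (N`!)%:R (2 ^+ N) ((- u) ^+ N) => a b c e *.
by field; do ?[apply/andP; split].
Qed.

(** Apply z d/dz to z^k exp(-u z^2/2): it multiplies by k - u z^2. The double shift of constant
    functions is a shift of the index by two, padded with zeros. *)
Lemma gcoef_rec u k n : u * shift_series (m := 0) (shift_series (m := 0) (fun d _ => gcoef u k d)) n 0 =
  (k%:R - n%:R) * gcoef u k n.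
Proof.
have [nk|kn] := ltnP n k.
  rewrite (gcoef_lt _ nk) mulr0; case: n nk => [|[|n]] nk /=; rewrite ?mulr0//.
  by rewrite gcoef_lt ?mulr0//; lia.
have -> : n = (k + (n - k))%N by lia.
rewrite -(odd_double_half (n - k)).
case: (odd (n - k)) => /=; rewrite ?add1n ?add0n.
  rewrite gcoef_odd mulr0 addnS /=.
  case: k {kn} => [|k]; case: (n - _)./2 => [|N] /=; rewrite ?mulr0//.
  - by have := gcoef_odd u 0 N; rewrite add0n => ->; rewrite mulr0.
  - by rewrite addn0 gcoef_lt ?mulr0.
  - by rewrite doubleS addnS /= gcoef_odd mulr0.
case: (n - k)./2 => [|N].
  rewrite double0 addn0 subrr mul0r.
  case: k {kn} => [|[|k]] /=; rewrite ?mulr0// gcoef_lt ?mulr0//.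
rewrite doubleS !addnS /= gcoef_double -!addnS -doubleS gcoef_double.
have -> : k%:R - (k + N.+1.*2)%:R = - (2 * N.+1%:R) :> R by rewrite natrD -mul2n natrM; ring.
by rewrite mulNr gcoef_double_rec; ring.
Qed.

Lemma dfactE n : (0 < n)%N -> dfact n = (n * dfact n.-2)%N.
Proof. by case: n => [|[|n]]. Qed.

(** For i + k odd, m - 2 - i + k cancels the leading factor of the last denominator; over
    (k+m-i-4)!! there remains k (k+i-2)!! + i (k+i-2)!! = (k+i)!!. For i + k even all terms
    vanish. *)
Lemma kernel_eig_rec i k : (i.+1 <= m - 2)%N ->
  kernel_eig i.+1 k = k%:R * kernel_eig i k.-1 + i%:R * (m%:R - 2 - i%:R + k%:R) * kernel_eig i.-1 k.
Proof.
move=> im; case: i im => [|i] im.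
  rewrite /= !mul0r addr0; case: k => [|k] /=; first by rewrite /kernel_eig mul0r.
  rewrite /kernel_eig add1n add0n addn0 subn0 -[odd k.+2]negbK /= !negbK.
  case: ifP => ok; first by rewrite mulr0.
  have -> : (k + 1)%N = k.+1 by lia.
  have -> : (k + (m - 2 - 1) = (k + (m - 2)).-1)%N by lia.
  by rewrite (@dfactE k.+1)// (natrM R k.+1) mulrA.
have e3 : m%:R - 2 - i.+1%:R + k%:R = (k + (m - 2 - i.+1))%:R :> R.
  by rewrite natrD !natrB//; [ring|lia..].
rewrite e3 /=; have [ok|ok] := boolP (odd (i + k)).
  rewrite /kernel_eig ; case: k ok e3 => [|k] ok e3 /=.
    by rewrite addn0 in ok; rewrite !addn0 ok /= !mul0r mulr0 addr0.
  move: ok; rewrite addnS /= => ok.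
  by rewrite !addSn !addnS /= !negbK ok /= !mulr0 addr0.
have ei2 : odd (i.+2 + k) = false by rewrite !addSn /= negbK (negPf ok).
rewrite [kernel_eig i.+2 k]/kernel_eig ei2 [kernel_eig i k]/kernel_eig (negPf ok).
set a := (k + (m - 2 - i.+1))%N.
have a0 : (0 < a)%N by rewrite /a; lia.
have ea : (k + (m - 2 - i.+2)).-1 = a.-2 by rewrite /a; lia.
have ea2 : (k + (m - 2 - i)).-1 = a by rewrite /a; lia.
rewrite ea ea2 (@dfactE a)// (natrM R a).
have -> : (k + i.+2).-1 = (k + i).+1 by lia.
rewrite (@dfactE (k + i).+1)// (natrM R (k + i).+1) /=.
have d0 : (dfact a.-2)%:R != 0 :> R by rewrite pnatr_eq0 -lt0n dfact_gt0.
have aa0 : a%:R != 0 :> R by rewrite pnatr_eq0 -lt0n.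
have eB : k%:R * kernel_eig i.+1 k.-1 = k%:R * ((dfact (k + i).-1)%:R / (dfact a.-2)%:R).
  case: k ok e3 @a a0 ea ea2 d0 aa0 {ei2} => [|k] ok e3 a a0 ea ea2 d0 aa0; first by rewrite !mul0r.
  rewrite /kernel_eig -[k.+1.-1]/k; have -> : odd (i.+1 + k) = false by rewrite addSnnS (negPf ok).
  by congr (_ * ((dfact _)%:R / (dfact _)%:R)); rewrite /a; lia.
rewrite eB -!natr1 natrD.
move: d0 aa0; set b := (dfact a.-2)%:R; set c := (dfact (k + i).-1)%:R.
move: b c => b c *.
by field; apply/andP; split.
Qed.

(** Only the dependence on s contributes, since grad q is orthogonal to y. *)
Lemma dd_y_kpoly h i n x : dd y (kpoly y h i n) x =
  sqnorm y * i%:R * shift_series (kpoly y h i.-1) n x.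
Proof.
case: n => [|n]; first by rewrite (homf0_dd _ (homf_kpoly y h i 0)) mulr0.
rewrite (dd_part y x (polyfun_kpoly y h i n.+1)).
rewrite (eq_bigr (fun j => y 0 j * y 0 j * (i%:R * kpoly y h i.-1 n x)
  - ((sqnorm y * shift_series (kpoly y h.+1 i) n x) * (x 0 j * y 0 j)
     - (dotR x y * shift_series (kpoly y h.+1 i) n x) * (y 0 j * y 0 j)))); last first.
  by move=> j _; rewrite part_kpoly; ring.
rewrite sumrB sumrB -!mulr_sumr -mulr_suml.
rewrite -[\sum_(_ < _) y 0 _ * y 0 _]/(sqnorm y) -[\sum_(_ < _) x 0 _ * y 0 _]/(dotR x y) /=.
by ring.
Qed.

Lemma prod_dfact h k n : (k <= n)%N ->
  (dfact (n + h).*2.-1)%:R = (dfact (k + h).*2.-1)%:R *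
  \prod_(k <= j < n) (2 * h%:R + 1 + 2 * j%:R) :> R.
Proof.
move=> /subnK <-; elim: (n - k)%N => [|d ih].
  by rewrite add0n big_geq// mulr1.
rewrite addSn (big_nat_recr (d + k)) ?leq_addl// mulrA -ih.
rewrite addSn doubleS -pred_Sn dfactE// (natrM R) mulrC; congr (_ * _).
by rewrite -natr1 -mul2n natrM natrD; ring.
Qed.

Lemma fact_double k : (k.*2)`! = (2 ^ k * k`! * dfact k.*2.-1)%N.
Proof.
elim: k => [//|k ih]; rewrite doubleS !factS ih expnS -pred_Sn.
rewrite (@dfactE k.*2.+1)// -pred_Sn; lia.
Qed.

(** The case i = 0. As m - 1 = 2h + 1, the product in [qcoef] cancels the double factorial of
    [bessel_coef] down to (k+2h-1)!!; here the Bessel order matches the dimension. *)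
Lemma kernel_eig_base h k n : m = h.*2.+2 ->
  (if odd n then 0 else bessel_coef R h n./2 *
    (if odd k then 0 else qcoef R m n./2 k./2 * sqnorm y ^+ (n./2 - k./2))) =
  kernel_eig 0 k * gcoef (sqnorm y) k n.
Proof.
move=> mh; have [on|on] := boolP (odd n).
  rewrite /kernel_eig add0n; case: ifP => ok; first by rewrite mul0r.
  have [nk|kn] := ltnP n k; first by rewrite gcoef_lt ?mulr0.
  by rewrite /gcoef kn oddB// on ok /= mulr0.
rewrite /kernel_eig add0n addn0 subn0; have [ok|ok] := boolP (odd k); first by rewrite mulr0 mul0r.
have [nk|kn] := ltnP n./2 k./2.
  rewrite /qcoef bin_small// mulr0 !mul0r mulr0 gcoef_lt ?mulr0//.
  by rewrite -(even_halfK on) -(even_halfK ok) ltn_double.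
have en := even_halfK on; have ek := even_halfK ok.
move: kn en ek; move: n./2 k./2 => n' k' kn en ek; rewrite -{}en -{}ek {n k on ok}.
have -> : (n'.*2 = k'.*2 + (n' - k').*2)%N by lia.
rewrite gcoef_double.
rewrite /bessel_coef /qcoef.
have -> : \prod_(k' <= j < n') (m%:R - 1 + 2 * j%:R) = \prod_(k' <= j < n') (2 * h%:R + 1 + 2 * j%:R) :> R.
  by apply: eq_bigr => j _; rewrite mh -!natr1 -mul2n natrM; ring.
have e1 : (k'.*2 + (m - 2)).-1 = (k' + h).*2.-1 by rewrite mh; lia.
rewrite e1 (prod_dfact h kn) fact_double.
have := bin_fact kn; rewrite -{2}(subnK kn) => eb.
have -> : (n'`!)%:R = ('C(n', k'))%:R * (k'`!)%:R * ((n' - k')`!)%:R :> R.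
  by rewrite -!natrM -(bin_fact kn) mulnA.
have -> : 2 ^+ n' = 2 ^+ k' * 2 ^+ (n' - k') :> R by rewrite -exprD subnKC.
have -> : (-1) ^+ n' = (-1) ^+ k' * (-1) ^+ (n' - k') :> R by rewrite -exprD subnKC.
rewrite (exprNn (sqnorm y)) !natrM natrX.
have s2 : (-1) ^+ k' * (-1) ^+ k' = 1 :> R by rewrite -exprMn mulrNN mulr1 expr1n.
have c0 : ('C(n', k'))%:R != 0 :> R by rewrite pnatr_eq0 -lt0n bin_gt0.
have k0 : (k'`!)%:R != 0 :> R by rewrite pnatr_eq0 -lt0n fact_gt0.
have n0 : ((n' - k')`!)%:R != 0 :> R by rewrite pnatr_eq0 -lt0n fact_gt0.
have t0 : 2 ^+ k' != 0 :> R by rewrite expf_neq0// pnatr_eq0.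
have t1 : 2 ^+ (n' - k') != 0 :> R by rewrite expf_neq0// pnatr_eq0.
have d0 : (dfact (k' + h).*2.-1)%:R != 0 :> R by rewrite pnatr_eq0 -lt0n dfact_gt0.
have p0 : \prod_(k' <= j < n') (2 * h%:R + 1 + 2 * j%:R) != 0 :> R.
  by rewrite prodf_seq_neq0; apply/allP => j _ /=; rewrite gt_eqF// -addrA ltr_wpDl//
    ?mulr_ge0// ltr_wpDr// mulr_ge0.
move: s2 c0 k0 n0 t0 t1 d0 p0.
set x1 := ('C(n', k'))%:R; set x2 := (k'`!)%:R; set x3 := ((n' - k')`!)%:R.
set x4 := 2 ^+ k'; set x5 := 2 ^+ (n' - k'); set x6 := (dfact (k' + h).*2.-1)%:R.
set x7 := \prod_(_ <= _ < _) _; set x8 := (-1) ^+ k'; set x9 := (-1) ^+ (n' - k').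
set x10 := (dfact _)%:R; set x11 := sqnorm y ^+ _.
move=> s2 c0 k0 n0 t0 t1 d0 p0.
transitivity ((x8 * x8) * (x10 / x6 * (x9 * x11 / (x5 * x3)))); last by rewrite s2 mul1r.
clear - c0 k0 n0 t0 t1 d0 p0.
move: x1 x2 x3 x4 x5 x6 x7 x8 x9 x10 x11 c0 k0 n0 t0 t1 d0 p0 => *.
by field; do ?[apply/andP; split].
Qed.

(** Integrate the factor s by parts along y. On H the derivative gives a harmonic function of degree
    k - 1 with value k H(y) at y. On the kernel it lowers i, and [gcoef_rec] converts its |y|^2 into
    k - n. Added to i (2h - i + n), this makes n cancel and leaves i (m - 2 - i + k), the
    coefficient in [kernel_eig_rec]. *)
Lemma gE_kpoly h i k n H : m = h.*2.+2 -> (i <= m - 2)%N -> homf k H -> harmonicf H ->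
  gE (fun x => kpoly y h i n x * H x) = kernel_eig i k * gcoef (sqnorm y) k n * H y.
Proof.
move=> mh; elim/kpoly_ind: i k n H => [|i h1 h2] k n H im hH harmH.
  rewrite -(kernel_eig_base k n mh).
  case: ifP => on.
    have -> : (fun x => kpoly y h 0 n x * H x) = fun _ => 0.
      by apply/funext => x; rewrite /= on mul0r.
    by rewrite gE0 mul0r.
  have -> : (fun x => kpoly y h 0 n x * H x) = fun x => bessel_coef R h n./2 * (qf x ^+ n./2 * H x).
    by apply/funext => x; rewrite /= on mulrA.
  rewrite gE_scale; last exact: polyfun_mul (polyfun_exp _ (polyfun_qf y)) (homf_polyfun hH).
  by rewrite (gE_qfX_harmonicf y _ hH harmH) mulrA.
have pH := homf_polyfun hH; have pk a b := polyfun_kpoly y h a b.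
have im1 : (i <= m - 2)%N by lia.
have im2 : (i.-1 <= m - 2)%N by lia.
have mR : m%:R = 2 * h%:R + 2 :> R by rewrite mh -!natr1 -mul2n natrM; ring.
rewrite (kernel_eig_rec _ im).
case: n => [|n].
  have -> : (fun x => kpoly y h i.+1 0 x * H x) =
     fun x => (i%:R * (2 * h%:R - i%:R)) * (kpoly y h i.-1 0 x * H x).
    by apply/funext => x; rewrite kpoly0; ring.
  rewrite gE_scale; last exact: polyfun_mul.
  rewrite (h2 _ _ _ im2 hH harmH).
  case: k {hH} => [|k]; first by rewrite mR; ring.
  by rewrite gcoef_lt// !mulr0 !mul0r mulr0.
have pkH a b := polyfun_mul (pk a b) pH.
have -> : (fun x => kpoly y h i.+1 n.+1 x * H x) =
   fun x => dotR x y * (kpoly y h i n x * H x) +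
   (i%:R * (2 * h%:R - i%:R + n.+1%:R)) * (kpoly y h i.-1 n.+1 x * H x).
  by apply/funext => x; rewrite kpolyS; ring.
rewrite (gE_add (polyfun_mul (polyfun_dot y) (pkH i n)) (polyfun_scale _ (pkH i.-1 n.+1))).
rewrite (gE_scale _ (pkH i.-1 n.+1)) (h2 _ _ _ im2 hH harmH) (gE_dot y (pkH i n)).
rewrite (dd_mul y (pk i n) pH).
have pd := polyfun_dd y pH; have pkd := polyfun_dd y (pk i n).
rewrite (gE_add (polyfun_mul pkd pH) (polyfun_mul (pk i n) pd)).
have E1 : gE (fun x => dd y (kpoly y h i n) x * H x) =
  i%:R * ((k%:R - n.+1%:R) * (kernel_eig i.-1 k * gcoef (sqnorm y) k n.+1 * H y)).
  have -> : (fun x => dd y (kpoly y h i n) x * H x) =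
    fun x => (sqnorm y * i%:R) * (shift_series (kpoly y h i.-1) n x * H x).
    by apply/funext => x; rewrite dd_y_kpoly mulrA.
  have ps : polyfun (fun x => shift_series (kpoly y h i.-1) n x * H x).
    by apply: polyfun_mul => //; case: (n) => [|n'] /=; [exact: polyfun_cst|exact: pk].
  rewrite gE_scale//.
  have := gcoef_rec (sqnorm y) k n.+1; rewrite /=.
  case: n ps {h1 pkd} => [|n] ps /= e.
    have -> : (fun x => 0 * H x) = fun _ => 0 by apply/funext => x; rewrite mul0r.
    rewrite gE0 mulr0.
    transitivity (i%:R * ((k%:R - 1%:R) * gcoef (sqnorm y) k 1) * kernel_eig i.-1 k * H y); last by ring.
    by rewrite -e; ring.
  rewrite (h2 _ _ _ im2 hH harmH).
  transitivity (i%:R * ((k%:R - n.+2%:R) * gcoef (sqnorm y) k n.+2) * kernel_eig i.-1 k * H y); last by ring.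
  by rewrite -e; ring.
have E2 : gE (fun x => kpoly y h i n x * dd y H x) =
  k%:R * kernel_eig i k.-1 * gcoef (sqnorm y) k n.+1 * H y.
  case: k hH {E1} => [|k] hH.
    have -> : (fun x => kpoly y h i n x * dd y H x) = fun _ => 0.
      by apply/funext => x; rewrite (homf0_dd y hH) mulr0.
    by rewrite gE0 !mul0r.
  rewrite (h1 _ _ _ im1 (homfS_dd y hH) (harmonicf_dd y pH harmH)) (euler y hH) gcoefSS /=; ring.
rewrite E1 E2 mR; ring.
Qed.

Lemma kpoly_at_y0 h i n x : y = 0 -> kpoly y h i n.+1 x = 0.
Proof.
move=> y0; have d0 : dotR x y = 0 by rewrite y0 /dotR big1// => j _; rewrite mxE mulr0.
have s0 : sqnorm y = 0 by rewrite y0 /sqnorm /dotR big1// => j _; rewrite mxE mulr0.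
have q0 : qf x = 0 by rewrite /qform d0 s0; ring.
elim/kpoly_ind: i n => [|i h1 h2] n.
  by rewrite /=; case: ifP => // /negbFE on; rewrite q0; case: n on => // n _; rewrite expr0n /= mulr0.
by rewrite kpolyS d0 mul0r h2 mulr0 addr0.
Qed.

End FunkHecke.

(** * Clifford multiplication in coordinates *)

Section Clifford.
Variables (R : realType) (m : nat).
Notation Cl := (Cl R m).
Notation V := 'rV[R]_m.

Definition symd (A B : {set 'I_m}) : {set 'I_m} := (A :\: B) :|: (B :\: A).

Lemma in_symd A B i : (i \in symd A B) = (i \in A) (+) (i \in B).
Proof. by rewrite !inE; case: (i \in A); case: (i \in B). Qed.

Lemma symdC A B : symd A B = symd B A.
Proof. by apply/setP => i; rewrite !in_symd addbC. Qed.

Lemma symdA A B C : symd A (symd B C) = symd (symd A B) C.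
Proof. by apply/setP => i; rewrite !in_symd addbA. Qed.

Lemma symdK A B : symd A (symd A B) = B.
Proof. by apply/setP => i; rewrite !in_symd addbA addbb. Qed.

Lemma symd0 A : symd A finset.set0 = A.
Proof. by apply/setP => i; rewrite in_symd finset.in_set0 addbF. Qed.

Lemma symd_eq A B C : (symd A B == C) = (B == symd A C).
Proof. by apply/eqP/eqP => [<-|->]; rewrite symdK. Qed.

(** One sign for moving e_a past an earlier e_b, one for e_a e_a = -1. As a product over pairs the
    sign is multiplicative in each argument. *)
Definition pairw (a b : 'I_m) : nat := ((b < a) + (a == b))%N.

Lemma cl_sgnE A B : cl_sgn R A B = \prod_(a in A) \prod_(b in B) (-1) ^+ pairw a b.
Proof.
under eq_bigr do rewrite prodrXr; rewrite prodrXr /cl_sgn; congr (_ ^+ _).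
under eq_bigr do rewrite big_split; rewrite big_split /=; congr (_ + _)%N.
  rewrite -sum1_card pair_big_dep /= big_mkcond [in RHS]big_mkcond /=.
  apply: eq_bigr => -[a b] _; rewrite !inE /=.
  by case: (a \in A); case: (b \in B); case: (b < a)%N.
rewrite -sum1_card big_mkcond [in RHS]big_mkcond /=; apply: eq_bigr => a _.
rewrite finset.in_setI; case: (a \in A) => //=.
rewrite big_mkcond (bigD1 a)//= eqxx big1 ?addn0; first by case: (a \in B).
by move=> b ba; rewrite eq_sym (negPf ba); case: ifP.
Qed.

Lemma prod_symd (f : 'I_m -> R) A B : (forall a, f a * f a = 1) ->
  \prod_(a in symd A B) f a = (\prod_(a in A) f a) * \prod_(a in B) f a.
Proof.
move=> ff; rewrite !(big_mkcond (fun a => a \in _)) -big_split; apply: eq_bigr => a _ /=.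
by rewrite in_symd; case: (a \in A); case: (a \in B); rewrite ?mul1r ?mulr1// ff.
Qed.

(* [cl_sgn] is a bicharacter for symmetric difference, whence the associativity of the product. *)
Lemma cl_sgn_symdl A B C : cl_sgn R (symd A B) C = cl_sgn R A C * cl_sgn R B C.
Proof.
rewrite !cl_sgnE prod_symd// => a; rewrite -big_split big1// => b _ /=.
by rewrite -exprMn mulrNN mulr1 expr1n.
Qed.

Lemma cl_sgn_symdr A B C : cl_sgn R A (symd B C) = cl_sgn R A B * cl_sgn R A C.
Proof.
rewrite !cl_sgnE -big_split; apply: eq_bigr => a _ /=; rewrite prod_symd// => b.
by rewrite -exprMn mulrNN mulr1 expr1n.
Qed.

Lemma cl_mulE (u v : Cl) C :
  cl_mul u v C = \sum_A u A * v (symd A C) * cl_sgn R A (symd A C).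
Proof.
rewrite ffunE; apply: eq_bigr => A _; rewrite -big_mkcond (big_pred1 (symd A C))//.
by move=> B; rewrite -/(symd A B) symd_eq.
Qed.

Lemma reindex_symd (S : {set 'I_m}) (F : {set 'I_m} -> R) :
  \sum_B F B = \sum_C F (symd S C).
Proof. by rewrite (reindex_inj (can_inj (symdK S))). Qed.

Lemma cl_mulA (u v w : Cl) : cl_mul (cl_mul u v) w = cl_mul u (cl_mul v w).
Proof.
apply/ffunP => D; rewrite !cl_mulE.
under eq_bigr do rewrite cl_mulE !mulr_suml; rewrite exchange_big; apply: eq_bigr => A _ /=.
rewrite cl_mulE mulr_sumr mulr_suml [RHS](reindex_symd A); apply: eq_bigr => C _ /=.
have e : symd (symd A C) (symd A D) = symd C D.
  by rewrite -symdA [symd C _]symdA [symd C A]symdC -symdA symdK.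
rewrite e.
have -> : symd A D = symd (symd A C) (symd C D).
  by rewrite -symdA symdK.
rewrite (cl_sgn_symdr A (symd A C) (symd C D)) (cl_sgn_symdl A C (symd C D)).
have s1 : cl_sgn R A (symd C D) * cl_sgn R A (symd C D) = 1.
  rewrite cl_sgnE -big_split big1// => a _ /=; rewrite -big_split big1// => b _ /=.
  by rewrite -exprMn mulrNN mulr1 expr1n.
set x := cl_sgn R A (symd C D) in s1 *; rewrite -[LHS]mulr1 -[X in _ * X = _]s1; ring.
Qed.

Lemma cl_mul_suml (I : Type) (r : seq I) (P : pred I) (c : I -> R) (w : I -> Cl) (u v : Cl) C :
  (forall A, u A = \sum_(i <- r | P i) c i * w i A) ->
  cl_mul u v C = \sum_(i <- r | P i) c i * cl_mul (w i) v C.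
Proof.
move=> hu; rewrite cl_mulE.
under eq_bigr do rewrite hu !mulr_suml; rewrite exchange_big; apply: eq_bigr => i _ /=.
by rewrite cl_mulE mulr_sumr; apply: eq_bigr => A _; rewrite !mulrA.
Qed.

Lemma cl_mul_sumr (I : Type) (r : seq I) (P : pred I) (c : I -> R) (w : I -> Cl) (u v : Cl) C :
  (forall A, v A = \sum_(i <- r | P i) c i * w i A) ->
  cl_mul u v C = \sum_(i <- r | P i) c i * cl_mul u (w i) C.
Proof.
move=> hu; rewrite cl_mulE.
under eq_bigr do rewrite hu mulr_sumr mulr_suml; rewrite exchange_big; apply: eq_bigr => i _ /=.
by rewrite cl_mulE mulr_sumr; apply: eq_bigr => A _; ring.
Qed.

(* Up to the sign [esgn j C], left multiplication by e_j permutes the blades. *)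
Definition esgn (j : 'I_m) (C : {set 'I_m}) : R := cl_sgn R [set j] (symd [set j] C).

Lemma cl_mul_e j (v : Cl) C : cl_mul (cl_e R j) v C = esgn j C * v (symd [set j] C).
Proof.
rewrite cl_mulE (bigD1 [set j]%SET)//= big1 ?addr0; last first.
  by move=> A Aj; rewrite !ffunE (negPf Aj) !mul0r.
by rewrite !ffunE eqxx mul1r mulrC.
Qed.

Lemma cl_sgn11 j k : cl_sgn R [set j] [set k] = (-1) ^+ pairw j k.
Proof. by rewrite cl_sgnE !big_set1. Qed.

Lemma cl_e_anticomm j k (v : Cl) C :
  cl_mul (cl_e R j) (cl_mul (cl_e R k) v) C + cl_mul (cl_e R k) (cl_mul (cl_e R j) v) C =
  - 2 * (j == k)%:R * v C.
Proof.
rewrite !cl_mul_e /esgn.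
have e a b : symd [set a] (symd [set b] C) = symd [set b] (symd [set a] C).
  by rewrite !symdA (symdC [set a]).
rewrite (e k j) !cl_sgn_symdr !cl_sgn11.
have sq n : (-1) ^+ n * (-1) ^+ n = 1 :> R by rewrite -exprMn mulrNN mulr1 expr1n.
have [<-|jk] := eqVneq j k.
  rewrite symdK /pairw ltnn eqxx /= mulr1.
  have : cl_sgn R [set j] C * cl_sgn R [set j] C = 1.
    rewrite cl_sgnE -big_split big1// => a _ /=; rewrite -big_split big1// => b _ /=.
    exact: sq.
  set x := cl_sgn R [set j] C; move=> xx; rewrite add0n expr1.
  transitivity (-2 * v C * (x * x)); first by ring.
  by rewrite xx mulr1.
rewrite mulr0 mul0r /pairw [k == j]eq_sym (negPf jk) !addn0.
have : (k < j)%N = ~~ (j < k)%N.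
  by move: jk; case: (ltngtP j k) => // /val_inj ->; rewrite eqxx.
move=> ->.
case: (j < k)%N => /=; rewrite expr0 expr1; ring.
Qed.

Lemma cl_vec_mul (x : V) (v : Cl) C : cl_mul (cl_vec x) v C = \sum_j x 0 j * cl_mul (cl_e R j) v C.
Proof. by apply: cl_mul_suml => A; rewrite ffunE. Qed.

Lemma cl_vec_mul2 (x z : V) (v : Cl) C : cl_mul (cl_vec x) (cl_mul (cl_vec z) v) C =
  \sum_j \sum_k x 0 j * z 0 k * cl_mul (cl_e R j) (cl_mul (cl_e R k) v) C.
Proof.
rewrite cl_vec_mul; apply: eq_bigr => j _.
rewrite (@cl_mul_sumr _ (index_enum _) xpredT (fun k => z 0 k) (fun k => cl_mul (cl_e R k) v)).
  by rewrite mulr_sumr; apply: eq_bigr => k _; rewrite mulrA.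
by move=> A; exact: cl_vec_mul.
Qed.

Lemma cl_vec_anticomm (x z : V) (v : Cl) C :
  cl_mul (cl_vec x) (cl_mul (cl_vec z) v) C + cl_mul (cl_vec z) (cl_mul (cl_vec x) v) C =
  - 2 * dotR x z * v C.
Proof.
rewrite !cl_vec_mul2 [X in _ + X]exchange_big -big_split /=.
transitivity (\sum_j (- 2 * (x 0 j * z 0 j) * v C)); last first.
  by rewrite -mulr_suml -mulr_sumr.
apply: eq_bigr => j _; rewrite -big_split /=.
under eq_bigr => k _ do rewrite (mulrC (z 0 k)) -mulrDr cl_e_anticomm.
rewrite (bigD1 j)//= eqxx big1 ?addr0; first by rewrite mulr1; ring.
by move=> k kj; rewrite eq_sym (negPf kj) mulr0 mul0r mulr0.
Qed.

Lemma cl_vec_sqr (x : V) (v : Cl) C : cl_mul (cl_vec x) (cl_mul (cl_vec x) v) C = - sqnorm x * v C.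
Proof.
have := cl_vec_anticomm x x v C; rewrite /sqnorm.
move: (cl_mul _ _ C) (dotR x x) (v C) => a b c h; lra.
Qed.

(** From x z = x ^ z - <x,z> and x z + z x = - 2 <x,z>. Having z on the left prepares for another
    multiplication by z, where z z = - |z|^2. *)
Lemma cl_wedge_mul (x z : V) (v : Cl) C : cl_mul (cl_wedge x z) v C =
  - cl_mul (cl_vec z) (cl_mul (cl_vec x) v) C - dotR x z * v C.
Proof.
suff -> : cl_mul (cl_wedge x z) v C = cl_mul (cl_vec x) (cl_mul (cl_vec z) v) C + dotR x z * v C.
  have := cl_vec_anticomm x z v C.
  move: (cl_mul _ _ C) (cl_mul _ _ C) (dotR x z) (v C) => a b c d h; lra.
pose L j k : R := cl_mul (cl_e R j) (cl_mul (cl_e R k) v) C.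
have -> : cl_mul (cl_wedge x z) v C =
   \sum_(j < m) \sum_(k < m | (j < k)%N) (x 0 j * z 0 k - x 0 k * z 0 j) * L j k.
  rewrite pair_big_dep /=.
  rewrite (@cl_mul_suml _ (index_enum _) (fun q : 'I_m * 'I_m => (q.1 < q.2)%N)
    (fun q => x 0 q.1 * z 0 q.2 - x 0 q.2 * z 0 q.1) (fun q => cl_mul (cl_e R q.1) (cl_e R q.2))).
    by apply: eq_bigr => q _; rewrite cl_mulA.
  by move=> A; rewrite ffunE pair_big_dep /=; apply: eq_bigr => q _; rewrite mulrC.
rewrite cl_vec_mul2.
have Ljj j : L j j = - v C.
  have := cl_e_anticomm j j v C; rewrite eqxx mulr1 -/(L j j).
  by move: (L j j) (v C) => a b h; lra.
have Ljk j k : j != k -> L k j = - L j k.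
  move=> jk; have := cl_e_anticomm j k v C.
  by rewrite (negPf jk) mulr0 mul0r -/(L j k) -/(L k j); move: (L j k) (L k j) => a b h; lra.
have -> : \sum_j \sum_k x 0 j * z 0 k * cl_mul (cl_e R j) (cl_mul (cl_e R k) v) C =
  \sum_(j < m) (\sum_(k < m | (j < k)%N) x 0 j * z 0 k * L j k +
          (\sum_(k < m | (k < j)%N) x 0 j * z 0 k * L j k + x 0 j * z 0 j * - v C)).
  apply: eq_bigr => j _; rewrite (bigID (fun k : 'I_m => (j < k)%N)) /=; congr (_ + _).
  rewrite (bigD1 j) ?ltnn//= addrC -/(L j j) Ljj; congr (_ + _).
  by apply: eq_bigl => k; rewrite -leqNgt ltn_neqAle andbC.
rewrite big_split big_split /=.
have -> : \sum_(j < m) x 0 j * z 0 j * - v C = - (dotR x z * v C).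
  by rewrite -mulr_suml mulrN.
rewrite -!addrA addNr addr0.
have -> : \sum_(j < m) \sum_(k < m | (k < j)%N) x 0 j * z 0 k * L j k =
  \sum_(j < m) \sum_(k < m | (j < k)%N) x 0 k * z 0 j * L k j.
  by rewrite (exchange_big_dep xpredT).
rewrite -big_split /=; apply: eq_bigr => j _; rewrite -big_split /=; apply: eq_bigr => k jk.
by rewrite (Ljk j k) ?neq_ltn ?jk//; ring.
Qed.

End Clifford.

(** * Binomial identities for Laguerre coefficients *)

Section Laguerre.
Variables (R : realType) (a : nat).

(** [Q] and [P] are the two sums to be compared. [U] and [T] are their companions with lower index p
    - j - 1, produced by Pascal's rule in N; Pascal's rule in p gives their own recursions. *)
Let Q (N p : nat) : R := \sum_(j < p.+1) (-2) ^+ j * 'C(p + a, p - j)%:R * 'C(N + a + j, j)%:R.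
Let P (N p : nat) : R := \sum_(j < p.+1) 2 ^+ j * 'C(p + a, p - j)%:R * 'C(N, j)%:R.
Let U (N p : nat) : R := \sum_(j < p) (-2) ^+ j * 'C(p + a, p - j.+1)%:R * 'C(N + a + j, j)%:R.
Let T (N p : nat) : R := \sum_(j < p) 2 ^+ j * 'C(p + a, p - j.+1)%:R * 'C(N, j)%:R.

Let PascalT (c : nat -> R) p :
  \sum_(j < p.+1) c j * 'C(p.+1 + a, p.+1 - j.+1)%:R =
  \sum_(j < p) c j * 'C(p + a, p - j.+1)%:R + \sum_(j < p.+1) c j * 'C(p + a, p - j)%:R.
Proof.
rewrite [LHS]big_ord_recr [in RHS]big_ord_recr /= subSS subnn !bin0 addrA; congr (_ + _).
rewrite -big_split /=; apply: eq_bigr => j _.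
by rewrite subSS addSn -(subnSK (ltn_ord j)) binS natrD mulrDr addrC.
Qed.

Let T_rec N p : T N p.+1 = T N p + P N p.
Proof.
rewrite /T /P.
transitivity (\sum_(j < p.+1) (2 ^+ j * 'C(N, j)%:R) * 'C(p.+1 + a, p.+1 - j.+1)%:R : R).
  by apply: eq_bigr => j _; ring.
rewrite (PascalT (fun j => 2 ^+ j * 'C(N, j)%:R)).
by congr (_ + _); apply: eq_bigr => j _; ring.
Qed.

Let U_rec N p : U N p.+1 = U N p + Q N p.
Proof.
rewrite /U /Q; transitivity (\sum_(j < p.+1) ((-2) ^+ j * 'C(N + a + j, j)%:R) * 'C(p.+1 + a, p.+1 - j.+1)%:R : R).
  by apply: eq_bigr => j _; ring.
rewrite (PascalT (fun j => (-2) ^+ j * 'C(N + a + j, j)%:R)).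
by congr (_ + _); apply: eq_bigr => j _; ring.
Qed.

Let P_rec N p : P N.+1 p = P N p + 2 * T N p.
Proof.
rewrite /P /T big_ord_recl [in RHS]big_ord_recl !bin0 -addrA; congr (_ + _).
rewrite mulr_sumr -big_split; apply: eq_bigr => j _ /=.
by rewrite /bump /= add1n binS natrD exprS; ring.
Qed.

Let Q_rec N p : Q N.+1 p = Q N p - 2 * U N.+1 p.
Proof.
rewrite /Q /U big_ord_recl [in RHS]big_ord_recl !bin0 -addrA; congr (_ + _).
rewrite mulr_sumr -sumrB; apply: eq_bigr => j _ /=.
rewrite /bump /= add1n exprS.
have -> : (N.+1 + a + j.+1 = (N.+1 + a + j).+1)%N by lia.
have -> : (N + a + j.+1 = N.+1 + a + j)%N by lia.
by rewrite binS natrD; ring.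
Qed.

Lemma bin_natr n k : (k <= n)%N -> 'C(n, k)%:R = (n`!)%:R / ((k`!)%:R * ((n - k)`!)%:R) :> R.
Proof.
move=> kn; rewrite -(bin_fact kn) !natrM.
have k0 : (k`!)%:R != 0 :> R by rewrite pnatr_eq0 -lt0n fact_gt0.
have n0 : ((n - k)`!)%:R != 0 :> R by rewrite pnatr_eq0 -lt0n fact_gt0.
by rewrite mulfK// mulf_neq0.
Qed.

(** C(p+a,p-j) C(a+j,j) = C(p,j) C(p+a,p), so the sum is C(p+a,p) times the binomial expansion of (1
    - 2)^p. *)
Let Q0 p : Q 0 p = (-1) ^+ p * P 0 p.
Proof.
have -> : P 0 p = 'C(p + a, p)%:R.
  rewrite /P big_ord_recl subn0 bin0 big1 ?addr0; first by rewrite expr0; ring.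
  by move=> j _; rewrite lift0 bin0n mulr0.
have -> : (-1) ^+ p = (1 + -2) ^+ p :> R by congr (_ ^+ p); ring.
rewrite exprDn mulr_suml; apply: eq_bigr => j _.
transitivity ((-2) ^+ j * ('C(p, j)%:R * 'C(p + a, p)%:R) : R); last first.
  by rewrite expr1n mul1r mulrA; congr (_ * _); rewrite -[RHS]mulr_natr.
rewrite add0n -mulrA; congr (_ * _).
have jp : (j <= p)%N by rewrite -ltnS.
rewrite (@bin_natr (p + a) (p - j)); last lia.
rewrite (@bin_natr (a + j)); last lia.
rewrite (bin_natr jp) (@bin_natr (p + a) p); last lia.
have -> : (p + a - (p - j) = a + j)%N by lia.
have -> : (a + j - j = a)%N by lia.
have -> : (p + a - p = a)%N by lia.
have f0 n : (n`!)%:R != 0 :> R by rewrite pnatr_eq0 -lt0n fact_gt0.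
have [h1 h2 h3] := And3 (f0 (p - j)%N) (f0 (a + j)%N) (f0 p).
have [h4 h5] := conj (f0 j) (f0 a).
move: h1 h2 h3 h4 h5.
move: ((p - j)`!)%:R ((a + j)`!)%:R (p`!)%:R (j`!)%:R (a`!)%:R ((p + a)`!)%:R => *.
by field; do ?[apply/andP; split].
Qed.

(** Induction on N for all p at once. The step needs the companion relation U(N+1,r) = - (-1)^r
    T(N,r), itself an induction on r using the hypothesis for every r. *)
Let P0Q0 N : (forall p, Q N p = (-1) ^+ p * P N p).
Proof.
elim: N => [|N ih] p; first exact: Q0.
have UT r : U N.+1 r = - ((-1) ^+ r * T N r).
  elim: r => [|r ihr]; first by rewrite /U /T !big_ord0 mulr0 oppr0.
  by rewrite U_rec T_rec Q_rec ih ihr exprS; ring.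
by rewrite Q_rec P_rec ih UT; ring.
Qed.

Lemma laguerre_bin_reflection N p :
  \sum_(j < p.+1) (-2) ^+ j * 'C(p + a, p - j)%:R * 'C(N + a + j, j)%:R =
  (-1) ^+ p * \sum_(j < p.+1) 2 ^+ j * 'C(p + a, p - j)%:R * 'C(N, j)%:R :> R.
Proof. exact: P0Q0. Qed.

Lemma prod_rising N j :
  \prod_(r < j) (2 * (a + N)%:R + 2 + 2 * r%:R) = 2 ^+ j * (j`!)%:R * 'C(N + a + j, j)%:R :> R.
Proof.
rewrite bin_natr ?leq_addl// addnK.
have f0 n : (n`!)%:R != 0 :> R by rewrite pnatr_eq0 -lt0n fact_gt0.
transitivity (2 ^+ j * (((N + a + j)`!)%:R / ((N + a)`!)%:R) : R); last first.
  move: (f0 j) (f0 (N + a)%N); move: (j`!)%:R ((N + a)`!)%:R ((N + a + j)`!)%:R (2 ^+ j) => *.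
  by field; apply/andP; split.
elim: j => [|j ih]; first by rewrite big_ord0 addn0 divff// mulr1.
rewrite big_ord_recr /= ih addnS factS (natrM R (N + a + j).+1) exprS -natr1 !natrD.
move: (f0 (N + a)%N); move: ((N + a)`!)%:R ((N + a + j)`!)%:R (2 ^+ j) => *.
by field.
Qed.

(** Each X^N/N! C(N,j) equals X^j/j! times X^(N-j)/(N-j)!, so from N = j on this is an exponential
    series. *)
Lemma cvg_exp_bin (X : R) j :
  (fun M => \sum_(N < M) X ^+ N / (N`!)%:R * 'C(N, j)%:R) @ \oo --> X ^+ j / (j`!)%:R * expR X.
Proof.
rewrite -(cvg_shiftn j).
have -> : (fun M => \sum_(N < M + j) X ^+ N / (N`!)%:R * 'C(N, j)%:R) =
   (fun M => X ^+ j / (j`!)%:R * series (exp_coeff X) M).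
  apply/funext => M; rewrite addnC big_split_ord /= big1 ?add0r; last first.
    by move=> i _; rewrite bin_small ?mulr0.
  rewrite /series /= big_mkord mulr_sumr; apply: eq_bigr => N _.
  rewrite bin_natr ?leq_addr// addKn exprD /exp_coeff /=.
  have f0 n : (n`!)%:R != 0 :> R by rewrite pnatr_eq0 -lt0n fact_gt0.
  move: (f0 j) (f0 N) (f0 (j + N)%N).
  move: (j`!)%:R (N`!)%:R ((j + N)`!)%:R (X ^+ j) (X ^+ N) => *.
  by field; do ?[apply/andP; split].
apply: cvgMr; exact: is_cvg_series_exp_coeff.
Qed.

End Laguerre.

(** * Series supported on one parity class *)

Section SparseSeries.
Variable R : realType.

(** Exactly [uphalf (M - k)] of the indices k, k+2, k+4, ... lie below M. *)
Lemma sum_sparse (f : nat -> R) k M :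
  (forall n, (n < k)%N || odd (n - k) -> f n = 0) ->
  \sum_(n < M) f n = \sum_(N < uphalf (M - k)) f (k + N.*2)%N.
Proof.
move=> hf; elim: M => [|M ih]; first by rewrite sub0n !big_ord0.
rewrite big_ord_recr /= ih; have [Mk|kM] := ltnP M k.
  have -> : (M.+1 - k)%N = 0%N by lia.
  have -> : (M - k)%N = 0%N by lia.
  by rewrite hf ?Mk// addr0.
rewrite subSn// uphalfE /=; have [od|ev] := boolP (odd (M - k)).
  by rewrite hf ?od ?orbT// addr0 uphalf_half od.
rewrite uphalf_half (negPf ev) add0n big_ord_recr /=; congr (_ + f _).
by rewrite even_halfK// subnKC.
Qed.

Lemma cvg_uphalf_subn k : (fun M => uphalf (M - k)) @ \oo --> \oo.
Proof.
apply/cvgnyPge => A; near=> M.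
suff : (A.*2 + k <= M)%N by lia.
by near: M; exact: nbhs_infty_ge.
Unshelve. all: by end_near. Qed.

Lemma cvg_sum_sparse (f : nat -> R) k (l : R) :
  (forall n, (n < k)%N || odd (n - k) -> f n = 0) ->
  (fun M => \sum_(N < M) f (k + N.*2)%N) @ \oo --> l ->
  (fun M => \sum_(n < M) f n) @ \oo --> l.
Proof.
move=> hf h; under eq_fun do rewrite (sum_sparse _ hf).
exact: (cvg_comp (fun M => uphalf (M - k)) _ (cvg_uphalf_subn k) h).
Qed.

Lemma sum_exp_le (x : R) M : 0 <= x -> \sum_(n < M) x ^+ n / (n`!)%:R <= expR x.
Proof.
move=> x0; rewrite /expR.
have -> : \sum_(n < M) x ^+ n / (n`!)%:R = series (exp_coeff x) M.
  by rewrite /series /= big_mkord; apply: eq_bigr => n _.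
apply: nondecreasing_cvgn_le; last exact: is_cvg_series_exp_coeff.
apply/nondecreasing_seqP => n; rewrite /series /= big_nat_recr//= lerDl.
exact: exp_coeff_ge0.
Qed.

End SparseSeries.

(** * Convergence and growth of the Bessel expansions *)

Section BesselSeries.
Variables (R : realType) (m : nat) (y : 'rV[R]_m).
Notation V := 'rV[R]_m.
Notation qf := (qform y).

(** Cauchy-Schwarz, read off from the squared norm of |y|^2 x - s y, which is |y|^2 q(x). It makes
    the square root in [t_of] genuine. *)
Lemma qf_ge0 (x : V) : 0 <= qf x.
Proof.
have e : sqnorm (sqnorm y *: x - dotR x y *: y) = sqnorm y * qf x.
  rewrite {1}/sqnorm {1}/dotR.
  rewrite (eq_bigr (fun j => sqnorm y ^+ 2 * (x 0 j * x 0 j) - 2 * sqnorm y * dotR x y * (x 0 j * y 0 j)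
    + dotR x y ^+ 2 * (y 0 j * y 0 j))); last by move=> j _; rewrite !mxE; ring.
  rewrite big_split sumrB -!mulr_sumr /=.
  rewrite -[\sum_(_ < _) x 0 _ * x 0 _]/(sqnorm x) -[\sum_(_ < _) x 0 _ * y 0 _]/(dotR x y).
  rewrite -[\sum_(_ < _) y 0 _ * y 0 _]/(sqnorm y) /qform; ring.
have [y0|y0] := eqVneq (sqnorm y) 0; last first.
  have y1 : 0 < sqnorm y by rewrite lt_def y0 sqnorm_ge0.
  by rewrite -(pmulr_rge0 _ y1) -e sqnorm_ge0.
have yj j : y 0 j = 0.
  move/eqP: y0; rewrite /sqnorm /dotR psumr_eq0; last by move=> i _; rewrite -expr2 sqr_ge0.
  by move=> /allP/(_ j); rewrite mem_index_enum => /(_ isT) /=; rewrite mulf_eq0 orbb => /eqP.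
have d0 : dotR x y = 0 by rewrite /dotR big1// => j _; rewrite yj mulr0.
by rewrite /qform y0 d0 mul0r expr0n /= subr0.
Qed.

Lemma qf_le (x : V) : qf x <= sqnorm y * sqnorm x.
Proof. by rewrite /qform lerBlDr lerDl sqr_ge0. Qed.

Definition bessel0 (h : nat) (x : V) : R := Num.sqrt (pi / 2) * tildeJ (h%:R - 1 / 2) (t_of x y).

Lemma t_of_sqr (x : V) n : t_of x y ^+ (2 * n) = qf x ^+ n.
Proof.
rewrite exprM /t_of sqr_sqrtr; last by rewrite mulrC; exact: qf_ge0.
by rewrite /qform mulrC.
Qed.

(** Gamma(n+h+1/2) contributes sqrt(pi) and 2^(2n+h-1/2) contributes 1/sqrt(2) to the denominator;
    the prefactor sqrt(pi/2) cancels both. *)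
Lemma bessel_coefE h n : Num.sqrt (pi / 2) * ((-1) ^+ n /
  ((n`!)%:R * Gamma (n%:R + (h%:R - 1 / 2) + 1) * (2 `^ (2 * n%:R + (h%:R - 1 / 2))))) = bessel_coef R h n.
Proof.
have -> : n%:R + (h%:R - 1 / 2) + 1 = (n + h)%:R + 1 / 2 :> R by rewrite natrD; lra.
rewrite Gamma_half_odd.
have -> : 2 * n%:R + (h%:R - 1 / 2) = (2 * n + h)%:R + - 2^-1 :> R.
  by rewrite natrD (natrM R 2); lra.
rewrite powRD; last by rewrite pnatr_eq0 implybT.
rewrite powR_mulrn// powRN powR12_sqrt//.
have p0 : 0 < Num.sqrt pi :> R by rewrite sqrtr_gt0 pi_gt0.
have s0 : 0 < Num.sqrt 2 :> R by rewrite sqrtr_gt0.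
rewrite sqrtrM ?pi_ge0// sqrtrV//.
have -> : (2 * n + h = n + (n + h))%N by lia.
rewrite (exprD 2 n (n + h)) /bessel_coef.
have f0 : (n`!)%:R != 0 :> R by rewrite pnatr_eq0 -lt0n fact_gt0.
have d0 : (dfact (n + h).*2.-1)%:R != 0 :> R by rewrite pnatr_eq0 -lt0n dfact_gt0.
have t0 : 2 ^+ n != 0 :> R by rewrite expf_neq0// pnatr_eq0.
have t1 : 2 ^+ (n + h) != 0 :> R by rewrite expf_neq0// pnatr_eq0.
move: (lt0r_neq0 p0) (lt0r_neq0 s0) f0 d0 t0 t1.
move: (Num.sqrt pi) (Num.sqrt 2) (n`!)%:R (dfact _)%:R (2 ^+ n) (2 ^+ (n + h)) ((-1) ^+ n) => *.
by field; do ?[apply/andP; split].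
Qed.

Lemma dfact_double_ge n : (n`! <= dfact n.*2.-1)%N.
Proof.
elim: n => [//|n ih]; rewrite doubleS -pred_Sn dfactE// factS leq_mul//; lia.
Qed.

(** The denominator dominates n! twice. One copy absorbs (u/e)^n into exp(u/e), the other keeps
    e^n/n!; summation against |x|^(2n) then gives growth exp(e |x|^2) with e as small as desired. *)
Lemma bessel_coef_le h n (e u : R) : 0 < e -> 0 <= u ->
  `|bessel_coef R h n| * u ^+ n <= expR (u / e) * (e ^+ n / (n`!)%:R).
Proof.
move=> e0 u0.
have f0 : 0 < (n`!)%:R :> R by rewrite ltr0n fact_gt0.
have d0 : 0 < (dfact (n + h).*2.-1)%:R :> R by rewrite ltr0n dfact_gt0.
have t0 : 0 < 2 ^+ n :> R by rewrite exprn_gt0.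
have -> : `|bessel_coef R h n| = (2 ^+ n * (n`!)%:R * (dfact (n + h).*2.-1)%:R)^-1.
  rewrite /bessel_coef normrM normrX normrN1 expr1n mul1r gtr0_norm// invr_gt0.
  by rewrite !mulr_gt0.
have h1 : (u / e) ^+ n / (n`!)%:R <= expR (u / e).
  have ue : 0 <= u / e by rewrite divr_ge0// ltW.
  apply: le_trans (sum_exp_le n.+1 ue); rewrite big_ord_recr /= lerDr.
  by apply: sumr_ge0 => j _; rewrite divr_ge0// exprn_ge0.
have h2 : (n`!)%:R <= (dfact (n + h).*2.-1)%:R :> R.
  rewrite ler_nat; apply: leq_trans (dfact_double_ge _).
  by elim: h {d0} => [|h ih]; rewrite ?addn0// addnS factS; nia.
have h3 : 1 <= 2 ^+ n :> R by rewrite exprn_ege1// ler1n.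
rewrite ler_pdivrMl ?mulr_gt0//.
have -> : u ^+ n = (u / e) ^+ n * e ^+ n by rewrite -exprMn divfK// gt_eqF.
have -> : 2 ^+ n * (n`!)%:R * (dfact (n + h).*2.-1)%:R * (expR (u / e) * (e ^+ n / (n`!)%:R)) =
  (2 ^+ n * (dfact (n + h).*2.-1)%:R * expR (u / e)) * e ^+ n.
  by field; rewrite gt_eqF.
apply: ler_wpM2r; first by rewrite exprn_ge0// ltW.
move: h1; rewrite ler_pdivrMr// => h1; apply: (le_trans h1).
rewrite mulrC ler_wpM2r ?expR_ge0//; apply: (le_trans h2).
by rewrite ler_peMl// ltW.
Qed.

Lemma series_bessel_cvg h x :
  (fun N => \sum_(n < N) bessel_coef R h n * qf x ^+ n) @ \oo --> bessel0 h x.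
Proof.
pose a n := bessel_coef R h n * qf x ^+ n.
have q0 := qf_ge0 x.
have cva : cvgn (series a).
  apply: normed_cvg.
  apply: (@series_le_cvg _ _ (fun n => expR (qf x) * (1 ^+ n / (n`!)%:R))).
  - by move=> n; rewrite /= normr_ge0.
  - by move=> n; rewrite mulr_ge0 ?expR_ge0// divr_ge0.
  - move=> n; rewrite /= /a normrM (ger0_norm (exprn_ge0 _ q0)).
    by have := @bessel_coef_le h n 1 (qf x) ltr01 q0; rewrite divr1.
  - have -> : series (fun n => expR (qf x) * (1 ^+ n / (n`!)%:R)) =
      (fun N => expR (qf x) * series (exp_coeff 1) N).
      by apply/funext => n; rewrite /series /= mulr_sumr.
    by apply: is_cvgMr; exact: is_cvg_series_exp_coeff.
have e : (fun N => \sum_(n < N) a n) = series a.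
  by apply/funext => N; rewrite /series /= big_mkord.
rewrite -/a e.
have -> : bessel0 h x = limn (series a); last exact: cva.
rewrite /bessel0 /tildeJ.
set S := (fun N : nat => _).
have sp : 0 < Num.sqrt (pi / 2) :> R by rewrite sqrtr_gt0 divr_gt0 ?pi_gt0.
have eS : series a = (fun N => Num.sqrt (pi / 2) * S N).
  apply/funext => N; rewrite -e /S mulr_sumr; apply: eq_bigr => n _.
  by rewrite t_of_sqr /a -bessel_coefE -[LHS]mulrA.
have cS : cvgn S.
  have -> : S = (fun N => (Num.sqrt (pi / 2))^-1 * series a N).
    by apply/funext => N; rewrite eS mulKf// gt_eqF.
  exact: is_cvgMr.
by rewrite eS; apply/esym/cvg_lim => //; exact: cvgMr.
Qed.

Lemma series_of_bessel0 h : series_of (bessel0 h) (kpoly y h 0).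
Proof.
split.
- by move=> d; exact: polyfun_kpoly.
- move=> e e0; exists (expR (sqnorm y / e)); first exact: expR_ge0.
  move=> M x; rewrite (@sum_sparse _ (fun d => `|kpoly y h 0 d x|) 0); last first.
    by move=> n /=; rewrite subn0 => on; rewrite /= on normr0.
  rewrite subn0.
  apply: (@le_trans _ _ (expR (sqnorm y / e) * \sum_(n < uphalf M) (e * sqnorm x) ^+ n / (n`!)%:R)).
    rewrite mulr_sumr; apply: ler_sum => n _.
    rewrite add0n /= odd_double doubleK normrM (ger0_norm (exprn_ge0 _ (qf_ge0 x))).
    apply: (@le_trans _ _ (`|bessel_coef R h n| * (sqnorm y * sqnorm x) ^+ n)).
      rewrite ler_wpM2l// lerXn2r// ?nnegrE ?qf_ge0 ?qf_le//.
      by rewrite mulr_ge0// sqnorm_ge0.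
    rewrite !exprMn.
    have := bessel_coef_le h n e0 (sqnorm_ge0 y).
    move=> /(ler_wpM2l (exprn_ge0 n (sqnorm_ge0 x))); congr (_ <= _); ring.
  rewrite ler_wpM2l ?expR_ge0//; apply: sum_exp_le.
  by rewrite mulr_ge0 ?sqnorm_ge0// ltW.
- move=> x; apply: (@cvg_sum_sparse _ (fun d => kpoly y h 0 d x) 0).
    by move=> n /=; rewrite subn0 => on; rewrite /= on.
  under eq_fun => M do under eq_bigr => n _ do rewrite add0n /= odd_double doubleK.
  exact: series_bessel_cvg.
Qed.

(** C(i,2l) (2l-1)!! is i! / (2^l l! (i-2l)!), the coefficient pattern of Hermite polynomials. The
    subtraction h - l does not truncate as long as i <= 2h + 1. *)
Definition bessel_sum (h i : nat) (x : V) : R := \sum_(l < (i./2).+1)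
  ('C(i, l.*2) * dfact l.*2.-1)%:R * dotR x y ^+ (i - l.*2) * bessel0 (h - l) x.

Lemma bessel_sum_widen h i B x : (i./2 < B)%N -> bessel_sum h i x =
  \sum_(l < B) ('C(i, l.*2) * dfact l.*2.-1)%:R * dotR x y ^+ (i - l.*2) * bessel0 (h - l) x.
Proof.
move=> iB; rewrite /bessel_sum.
rewrite (big_ord_widen B
  (fun l => ('C(i, l.*2) * dfact l.*2.-1)%:R * dotR x y ^+ (i - l.*2) * bessel0 (h - l) x))//.
rewrite big_mkcond; apply: eq_bigr => l _; case: ifP => // /negbT; rewrite -leqNgt => il.
by rewrite bin_small ?mul0n ?mul0r//; lia.
Qed.

(** The Hermite recursion: Pascal's rule splits C(i+1,2l+2) (2l+1)!!, and one part becomes i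
    C(i-1,2l) (2l-1)!!. Its Bessel index is (h+1) - (l+1) = h - l, which lowers h. *)
Lemma bessel_sum_rec h i x : bessel_sum h.+1 i.+1 x =
  dotR x y * bessel_sum h.+1 i x + i%:R * bessel_sum h i.-1 x.
Proof.
rewrite (@bessel_sum_widen h.+1 i.+1 i.+2); last by lia.
rewrite (@bessel_sum_widen h.+1 i i.+2); last by lia.
rewrite (@bessel_sum_widen h i.-1 i.+1); last by lia.
rewrite big_ord_recl [in RHS]big_ord_recl /= mulrDr -addrA; congr (_ + _).
  by rewrite !bin0 !subn0 exprS; ring.
rewrite !mulr_sumr -big_split; apply: eq_bigr => l _ /=.
rewrite /bump /= add1n subSS.
have e : ('C(i.+1, l.+1.*2) * dfact l.+1.*2.-1 =
  'C(i, l.+1.*2) * dfact l.+1.*2.-1 + i * ('C(i.-1, l.*2) * dfact l.*2.-1))%N.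
  rewrite doubleS binS mulnDl; congr (_ + _)%N.
  rewrite -pred_Sn dfactE// mulnA (mulnC 'C(_, _)) -mul_bin_diag mulnA.
  by congr (_ * dfact _)%N.
rewrite e natrD mulrDl mulrDl; congr (_ + _).
  have [il|il] := ltnP i l.+1.*2; first by rewrite bin_small// mul0n !mul0r mulr0.
  by rewrite subSn// exprS; ring.
rewrite natrM doubleS subSS -!mulrA; congr (_ * (_ * (_ ^+ _ * _))); lia.
Qed.

(** The recursion lowers i by two and h by one, which preserves the bound; [kpoly_lower] then
    rewrites the lowered term at the original h. *)
Lemma series_of_bessel_sum h i : (i <= h.*2.+1)%N ->
  series_of (bessel_sum h i) (kpoly y h i).
Proof.
elim/kpoly_ind: i h => [|i h1 h2] h ih.
  have -> : bessel_sum h 0 = bessel0 h; last exact: series_of_bessel0.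
  by apply/funext => x; rewrite /bessel_sum big_ord1 -[('C(_, _) * _)%N]/1%N sub0n expr0 mulr1 mul1r subn0.
have ps := polyfun_dot y.
have s1 := series_of_shift (series_of_mul (h1 h ltac:(lia)) ps).
case: i h1 h2 ih s1 => [|i] h1 h2 ih s1.
  have -> : bessel_sum h 1 = (fun x => dotR x y * bessel_sum h 0 x).
    apply/funext => x; rewrite /bessel_sum !big_ord1 /= !bin0; ring.
  have -> : kpoly y h 1 = shift_series (fun d x => dotR x y * kpoly y h 0 d x); last exact: s1.
  by apply/funext => n; apply/funext => x; rewrite /= !mul0r addr0.
case: h ih s1 => [//|h] ih s1.
have s2 := series_of_add s1 (series_of_scale i.+1%:R (h2 h ltac:(lia))).
have -> : bessel_sum h.+1 i.+2 = (fun x => dotR x y * bessel_sum h.+1 i.+1 x + i.+1%:R * bessel_sum h i x).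
  by apply/funext => x; rewrite bessel_sum_rec.
have -> : kpoly y h.+1 i.+2 = (fun n x => shift_series (fun d x => dotR x y * kpoly y h.+1 i.+1 d x) n x
   + i.+1%:R * kpoly y h i n x); last exact: s2.
apply/funext => n; apply/funext => x; rewrite (kpoly_lower y h i n x).
have -> : kpoly y h.+1 i.+2 n x = shift_series (fun d x => dotR x y * kpoly y h.+1 i.+1 d x) n x
  + i.+1%:R * (2 * h.+1%:R - i.+1%:R + n%:R) * kpoly y h.+1 i n x by [].
rewrite -!natr1; ring.
Qed.

End BesselSeries.

Local Opaque dd.

(** * Harmonicity of M and xM, and the Dirac operator on xM *)

Section Monogenic.
Variables (R : realType) (m : nat).
Notation Cl := (Cl R m).
Notation V := 'rV[R]_m.
Implicit Types (N M : V -> Cl).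

Definition clhom k N := forall A, homf k (fun x => N x A).

Definition vmul N (x : V) : Cl := cl_mul (cl_vec x) (N x).

Definition diracf N (A : {set 'I_m}) (x : V) : R :=
  \sum_j esgn R j A * part j (fun z => N z (symd [set j] A)) x.

Lemma clhom_poly k N A : clhom k N -> polyfun (fun x => N x A).
Proof. by move=> h; exact: homf_polyfun (h A). Qed.

Lemma vmulE N x A : vmul N x A = \sum_j x 0 j * (esgn R j A * N x (symd [set j] A)).
Proof. by rewrite /vmul cl_vec_mul; apply: eq_bigr => j _; rewrite cl_mul_e. Qed.

Lemma clhom_vmul k N : clhom k N -> clhom k.+1 (vmul N).
Proof.
move=> h A; have -> : (fun x => vmul N x A) =
  fun x => \sum_j x 0 j * (esgn R j A * N x (symd [set j] A)).
  by apply/funext => x; rewrite vmulE.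
by apply: homf_sum => j; apply: homf_coord; apply: homf_scale; exact: h.
Qed.

Lemma homf_prod_coord k (f : 'I_k -> 'I_m) : homf k (fun x : V => \prod_(r < k) x 0 (f r)).
Proof.
elim: k f => [|k ih] f; first by under eq_fun do rewrite big_ord0; exact: homf_cst.
by under eq_fun do rewrite big_ord_recl; apply: homf_coord; exact: ih.
Qed.

Lemma hom_poly_clhom k M : hom_poly k M -> clhom k M.
Proof.
move=> [c hc] A; have -> : (fun x => M x A) =
  fun x => \sum_(s : k.-tuple 'I_m) c s A * \prod_(r < k) x 0 (tnth s r).
  by apply/funext => x; rewrite hc ffunE; apply: eq_bigr => s _; rewrite mulrC.
by apply: homf_sum => s; apply: homf_scale; exact: homf_prod_coord.
Qed.

Lemma dirac_diracf N x A : Defs.dirac N x A = diracf N A x.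
Proof.
rewrite ffunE; apply: eq_bigr => j _; rewrite cl_mul_e /cl_partial ffunE.
by [].
Qed.

Section Monog.
Variables (k : nat) (M : V -> Cl).
Hypothesis hM : clhom k M.
Hypothesis dM : forall A x, diracf M A x = 0.

Let pM A : polyfun (fun x => M x A) := clhom_poly A hM.

Let d2 (l j : 'I_m) (x : V) : Cl := [ffun B => part l (part j (fun z => M z B)) x].

Let d2C l j x : d2 l j x = d2 j l x.
Proof. apply/ffunP => B.
rewrite [LHS]ffunE.
rewrite [RHS]ffunE.
have e := dd_comm (delta_mx 0 l) (delta_mx 0 j) (pM B).
rewrite /part.
rewrite e.
by []. Qed.

(** The Dirac operator squares to minus the Laplacian: after symmetrising the double sum,
    anticommutation leaves only its diagonal. *)
Lemma monogenic_harmonic A : harmonicf (fun x => M x A).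
Proof.
move=> x; have pp B j := polyfun_dd (delta_mx 0 j) (pM B).
have H : \sum_l \sum_j cl_mul (cl_e R l) (cl_mul (cl_e R j) (d2 l j x)) A = 0.
  transitivity (\sum_l esgn R l A * part l (diracf M (symd [set l] A)) x); last first.
    rewrite big1// => l _; have -> : diracf M (symd [set l] A) = fun _ => 0.
      by apply/funext => z; exact: dM.
    by rewrite /part dd_cst mulr0.
  apply: eq_bigr => l _; rewrite /diracf /part dd_sum; last first.
    by move=> j; apply: polyfun_scale; exact: pp.
  rewrite mulr_sumr; apply: eq_bigr => j _.
  by rewrite (dd_scale _ _ (pp _ j)) !cl_mul_e ffunE.
have : \sum_l \sum_j (cl_mul (cl_e R l) (cl_mul (cl_e R j) (d2 l j x)) A +
                      cl_mul (cl_e R j) (cl_mul (cl_e R l) (d2 l j x)) A) = 0.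
  under eq_bigr do rewrite big_split; rewrite big_split /= H add0r exchange_big /=.
  rewrite -[RHS]H; apply: eq_bigr => l _; apply: eq_bigr => j _.
  by rewrite d2C.
under eq_bigr => l _ do under eq_bigr => j _ do rewrite cl_e_anticomm.
have -> : \sum_l \sum_j -2 * (l == j)%:R * d2 l j x A =
   -2 * \sum_j part j (part j (fun z => M z A)) x.
  rewrite mulr_sumr; apply: eq_bigr => l _.
  rewrite (bigD1 l)//= eqxx big1 ?addr0; first by rewrite mulr1 ffunE.
  by move=> j jl; rewrite eq_sym (negPf jl) mulr0 mul0r.
by move/eqP; rewrite mulf_eq0 oppr_eq0 pnatr_eq0 /= => /eqP.
Qed.

Let f j A x := esgn R j A * M x (symd [set j] A).
Let pf j A : polyfun (f j A). Proof. exact: polyfun_scale (pM _). Qed.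

Let part_vmul l A x : part l (fun z => vmul M z A) x =
  f l A x + \sum_j x 0 j * part l (f j A) x.
Proof.
have -> : (fun z => vmul M z A) = fun z => \sum_j z 0 j * f j A z.
  by apply/funext => z; rewrite vmulE.
have pc j := @polyfun_coord R m j.
rewrite /part dd_sum; last by move=> j; exact: polyfun_mul.
rewrite (eq_bigr (fun j => (l == j)%:R * f j A x + x 0 j * part l (f j A) x)); last first.
  by move=> j _; rewrite (dd_mul _ (pc j) (pf j A)) dd_coord mxE eqxx /= eq_sym.
rewrite big_split /=; congr (_ + _).
rewrite (bigD1 l)//= eqxx mul1r big1 ?addr0// => j jl.
by rewrite eq_sym (negPf jl) mul0r.
Qed.

(** The Laplacian of xM is 2 DM + x times the Laplacian of M, D being the Dirac operator, and both
    terms vanish. *)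
Lemma vmul_harmonic A : harmonicf (fun x => vmul M x A).
Proof.
move=> x.
have pc j := @polyfun_coord R m j.
have pp l j := polyfun_dd (delta_mx 0 l) (pf j A).
have E l : part l (part l (fun z => vmul M z A)) x =
  2 * part l (f l A) x + \sum_j x 0 j * part l (part l (f j A)) x.
  have -> : part l (fun z => vmul M z A) = fun z => f l A z + \sum_j z 0 j * part l (f j A) z.
    by apply/funext => z; exact: part_vmul.
  have px j : polyfun (fun z => z 0 j * part l (f j A) z).
    by apply: polyfun_mul => //; exact: pp.
  rewrite /part (dd_add _ (pf l A) (polyfun_sum _ _ px)) dd_sum//.
  rewrite (eq_bigr (fun j => (l == j)%:R * part l (f j A) x + x 0 j * part l (part l (f j A)) x)); last first.
    by move=> j _; rewrite (dd_mul _ (pc j) (pp l j)) dd_coord mxE eqxx /= eq_sym.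
  rewrite big_split /= addrA; congr (_ + _).
  rewrite (bigD1 l)//= eqxx mul1r big1 ?addr0; last first.
    by move=> j jl; rewrite eq_sym (negPf jl) mul0r.
  by rewrite /part; ring.
under eq_bigr do rewrite E; rewrite big_split /= -mulr_sumr exchange_big /=.
have -> : \sum_l part l (f l A) x = 0.
  rewrite -[RHS](dM A x) /diracf; apply: eq_bigr => l _.
  by rewrite /f /part (dd_scale _ _ (pM _)).
rewrite mulr0 add0r big1// => j _; rewrite -mulr_sumr.
have -> : \sum_l part l (part l (f j A)) x = 
    esgn R j A * \sum_l part l (part l (fun z => M z (symd [set j] A))) x.
  rewrite mulr_sumr; apply: eq_bigr => l _.
  by rewrite /f /part (dd_scale _ _ (pM _)) (dd_scale _ _ (polyfun_dd _ (pM _))).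
by rewrite monogenic_harmonic !mulr0.
Qed.

Let d1 (j : 'I_m) (x : V) : Cl := [ffun B => part j (fun z => M z B) x].

(** D x + x D = - m - 2 Euler, applied to M with DM = 0 and Euler derivative k M. *)
Lemma dirac_vmul A x : diracf (vmul M) A x = - (m%:R + 2 * k%:R) * M x A.
Proof.
have E : diracf (vmul M) A x =
  \sum_l cl_mul (cl_e R l) (cl_mul (cl_e R l) (M x)) A +
  \sum_l \sum_j x 0 j * cl_mul (cl_e R l) (cl_mul (cl_e R j) (d1 l x)) A.
  rewrite -big_split; apply: eq_bigr => l _ /=.
  rewrite part_vmul mulrDr; congr (_ + _); first by rewrite !cl_mul_e.
  rewrite mulr_sumr; apply: eq_bigr => j _.
  rewrite !cl_mul_e ffunE /f /part (dd_scale _ _ (pM _)); ring.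
rewrite E.
have E1 l : cl_mul (cl_e R l) (cl_mul (cl_e R l) (M x)) A = - M x A.
  have := cl_e_anticomm l l (M x) A; rewrite eqxx mulr1.
  move: (cl_mul _ _ A) (M x A) => a b h; lra.
under eq_bigr do rewrite E1.
rewrite sumr_const card_ord exchange_big /=.
have E2 j : \sum_l x 0 j * cl_mul (cl_e R l) (cl_mul (cl_e R j) (d1 l x)) A =
   - 2 * (x 0 j * part j (fun z => M z A) x).
  rewrite -mulr_sumr.
  have -> : \sum_l cl_mul (cl_e R l) (cl_mul (cl_e R j) (d1 l x)) A =
    \sum_l (- 2 * (l == j)%:R * d1 l x A) - \sum_l cl_mul (cl_e R j) (cl_mul (cl_e R l) (d1 l x)) A.
    by rewrite -sumrB; apply: eq_bigr => l _; rewrite -cl_e_anticomm addrK.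
  have -> : \sum_l cl_mul (cl_e R j) (cl_mul (cl_e R l) (d1 l x)) A = 0.
    under eq_bigr do rewrite cl_mul_e; rewrite -mulr_sumr.
    rewrite -[X in _ * X = _]/(\sum_l cl_mul (cl_e R l) (d1 l x) (symd [set j] A)).
    rewrite -[RHS](mulr0 (esgn R j A)); congr (_ * _); rewrite -[RHS](dM (symd [set j] A) x).
    by apply: eq_bigr => l _; rewrite cl_mul_e ffunE.
  rewrite subr0 (bigD1 j)//= eqxx big1 ?addr0; first by rewrite mulr1 ffunE; move: (part _ _ _) => b; ring.
  by move=> l lj; rewrite (negPf lj) mulr0 mul0r.
under eq_bigr do rewrite E2.
rewrite -mulr_sumr -(dd_part x x (pM A)) (euler x (hM A)) -mulr_natl; ring.
Qed.

End Monog.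
End Monogenic.

(** * The remaining part of the kernel as a gradient *)

Section KernelAction.
Variables (R : realType) (m : nat) (y : 'rV[R]_m).
Notation Cl := (Cl R m).
Notation V := 'rV[R]_m.
Implicit Types (N M : V -> Cl).

(* The degree-[n] part of (ftilde + (x ^ y) g) applied to [N], not counting the degree of [N]; the shift
   accounts for the extra degree of the wedge. *)
Definition kernel_part h i n N (A : {set 'I_m}) (x : V) : R :=
  - (i%:R * kpoly y h i.-1 n x) * N x A +
  shift_series (kpoly y h.+1 i) n x * cl_mul (cl_wedge x y) (N x) A.

Lemma homf_wedge k N A : clhom k N -> homf k.+1 (fun x => cl_mul (cl_wedge x y) (N x) A).
Proof.
move=> hN.
have -> : (fun x => cl_mul (cl_wedge x y) (N x) A) = fun x =>
   -1 * (\sum_j (y 0 j * esgn R j A) * vmul N x (symd [set j] A)) + (-1) * (dotR x y * N x A).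
  apply/funext => x; rewrite cl_wedge_mul cl_vec_mul -/(vmul N x) !mulN1r; congr (- _ + _).
  by apply: eq_bigr => j _; rewrite cl_mul_e mulrA.
apply: homf_add; apply: homf_scale.
  by apply: homf_sum => j; apply: homf_scale; exact: clhom_vmul.
by rewrite -add1n; apply: homf_mul => //; exact: homf_dot.
Qed.

Lemma polyfun_kernel_part h i n k N A : clhom k N -> polyfun (kernel_part h i n N A).
Proof.
move=> hN; apply: polyfun_add; apply: polyfun_mul.
- by apply: polyfun_opp; apply: polyfun_scale; exact: polyfun_kpoly.
- exact: clhom_poly hN.
- by case: n => [|n]; [exact: polyfun_cst|exact: polyfun_kpoly].
- exact: homf_polyfun (homf_wedge A hN).
Qed.

(* Left multiplication by y turns this part of the kernel into -grad Phi^h_i. *)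
Lemma vec_kernel_part h i n N A x :
  \sum_j y 0 j * (esgn R j A * kernel_part h i n N (symd [set j] A) x) =
  - \sum_j part j (kpoly y h i n.+1) x * (esgn R j A * N x (symd [set j] A)).
Proof.
pose P1 := i%:R * kpoly y h i.-1 n x; pose P2 := shift_series (kpoly y h.+1 i) n x.
have W : \sum_j y 0 j * (esgn R j A * cl_mul (cl_wedge x y) (N x) (symd [set j] A)) =
   sqnorm y * cl_mul (cl_vec x) (N x) A - dotR x y * cl_mul (cl_vec y) (N x) A.
  transitivity (- cl_mul (cl_vec y) (cl_mul (cl_vec y) (cl_mul (cl_vec x) (N x))) A
     - dotR x y * cl_mul (cl_vec y) (N x) A); last by rewrite cl_vec_sqr; ring.
  rewrite (cl_vec_mul y (cl_mul _ _)) (cl_vec_mul y (N x)) mulr_sumr -sumrN -sumrB.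
  by apply: eq_bigr => j _; rewrite cl_wedge_mul !cl_mul_e; ring.
transitivity (- P1 * cl_mul (cl_vec y) (N x) A +
  P2 * (sqnorm y * cl_mul (cl_vec x) (N x) A - dotR x y * cl_mul (cl_vec y) (N x) A)).
  rewrite -W (cl_vec_mul y (N x)) !mulr_sumr -big_split; apply: eq_bigr => j _ /=.
  by rewrite cl_mul_e /kernel_part -/P1 -/P2; ring.
rewrite !cl_vec_mul !mulr_sumr -sumrB mulr_sumr -big_split -sumrN; apply: eq_bigr => j _ /=.
rewrite part_kpoly !cl_mul_e /P1 /P2.
move: (kpoly y h i.-1 n x) (shift_series (kpoly y h.+1 i) n x) (N x _) => a b c; ring.
Qed.

(** From E[x_j P g] = E[(d_j P) g] + E[P d_j g], summed with e_j on the left: the x_j assemble to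
    multiplication by x, the d_j acting on N to its Dirac derivative. *)
Lemma gE_vec_kernel_part h i n k N A : clhom k N ->
  \sum_j y 0 j * (esgn R j A * gE (kernel_part h i n N (symd [set j] A))) =
  gE (fun x => kpoly y h i n.+1 x * diracf N A x) -
  gE (fun x => kpoly y h i n.+1 x * vmul N x A).
Proof.
move=> hN; have pN B := clhom_poly B hN; have ps B := polyfun_kernel_part h i n B hN.
have pk := polyfun_kpoly y h i n.+1.
pose g j x := esgn R j A * N x (symd [set j] A).
have pg j : polyfun (g j) by exact: polyfun_scale (pN _).
have pdk j : polyfun (part j (kpoly y h i n.+1)) by exact: polyfun_dd pk.
have pdg j : polyfun (part j (g j)) by exact: polyfun_dd (pg j).
have pc j := @polyfun_coord R m j.
transitivity (gE (fun x => - \sum_j part j (kpoly y h i n.+1) x * g j x)).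
  transitivity (gE (fun x => \sum_j (y 0 j * esgn R j A) * kernel_part h i n N (symd [set j] A) x)).
    rewrite gE_sum; last by move=> j; exact: polyfun_scale.
    by apply: eq_bigr => j _; rewrite gE_scale// mulrA.
  congr gE; apply/funext => x; rewrite -vec_kernel_part.
  by apply: eq_bigr => j _; rewrite mulrA.
have pkg j : polyfun (fun x => part j (kpoly y h i n.+1) x * g j x) by exact: polyfun_mul.
have pkdg j : polyfun (fun x => kpoly y h i n.+1 x * part j (g j) x) by exact: polyfun_mul.
have pxkg j : polyfun (fun x => x 0 j * (kpoly y h i n.+1 x * g j x)).
  by apply: polyfun_mul => //; exact: polyfun_mul.
rewrite gE_opp; last exact: polyfun_sum.
have -> : (fun x => kpoly y h i n.+1 x * diracf N A x) =
   fun x => \sum_j kpoly y h i n.+1 x * part j (g j) x.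
  apply/funext => x; rewrite /diracf mulr_sumr; apply: eq_bigr => j _.
  by rewrite /g /part (dd_scale _ _ (pN _)).
have -> : (fun x => kpoly y h i n.+1 x * vmul N x A) =
   fun x => \sum_j x 0 j * (kpoly y h i n.+1 x * g j x).
  by apply/funext => x; rewrite vmulE mulr_sumr; apply: eq_bigr => j _; rewrite mulrCA.
rewrite !gE_sum// -sumrN -sumrB; apply: eq_bigr => j _.
rewrite (gE_coord j (polyfun_mul pk (pg j))) /part (dd_mul _ pk (pg j)) -!/(part j _).
by rewrite gE_add// opprD addrCA subrr addr0.
Qed.

(** A second multiplication by y replaces y y with - |y|^2, which is cancelled. The arguments are
    plain families of components because they will be means taken componentwise. *)
Lemma vec_cancel (v w : {set 'I_m} -> R) c : sqnorm y != 0 ->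
  (forall A, \sum_j y 0 j * (esgn R j A * v (symd [set j] A)) =
     c * \sum_j y 0 j * (esgn R j A * w (symd [set j] A))) ->
  forall A, v A = c * w A.
Proof.
move=> y0 H A; pose v' : Cl := [ffun B => v B]; pose w' : Cl := [ffun B => w B].
have E B : cl_mul (cl_vec y) v' B = c * cl_mul (cl_vec y) w' B.
  rewrite !cl_vec_mul; have := H B; congr (_ = c * _).
    by apply: eq_bigr => j _; rewrite cl_mul_e ffunE.
  by apply: eq_bigr => j _; rewrite cl_mul_e ffunE.
have Z : cl_mul (cl_vec y) (cl_mul (cl_vec y) v') A = c * cl_mul (cl_vec y) (cl_mul (cl_vec y) w') A.
  rewrite !(cl_vec_mul y (cl_mul _ _)) mulr_sumr; apply: eq_bigr => j _.
  by rewrite !cl_mul_e E; ring.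
move: Z; rewrite !cl_vec_sqr !ffunE => Z.
have y1 : - sqnorm y != 0 by rewrite oppr_eq0.
by apply: (mulfI y1); rewrite Z; ring.
Qed.


End KernelAction.

(** * Gaussian means of the remaining part against M and xM *)

Section KernelMoments.
Variables (R : realType) (m : nat) (y : 'rV[R]_m).
Notation V := 'rV[R]_m.
Notation u := (sqnorm y).

Lemma sqnorm_eq0 : u = 0 -> y = 0.
Proof.
move=> /eqP; rewrite /sqnorm /dotR psumr_eq0; last by move=> j _; rewrite -expr2 sqr_ge0.
move=> /allP h; apply/rowP => j; rewrite mxE; apply/eqP.
by have := h j (mem_index_enum j); rewrite /= mulf_eq0 orbb.
Qed.

Lemma cl_wedge_mul0 (x : V) (v : Cl R m) A : y = 0 -> cl_mul (cl_wedge x y) v A = 0.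
Proof.
move=> y0; rewrite cl_wedge_mul cl_vec_mul big1; last by move=> j _; rewrite y0 mxE mul0r.
by rewrite /dotR big1 ?mul0r ?subr0 ?oppr0// => j _; rewrite y0 mxE mulr0.
Qed.

Lemma kernel_part_y0 h i n N A : y = 0 -> kernel_part y h i n.+1 N A = fun _ => 0.
Proof.
move=> y0; apply/funext => x.
by rewrite /kernel_part kpoly_at_y0// cl_wedge_mul0// !mulr0 oppr0 mul0r addr0.
Qed.

Lemma gcoef_u0 k n : u = 0 -> gcoef u k (k + n.+1) = 0.
Proof.
move=> u0; rewrite -(odd_double_half n.+1).
have e := odd_double_half n.+1.
case: (odd n.+1) e => e; first by rewrite add1n gcoef_odd.
rewrite add0n gcoef_double u0 oppr0 expr0n; case: (n.+1)./2 e => [|N] e; last by rewrite mul0r.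
by move: e; rewrite double0 addn0.
Qed.

Lemma homf_gcoef_y0 k n (f : V -> R) : homf k f -> y = 0 -> gcoef u k n.+1 * f y = 0.
Proof.
move=> hf y0; case: k hf => [|k] hf; last by rewrite {2}y0 (homf_at0 hf) mulr0.
have u0 : u = 0 by rewrite /sqnorm /dotR big1// => j _; rewrite y0 mxE mulr0.
by have := gcoef_u0 0 n u0; rewrite add0n => ->; rewrite mul0r.
Qed.

Variables (h i k : nat) (M : V -> Cl R m).
Hypotheses (mh : m = h.*2.+2) (im : (i <= m - 2)%N).
Hypotheses (hM : clhom k M) (dM : forall A x, diracf M A x = 0).

(** Serves y = 0 with n = k = 0, the one value there that can be nonzero and where y cannot be
    cancelled. *)
Lemma kernel_eig_pred0 : i%:R * kernel_eig R m i.-1 0 = kernel_eig R m i 1.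
Proof.
rewrite /kernel_eig; case: i im => [|j] jm /=; first by rewrite mul0r.
rewrite !addn0 !add0n addn1 /= negbK; case: (odd j); first by rewrite mulr0.
have -> : (m - 2 - j).-1 = (m - 2 - j.+1)%N by lia.
by rewrite -[in RHS]/(dfact j.+1) (dfactE (ltn0Sn j)) (natrM R j.+1) mulrA.
Qed.

Lemma gE_kernel_part0 l N A : clhom l N -> (forall B, harmonicf (fun x => N x B)) ->
  gE (kernel_part y h i 0 N A) = - i%:R * kernel_eig R m i.-1 l * gcoef u l 0 * N y A.
Proof.
move=> hN harN.
have -> : kernel_part y h i 0 N A = fun x => - i%:R * (kpoly y h i.-1 0 x * N x A).
  by apply/funext => x; rewrite /kernel_part /= mul0r addr0; ring.
rewrite gE_scale; last exact: polyfun_mul (polyfun_kpoly _ _ _ _) (clhom_poly A hN).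
rewrite (gE_kpoly y 0 mh _ (hN A) (harN A)); last by lia.
by ring.
Qed.

(** After multiplication by y, DM = 0 leaves only - E[P xM], and xM is harmonic of degree k + 1; its
    value at y is yM(y), from which y is cancelled. *)
Lemma gE_kernel_part_monogenic n A :
  gE (kernel_part y h i n M A) = - kernel_eig R m i k.+1 * gcoef u k n * M y A.
Proof.
case: (eqVneq u 0) => [u0|u0].
  have y0 := sqnorm_eq0 u0.
  case: n => [|n]; last first.
    by rewrite kernel_part_y0// gE0 -mulrA (homf_gcoef_y0 _ (hM A) y0) mulr0.
  rewrite (gE_kernel_part0 A hM (monogenic_harmonic hM dM)).
  case: (posnP k) => [k0|k0]; last by rewrite gcoef_lt// !mulr0 !mul0r.
  by rewrite k0 -kernel_eig_pred0 mulNr.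
apply: (@vec_cancel _ _ _ (fun B => gE (kernel_part y h i n M B)) (M y) _ u0) => B.
rewrite (gE_vec_kernel_part _ _ _ _ _ hM) -vmulE.
have -> : (fun x => kpoly y h i n.+1 x * diracf M B x) = fun _ => 0.
  by apply/funext => x; rewrite dM mulr0.
rewrite gE0 sub0r (gE_kpoly y n.+1 mh im (clhom_vmul hM B) (vmul_harmonic hM dM B)) gcoefSS.
by rewrite !mulNr.
Qed.

(** D(xM) = - (m+2k) M and x xM = - |x|^2 M. The latter contributes m + n + 1 + k, so the total
    factor is n + 1 - k, and [gcoef_rec] turns it into - |y|^2, which is y y. *)
Lemma gE_kernel_part_vmul n A :
  gE (kernel_part y h i n (vmul M) A) = kernel_eig R m i k * gcoef u k.+1 n * vmul M y A.
Proof.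
have hxM := clhom_vmul hM.
case: (eqVneq u 0) => [u0|u0].
  have y0 := sqnorm_eq0 u0.
  case: n => [|n].
    by rewrite (gE_kernel_part0 A hxM (vmul_harmonic hM dM)) gcoef_lt// !mulr0 !mul0r.
  by rewrite kernel_part_y0// gE0 -mulrA (homf_gcoef_y0 _ (hxM A) y0) mulr0.
apply: (@vec_cancel _ _ _ (fun B => gE (kernel_part y h i n (vmul M) B)) (vmul M y) _ u0) => B.
rewrite (gE_vec_kernel_part _ _ _ _ _ hxM) -vmulE.
pose f x := kpoly y h i n.+1 x * M x B.
have hf : homf (n.+1 + k) f by apply: homf_mul (homf_kpoly _ _ _ _) (hM B).
have pf := homf_polyfun hf.
have -> : (fun x => kpoly y h i n.+1 x * diracf (vmul M) B x) =
          fun x => - (m%:R + 2 * k%:R) * f x.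
  by apply/funext => x; rewrite (dirac_vmul hM dM) /f; ring.
have -> : (fun x => kpoly y h i n.+1 x * vmul (vmul M) x B) = fun x => - (sqnorm x * f x).
  by apply/funext => x; rewrite /vmul cl_vec_sqr /f; ring.
rewrite gE_scale// gE_opp; last by apply: polyfun_mul => //; exact: homf_polyfun (@homf_sqnorm R m).
rewrite (gE_sqnorm hf) (gE_kpoly y n.+1 mh im (hM B) (monogenic_harmonic hM dM B)).
rewrite {2}/vmul cl_vec_sqr.
have := gcoef_rec u k n.+1.
have -> : shift_series (m := 0) (shift_series (m := 0) (fun d _ => gcoef u k d)) n.+1 0 = gcoef u k.+1 n.
  by case: (n) => [|d] /=; rewrite ?gcoefSS// gcoef_lt.
rewrite natrD; move: (gcoef u k.+1 n) (gcoef u k n.+1) (kernel_eig _ _ _ _) (M y B) => a b c d e.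
apply: (@eq_trans _ _ (- c * d * ((k%:R - n.+1%:R) * b))); first by ring.
by rewrite -e; ring.
Qed.

End KernelMoments.

(** * The effect of the Laguerre factor *)

Section LaguerreTransform.
Variables (R : realType) (m : nat).
Notation V := 'rV[R]_m.

(** Since Q_n has degree n + k, |x|^(2j) multiplies its mean by the product of m + n + k + 2r over r
    < j. At n = k + 2N the relation m + 2k = 2a + 2 makes this 2^j j! C(N+a+j,j), ready for
    [laguerre_bin_reflection]. *)
Lemma gE_series_laguerre (F : V -> R) Q k a p (c u w : R) :
  series_of F Q -> (forall n, homf (n + k) (Q n)) -> (m + k.*2 = a.*2.+2)%N ->
  (forall n, gE (Q n) = c * gcoef u k n * w) ->
  gE (fun x => F x * laguerre p a (sqnorm x)) =
  c * (-1) ^+ p * (laguerre p a u * expR (- u / 2)) * w.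
Proof.
move=> sF hQ mk EQ.
have pL : polyfun (fun x : V => laguerre p a (sqnorm x)).
  apply: polyfun_sum => j; apply: polyfun_mul; last exact: polyfun_cst.
  apply: polyfun_mul; first exact: polyfun_cst.
  exact: polyfun_exp (homf_polyfun (@homf_sqnorm R m)).
have [_ cvF] := series_of_gE sF pL.
pose f n := gE (fun x => Q n x * laguerre p a (sqnorm x)).
suff cvf : (fun N => \sum_(d < N) f d) @ \oo --> c * (-1) ^+ p * (laguerre p a u * expR (- u / 2)) * w.
  exact: (cvg_unique _ cvF cvf).
have E n : f n =
  (\sum_(j < p.+1) (-1) ^+ j * 'C(p + a, p - j)%:R / (j`!)%:R *
     (\prod_(r < j) (m%:R + (n + k)%:R + 2 * r%:R))) * (c * gcoef u k n * w).
  have ps j : polyfun (fun x => sqnorm x ^+ j * Q n x).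
    by apply: polyfun_mul (homf_polyfun (hQ n)); exact: polyfun_exp (homf_polyfun (@homf_sqnorm R m)).
  transitivity (gE (fun x => \sum_(j < p.+1)
     ((-1) ^+ j * 'C(p + a, p - j)%:R / (j`!)%:R) * (sqnorm x ^+ j * Q n x))).
    congr gE; apply/funext => x; rewrite /laguerre mulr_sumr; apply: eq_bigr => j _; ring.
  rewrite gE_sum; last by move=> j; exact: polyfun_scale.
  rewrite mulr_suml; apply: eq_bigr => j _.
  by rewrite gE_scale// (gE_sqnorm_exp j (hQ n)) EQ mulrA.
apply: (@cvg_sum_sparse _ f k) => [n hn|].
  rewrite E; case/orP: hn => hn; first by rewrite gcoef_lt// mulr0 mul0r mulr0.
  by rewrite /gcoef hn andbF mulr0 mul0r mulr0.
pose X := - u / 2.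
have E2 N : f (k + N.*2)%N =
  c * w * (-1) ^+ p * (\sum_(j < p.+1) 2 ^+ j * 'C(p + a, p - j)%:R *
      (X ^+ N / (N`!)%:R * 'C(N, j)%:R)).
  rewrite E gcoef_double.
  have -> : \sum_(j < p.+1) (-1) ^+ j * 'C(p + a, p - j)%:R / (j`!)%:R *
     (\prod_(r < j) (m%:R + (k + N.*2 + k)%:R + 2 * r%:R)) =
     (-1) ^+ p * \sum_(j < p.+1) 2 ^+ j * 'C(p + a, p - j)%:R * 'C(N, j)%:R :> R.
    rewrite -laguerre_bin_reflection; apply: eq_bigr => j _.
    rewrite (eq_bigr (fun r : 'I_j => 2 * (a + N)%:R + 2 + 2 * r%:R)); last first.
      move=> r _; congr (_ + _); rewrite -natrD.
      have -> : (m + (k + N.*2 + k) = 2 * (a + N) + 2)%N by lia.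
      by rewrite natrD natrM.
    rewrite prod_rising (exprNn 2).
    have : (j`!)%:R != 0 :> R by rewrite pnatr_eq0 -lt0n fact_gt0.
    move: (j`!)%:R (2 ^+ j) ('C(p + a, p - j)%:R) ('C(N + a + j, j)%:R) ((-1) ^+ j) => *.
    by field.
  have -> : (- u) ^+ N / (2 ^+ N * (N`!)%:R) = X ^+ N / (N`!)%:R.
    by rewrite /X expr_div_n invfM mulrA.
  have -> : \sum_(j < p.+1) 2 ^+ j * 'C(p + a, p - j)%:R * (X ^+ N / (N`!)%:R * 'C(N, j)%:R) =
     (\sum_(j < p.+1) 2 ^+ j * 'C(p + a, p - j)%:R * 'C(N, j)%:R) * (X ^+ N / (N`!)%:R).
    by rewrite mulr_suml; apply: eq_bigr => j _; ring.
  ring.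
under eq_fun => M do under eq_bigr do rewrite E2.
under eq_fun => M do rewrite -mulr_sumr exchange_big /=.
(* With X = -u/2 the powers 2^j X^j are (-u)^j, so the reflected coefficients rebuild the same
   Laguerre polynomial, now at u. *)
have -> : c * (-1) ^+ p * (laguerre p a u * expR (- u / 2)) * w =
   c * w * (-1) ^+ p * \sum_(j < p.+1) 2 ^+ j * 'C(p + a, p - j)%:R * (X ^+ j / (j`!)%:R * expR X).
  have -> : \sum_(j < p.+1) 2 ^+ j * 'C(p + a, p - j)%:R * (X ^+ j / (j`!)%:R * expR X) =
    laguerre p a u * expR (- u / 2).
    rewrite mulr_suml; apply: eq_bigr => j _.
    rewrite /X expr_div_n (exprNn u).
    have : 2 ^+ j != 0 :> R by rewrite expf_neq0// pnatr_eq0.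
    have : (j`!)%:R != 0 :> R by rewrite pnatr_eq0 -lt0n fact_gt0.
    move: (j`!)%:R (2 ^+ j) ('C(p + a, p - j)%:R) ((-1) ^+ j) (u ^+ j) (expR _) => *.
    by field; apply/andP; split.
  ring.
apply: cvgMr.
apply: cvg_big => [|j _]; first exact: add_continuous.
under eq_fun do rewrite -mulr_sumr.
by apply: cvgMr; exact: cvg_exp_bin.
Qed.

End LaguerreTransform.

(** * The transform as a Gaussian mean of the series *)

Section Kernel.
Variables (R : realType) (m : nat) (y : 'rV[R]_m).
Notation V := 'rV[R]_m.

(** The orders enter through a function [g], so that one identity serves all three sums of the
    kernel. *)
Lemma bessel_sumE b i (g : nat -> R) x : (i <= b.*2.+1)%N ->
  (forall l, (l <= i./2)%N -> g l = (b - l)%:R - 1 / 2) ->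
  Num.sqrt (pi / 2) * \sum_(l < (i./2).+1)
      (s_of x y ^+ (i - 2 * l) / (2 ^+ l * (l`!)%:R)
       * (Gamma (i%:R + 1) / Gamma (i%:R + 1 - 2 * l%:R)) * tildeJ (g l) (t_of x y)) =
  bessel_sum y b i x.
Proof.
move=> ib hg; rewrite mulr_sumr; apply: eq_bigr => l _.
have li : (l.*2 <= i)%N by have := ltn_ord l; lia.
rewrite hg; last by have := ltn_ord l; lia.
have -> : i%:R + 1 - 2 * l%:R = (i - l.*2).+1%:R :> R.
  by rewrite -(natr1 (i - _)) natrB// -mul2n natrM; ring.
rewrite natr1 !Gamma_nat /bessel0 mul2n (natrM R) bin_natr//.
have -> : (dfact l.*2.-1)%:R = (l.*2`!)%:R / (2 ^+ l * (l`!)%:R) :> R.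
  have n0 : (2 ^ l * l`!)%:R != 0 :> R by rewrite pnatr_eq0 -lt0n muln_gt0 expn_gt0 fact_gt0.
  by rewrite fact_double -natrX -natrM (natrM R (_ * _)) mulrC mulKf.
have f0 n : (n`!)%:R != 0 :> R by rewrite pnatr_eq0 -lt0n fact_gt0.
have := f0 l; have := f0 l.*2; have := f0 (i - l.*2)%N.
have : 2 ^+ l != 0 :> R by rewrite expf_neq0// pnatr_eq0.
rewrite /s_of; move: (Num.sqrt _) (tildeJ _ _) (dotR x y ^+ _) => a b' c.
move: (l`!)%:R (l.*2`!)%:R (i`!)%:R ((i - l.*2)`!)%:R (2 ^+ l) => *.
by field; do ?[apply/andP; split].
Qed.

Variables (h i : nat).
Hypotheses (mh : m = h.*2.+2) (im : (i <= m - 2)%N).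

Let mE : m%:R = 2 * h%:R + 2 :> R.
Proof. by rewrite mh -addn2 natrD -mul2n natrM. Qed.

Lemma fhatE x : fhat m i (s_of x y) (t_of x y) = (-1) ^+ (m./2 + i) * bessel_sum y h i x.
Proof.
rewrite /fhat -mulrA (@bessel_sumE h i (fun l => (m%:R - 2 * l%:R - 3) / 2))//; first by lia.
move=> l li; have lh : (l <= h)%N by lia.
by rewrite mE natrB//; lra.
Qed.

Lemma gkerE x : gker m i (s_of x y) (t_of x y) = bessel_sum y h.+1 i x.
Proof.
rewrite /gker (@bessel_sumE h.+1 i (fun l => (m%:R - 2 * l%:R - 1) / 2))//; first by lia.
move=> l li; have lh : (l <= h.+1)%N by lia.
by rewrite mE natrB// -(natr1 h); lra.
Qed.

(** Gamma(i+1) = i Gamma(i) extracts the factor i and leaves the coefficients of index i - 1; at i =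
    0 both sides are 0. *)
Lemma ftildeE x : ftilde m i (s_of x y) (t_of x y) = - i%:R * bessel_sum y h i.-1 x.
Proof.
rewrite /ftilde; case: i im => [|j] jm /=; first by rewrite oppr0 mul0r.
rewrite -(@bessel_sumE h j (fun l => (m%:R - 2 * l%:R - 3) / 2)); first 1 last.
- by lia.
- move=> l li; have lh : (l <= h)%N by lia.
  by rewrite mE natrB//; lra.
rewrite !mulNr [in RHS]mulrCA; congr (- (_ * _)); rewrite mulr_sumr; apply: eq_bigr => l _.
rewrite subSS subn0 -(natr1 j) -[in RHS]natr1.
have -> : Gamma (j%:R + 1 + 1) = j.+1%:R * Gamma (j%:R + 1) :> R.
  by rewrite !natr1 !Gamma_nat factS natrM.
by rewrite -natr1; ring.
Qed.

Lemma cl_mul_kernel (c a b : R) (W v : Cl R m) A :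
  cl_mul (cl_add (cl_scal m a) (cl_scale b W)) (cl_scale c v) A =
  (a * v A + b * cl_mul W v A) * c.
Proof.
rewrite !cl_mulE.
transitivity (\sum_B (a * (B == finset.set0)%:R * v (symd B A) * cl_sgn R B (symd B A) * c +
   b * (W B * v (symd B A) * cl_sgn R B (symd B A)) * c)).
  by apply: eq_bigr => B _; rewrite !ffunE; ring.
rewrite big_split /= -!mulr_suml -mulr_sumr mulrDl; congr (_ * _ + _).
rewrite (bigD1 finset.set0)//= eqxx big1 ?addr0; last first.
  by move=> B B0; rewrite (negPf B0) mulr0 !mul0r.
rewrite symdC symd0 /cl_sgn finset.set0I finset.cards0 addn0.
rewrite (_ : [set _ | _]%SET = finset.set0) ?finset.cards0 ?mulr1//.
by apply/setP => q; rewrite !inE.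
Qed.

(** [F] is the kernel applied to N, the exponential being absorbed by the Gaussian mean. The wedge
    is linear in x, so its series is shifted and [Q n] is homogeneous of degree n + k. *)
Lemma FplusE k p a (N : V -> Cl R m) (c : R) A : clhom k N -> (m + k.*2 = a.*2.+2)%N ->
  (forall n, gE (fun x => (-1) ^+ (m./2 + i) * (kpoly y h i n x * N x A) + kernel_part y h i n N A x) =
     c * gcoef (sqnorm y) k n * N y A) ->
  Fplus i (fun x => cl_scale (laguerre p a (sqnorm x) * expR (- sqnorm x / 2)) (N x)) y A =
  c * (-1) ^+ p * (laguerre p a (sqnorm y) * expR (- sqnorm y / 2)) * N y A.
Proof.
move=> hN mk hE.
set s := (-1) ^+ _ in hE *.
pose F x := s * (N x A * bessel_sum y h i x) + (- i%:R * (N x A * bessel_sum y h i.-1 x) +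
   cl_mul (cl_wedge x y) (N x) A * bessel_sum y h.+1 i x).
pose Q n x := s * (N x A * kpoly y h i n x) + (- i%:R * (N x A * kpoly y h i.-1 n x) +
   shift_series (fun d x => cl_mul (cl_wedge x y) (N x) A * kpoly y h.+1 i d x) n x).
have pN := clhom_poly A hN; have hW := homf_wedge y A hN.
have sF : series_of F Q.
  apply: series_of_add; first apply: series_of_scale.
    by apply: series_of_mul => //; apply: series_of_bessel_sum; lia.
  apply: series_of_add; first apply: series_of_scale.
    by apply: series_of_mul => //; apply: series_of_bessel_sum; lia.
  apply: series_of_shift; apply: series_of_mul; last exact: homf_polyfun hW.
  by apply: series_of_bessel_sum; lia.
have hQ n : homf (n + k) (Q n).
  have hNk j : homf (n + k) (fun x => N x A * kpoly y h j n x).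
    by rewrite addnC; apply: homf_mul (hN A) (homf_kpoly _ _ _ _).
  apply: homf_add; first exact: homf_scale.
  apply: homf_add; first exact: homf_scale.
  case: n {hNk} => [|n] /=; first exact: homf_zero.
  by rewrite addSnnS addnC; apply: homf_mul hW (homf_kpoly _ _ _ _).
have EQ n : gE (Q n) = c * gcoef (sqnorm y) k n * N y A.
  rewrite -hE; congr gE; apply/funext => x; rewrite /Q /kernel_part; case: n => [|n] /=; ring.
rewrite -(gE_series_laguerre p sF hQ mk EQ) ffunE /gE ffunE; congr (_ * intRn _).
apply/funext => x; rewrite /Kplus cl_mul_kernel fhatE gkerE ftildeE /F /gdens -/s.
move: (s) (bessel_sum y h i x) (bessel_sum y h i.-1 x) (bessel_sum y h.+1 i x) => s' b1 b2 b3.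
move: (laguerre _ _ _) (expR _) (cl_mul _ _ _) (N x A) => *; ring.
Qed.

End Kernel.

(** * Eigenvalues and their parity cases *)

Section Conclusion.
Variable R : realType.

Lemma dfactz_nat n z : z = n%:Z -> dfactz R z = (dfact n)%:R.
Proof. by move=> ->. Qed.

(** At n = 0 the integer is -1, where the convention (-1)!! = 1 agrees with the truncated
    predecessor. *)
Lemma dfactz_pred n z : z = n%:Z - 1 -> dfactz R z = (dfact n.-1)%:R.
Proof. by move=> ->; case: n => [|n] //; rewrite -addn1 PoszD addrK addn1. Qed.

Variables (m i p k : nat) (M : 'rV[R]_m -> Cl R m).
Hypotheses (m2 : (2 <= m)%N) (em : ~~ odd m) (im : (i <= m - 2)%N).
Hypothesis monM : spherical_monogenic k M.

Let h := (m./2).-1.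
Let mh : m = h.*2.+2. Proof. by rewrite /h; lia. Qed.
Let hM : clhom k M. Proof. exact: hom_poly_clhom monM.1. Qed.
Let dM A x : diracf M A x = 0.
Proof. by rewrite -dirac_diracf monM.2 ffunE. Qed.

Let sgm : R := (-1) ^+ (m./2 + i).

(** The term fhat acts through the degree k of M, the rest of the kernel through the degree k + 1 of
    xM; for [psi_odd] the two roles are exchanged. *)
Lemma Fplus_psi_even y : Fplus i (psi_even p k M) y =
  cl_scale ((sgm * kernel_eig R m i k - kernel_eig R m i k.+1) * (-1) ^+ p) (psi_even p k M y).
Proof.
apply/ffunP => A; rewrite /psi_even.
rewrite (@FplusE _ _ y h i mh im k p _ M (sgm * kernel_eig R m i k - kernel_eig R m i k.+1) A hM).
- by rewrite !ffunE; ring.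
- by lia.
move=> n; have pK := polyfun_mul (polyfun_kpoly y h i n) (clhom_poly A hM).
rewrite gE_add; last 2 first.
- exact: polyfun_scale pK.
- exact: polyfun_kernel_part hM.
rewrite gE_scale// (gE_kpoly y n mh im (hM A) (monogenic_harmonic hM dM A)).
by rewrite (gE_kernel_part_monogenic y mh im hM dM) -/sgm; ring.
Qed.

Lemma Fplus_psi_odd y : Fplus i (psi_odd p k M) y =
  cl_scale ((sgm * kernel_eig R m i k.+1 + kernel_eig R m i k) * (-1) ^+ p) (psi_odd p k M y).
Proof.
have hxM := clhom_vmul hM.
apply/ffunP => A; rewrite /psi_odd.
rewrite (@FplusE _ _ y h i mh im k.+1 p _ (vmul M) (sgm * kernel_eig R m i k.+1 + kernel_eig R m i k) A hxM).
- by rewrite !ffunE -/(vmul M y); ring.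
- by lia.
move=> n; have pK := polyfun_mul (polyfun_kpoly y h i n) (clhom_poly A hxM).
rewrite gE_add; last 2 first.
- exact: polyfun_scale pK.
- exact: polyfun_kernel_part hxM.
rewrite gE_scale// (gE_kpoly y n mh im (hxM A) (vmul_harmonic hM dM A)).
by rewrite (gE_kernel_part_vmul y mh im hM dM) -/sgm; ring.
Qed.

End Conclusion.

Unset Implicit Arguments.

Theorem theorem4p3 (R : realType) (m i p k : nat) (M : 'rV[R]_m -> Cl R m) :
  (2 <= m)%N -> ~~ odd m -> (i <= m - 2)%N ->
  spherical_monogenic k M ->
  let sm : R := (-1) ^+ (m./2) in
  let ev := psi_even p k M in
  let od := psi_odd p k M in
  let F := Fplus i in
  let kZ : int := k%:Z in let iZ : int := i%:Z in let mZ : int := m%:Z in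
  [/\
   (* i even, k even *)
   ~~ odd i -> ~~ odd k ->
     (forall y, F ev y = cl_scale (sm * (dfactz R (kZ + iZ - 1) / dfactz R (kZ - iZ + mZ - 3))
                                     * (-1) ^+ p) (ev y)) /\
     (forall y, F od y = cl_scale ((dfactz R (kZ + iZ - 1) / dfactz R (kZ + mZ - iZ - 3))
                                     * (-1) ^+ p) (od y)),
   (* i even, k odd *)
   ~~ odd i -> odd k ->
     (forall y, F ev y = cl_scale ((dfactz R (kZ + iZ) / dfactz R (kZ + mZ - iZ - 2))
                                     * (-1) ^+ p.+1) (ev y)) /\
     (forall y, F od y = cl_scale (sm * (dfactz R (kZ + iZ) / dfactz R (kZ - iZ + mZ - 2))
                                     * (-1) ^+ p) (od y)),
   (* i odd, k even *)
   odd i -> ~~ odd k ->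
     (forall y, F ev y = cl_scale ((dfactz R (kZ + iZ) / dfactz R (kZ + mZ - iZ - 2))
                                     * (-1) ^+ p.+1) (ev y)) /\
     (forall y, F od y = cl_scale (sm * (dfactz R (kZ + iZ) / dfactz R (kZ + mZ - iZ - 2))
                                     * (-1) ^+ p.+1) (od y)) &
   (* i odd, k odd *)
   odd i -> odd k ->
     (forall y, F ev y = cl_scale (sm * (dfactz R (kZ + iZ - 1) / dfactz R (kZ + mZ - iZ - 3))
                                     * (-1) ^+ p.+1) (ev y)) /\
     (forall y, F od y = cl_scale ((dfactz R (kZ + iZ - 1) / dfactz R (kZ + mZ - iZ - 3))
                                     * (-1) ^+ p) (od y))].
Proof.
move=> m2 em im monM sm ev od F kZ iZ mZ.
have hev y : F ev y = _ := Fplus_psi_even p m2 em im monM y.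
have hod y : F od y = _ := Fplus_psi_odd p m2 em im monM y.
have E1 : dfactz R (kZ + iZ - 1) = (dfact (k + i).-1)%:R.
  by apply: dfactz_pred; rewrite PoszD.
have E2 : dfactz R (kZ - iZ + mZ - 3) = (dfact (k + (m - 2 - i)).-1)%:R.
  by apply: dfactz_pred; lia.
have E3 : kZ + mZ - iZ - 3 = kZ - iZ + mZ - 3 by ring.
have F1 : dfactz R (kZ + iZ) = (dfact (k + i))%:R by apply: dfactz_nat; rewrite PoszD.
have F2 : dfactz R (kZ - iZ + mZ - 2) = (dfact (k + (m - 2 - i)))%:R.
  by apply: dfactz_nat; lia.
have F3 : kZ + mZ - iZ - 2 = kZ - iZ + mZ - 2 by ring.
(* Each eigenvalue combines the degrees k and k + 1; this removes one of the two, and [l1] or [l2]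
   evaluates the other. *)
have l0 l : odd (i + l) -> kernel_eig R m i l = 0 by rewrite /kernel_eig => ->.
have l1 : ~~ odd (i + k) -> kernel_eig R m i k = dfactz R (kZ + iZ - 1) / dfactz R (kZ - iZ + mZ - 3).
  by rewrite E1 E2 /kernel_eig => /negPf ->.
have l2 : odd (i + k) -> kernel_eig R m i k.+1 = dfactz R (kZ + iZ) / dfactz R (kZ - iZ + mZ - 2).
  by move=> o; rewrite F1 F2 /kernel_eig addnS /= o.
have sE : (-1) ^+ (m./2 + i) = sm * (-1) ^+ odd i :> R by rewrite exprD signr_odd.
split=> oi ok; split=> y.
- rewrite hev sE l1 ?l0 ?oddD ?addnS /= ?oddD ?(negPf oi) ?(negPf ok)//.
  by congr cl_scale; ring.
- rewrite hod E3 l1 ?l0 ?oddD ?addnS /= ?oddD ?(negPf oi) ?(negPf ok)//.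
  by congr cl_scale; ring.
- rewrite hev F3 l2 ?l0 ?oddD ?addnS /= ?oddD ?(negPf oi) ?ok//.
  by congr cl_scale; rewrite exprS; ring.
- rewrite hod sE l2 ?l0 ?oddD ?addnS /= ?oddD ?(negPf oi) ?ok//.
  by congr cl_scale; ring.
- rewrite hev F3 l2 ?l0 ?oddD ?addnS /= ?oddD ?oi ?(negPf ok)//.
  by congr cl_scale; rewrite exprS; ring.
- rewrite hod F3 sE l2 ?l0 ?oddD ?addnS /= ?oddD ?oi ?(negPf ok)//.
  by congr cl_scale; rewrite exprS; ring.
- rewrite hev E3 sE l1 ?l0 ?oddD ?addnS /= ?oddD ?oi ?ok//.
  by congr cl_scale; rewrite exprS; ring.
- rewrite hod E3 l1 ?l0 ?oddD ?addnS /= ?oddD ?oi ?ok//.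
  by congr cl_scale; ring.
Qed.
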